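(* Let $K$ be a mixed-growth kernel on $\mathbb{R}^d$, let $\mathcal{L}=\mathcal{L}_K$, let $P$ be its heat kernel, and let $T\in(0,\infty)$. There is at most one very weak solution of $\partial_tu+\mathcal{L}u=0$ in $\mathbb{R}^d\times(0,T)$ belonging to $L^\infty((0,T);L^1_{P_1})$ with a given initial trace (a Radon measure); uniqueness is understood up to a.e. equality.
   Context: Mixed-growth kernel: a measurable $K:\mathbb{R}^d\to\mathbb{R}$ such that (a) $K(x)>0$ and $K(x)=K(-x)$ for a.e. $x$, and $\int_{\mathbb{R}^d}\min\{1,|y|^2\}K(y)\,dy<\infty$; and there is a nondecreasing function $\tilde\varphi:(0,\infty)\to(0,\infty)$ (scale function) with (b) $\frac{C^{-1}}{|x|^d\tilde\varphi(|x|)}\le K(x)\le\frac{C}{|x|^d\tilde\varphi(|x|)}$ for all $x\ne0$, for some constant $C>1$; (c) $\lambda_1(R/r)^{\beta_1}\le\tilde\varphi(R)/\tilde\varphi(r)\le\lambda_2(R/r)^{\beta_2}$ for all $0<r\le R<\infty$, for some constants $\lambda_1,\lambda_2>0$ and $\beta_2\ge\beta_1>0$. Operator (acting in the $x$ variable): $\mathcal{L}_Ku(x)=\int_{\mathbb{R}^d}\Big(u(x)-\frac{u(x+y)+u(x-y)}2\Big)K(y)\,dy$. Heat kernel: with $m(\xi)=\int_{\mathbb{R}^d}(1-\cos\langle\xi,y\rangle)K(y)\,dy$, $P_t(x)=P(x,t)$ is, for $t>0$, the continuous probability density on $\mathbb{R}^d$ with $\int_{\mathbb{R}^d}e^{i\langle\xi,x\rangle}P_t(x)\,dx=e^{-tm(\xi)}$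 (it exists, and it is positive). $L^1_{P_1}=\{v\in L^1_{\rm loc}(\mathbb{R}^d):\int_{\mathbb{R}^d}|v|P_1\,dx<\infty\}$; $u\in L^\infty((0,T);L^1_{P_1})$ means $\operatorname{ess\,sup}_{t\in(0,T)}\int_{\mathbb{R}^d}|u(x,t)|P_1(x)\,dx<\infty$. Very weak solution: $u\in L^1_{\rm loc}(\mathbb{R}^d\times(0,T))$ such that, for all $\theta\in C_c^\infty(\mathbb{R}^d\times(0,T))$, $\int_0^T\int_{\mathbb{R}^d}|u||\mathcal{L}\theta|\,dx\,dt<\infty$ and $\int_0^T\int_{\mathbb{R}^d}u(\partial_t\theta-\mathcal{L}\theta)\,dx\,dt=0$. Initial trace: $u\in L^1_{\rm loc}(\mathbb{R}^d\times(0,T))$ has initial trace (initial datum) $\mu_0$, a Radon measure (possibly signed, an element of the dual of $C_c(\mathbb{R}^d)$), if $\operatorname{ess\,lim}_{t\to0^+}\int_{\mathbb{R}^d}\psi(x)u(x,t)\,dx=\int_{\mathbb{R}^d}\psi\,d\mu_0$ for all $\psi\in C_c(\mathbb{R}^d)$. *)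

(* Defs.v *)
From HB Require Import structures.
From mathcomp Require Import all_boot all_order all_algebra.
From mathcomp Require Import all_classical all_reals all_analysis.
From mathcomp Require Import ess_sup_inf.

Set Implicit Arguments.
Unset Strict Implicit.
Unset Printing Implicit Defensive.

Import Order.TTheory GRing.Theory Num.Theory.
Import numFieldNormedType.Exports.

Local Open Scope classical_set_scope.
Local Open Scope ring_scope.

(* The Borel sigma-algebra of R^n, presented as the product sigma-algebra, i.e.
   the one generated by the coordinate functions. *)
Section measurable_rV.
Context {R : realType} {n : nat}.

Definition rV_coord (i : 'I_n) (x : 'rV[R]_n) : R := x ord0 i.

Let rV_set0 : g_sigma_preimage rV_coord set0.
Proof. exact: sigma_algebra0. Qed.

Let rV_setC A : g_sigma_preimage rV_coord A -> g_sigma_preimage rV_coord (~` A).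
Proof. exact: sigma_algebraC. Qed.

Let rV_bigcup (F : (set 'rV[R]_n)^nat) :
  (forall i, g_sigma_preimage rV_coord (F i)) ->
  g_sigma_preimage rV_coord (\bigcup_i (F i)).
Proof. exact: sigma_algebra_bigcup. Qed.

HB.instance Definition _ := @isMeasurable.Build
  (measure_tuple_display default_measure_display)
  'rV[R]_n (g_sigma_preimage rV_coord) rV_set0 rV_setC rV_bigcup.

End measurable_rV.

Section rV_measurable_fun.
Context {R : realType}.

Lemma measurable_rV_coord n (i : 'I_n) :
  measurable_fun [set: 'rV[R]_n] (rV_coord i).
Proof.
move=> _ Y mY; rewrite setTI; apply: sub_sigma_algebra => /=.
rewrite -bigcup_seq/=; exists i => /=; first by rewrite mem_index_enum.
by exists Y => //; rewrite setTI.
Qed.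

Lemma measurable_fun_rVP d (T : measurableType d) n (f : T -> 'rV[R]_n) :
  (forall i, measurable_fun [set: T] (rV_coord i \o f)) ->
  measurable_fun [set: T] f.
Proof.
move=> mf _ A mA; rewrite setTI.
pose G := [set B : set 'rV[R]_n | measurable (f @^-1` B)].
suff: measurable `<=` G by exact.
apply: smallest_sub.
- split => /=.
  + by rewrite /G /= preimage_set0.
  + by move=> B GB; rewrite /G /= setTD -preimage_setC; apply: measurableC.
  + move=> F GF; rewrite /G /= preimage_bigcup.
    exact: bigcupT_measurable.
- move=> B; rewrite -bigcup_seq => -[i _ [C mC <-]].
  rewrite /G /= setTI -comp_preimage -[X in measurable X]setTI.
  exact: mf.
Qed.

(* (a, x) |-> (a, x_0, ..., x_{n-1}) *)
Definition rV_cons n (p : R * 'rV[R]_n) : 'rV[R]_n.+1 :=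
  \row_i (if unlift ord0 i is Some j then p.2 ord0 j else p.1).

Definition rV_uncons n (x : 'rV[R]_n.+1) : R * 'rV[R]_n :=
  (x ord0 ord0, \row_j x ord0 (lift ord0 j)).

Lemma rV_consK n : cancel (@rV_cons n) (@rV_uncons n).
Proof.
move=> [a x]; rewrite /rV_uncons mxE unlift_none; congr pair.
by apply/rowP => j; rewrite !mxE liftK.
Qed.

Lemma measurable_rV_cons n : measurable_fun setT (@rV_cons n).
Proof.
apply: measurable_fun_rVP => i; case: (unliftP ord0 i) => [j|] ->.
  rewrite (_ : _ \o _ = rV_coord j \o snd); last first.
    by apply/funext => p; rewrite /= /rV_coord mxE liftK.
  by apply: measurableT_comp => //; exact: measurable_rV_coord.
rewrite (_ : _ \o _ = fst) //.
by apply/funext => p; rewrite /= /rV_coord mxE unlift_none.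
Qed.

Lemma measurable_rV_uncons n : measurable_fun setT (@rV_uncons n).
Proof.
apply: measurable_fun_pair; first exact: measurable_rV_coord.
apply: measurable_fun_rVP => i.
rewrite (_ : _ \o _ = rV_coord (lift ord0 i)); last first.
  by apply/funext => x; rewrite /= /rV_coord mxE.
exact: measurable_rV_coord.
Qed.

End rV_measurable_fun.

Section lebesgue_rV_step.
Context {R : realType} {n : nat}.
Variable m : {sigma_finite_measure set 'rV[R]_n -> \bar R}.

Let cons : measurableTypeR R * 'rV[R]_n -> 'rV[R]_n.+1 := @rV_cons R n.

Let mcons : measurable_fun setT cons.
Proof. exact: measurable_rV_cons. Qed.

Definition lebesgue_rV_step : set 'rV[R]_n.+1 -> \bar R :=
  pushforward (lebesgue_measure \x m)%E cons.

Let step_measure : {measure set 'rV[R]_n.+1 -> \bar R} :=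
  measure_function_pushforward__canonical__measure_function_Measure
    (lebesgue_measure \x m)%E mcons.

HB.instance Definition _ := isMeasure.Build _ _ _ lebesgue_rV_step
  (measure0 step_measure) (measure_ge0 step_measure)
  (@measure_semi_sigma_additive _ _ _ step_measure).

Let sigma_finite_prod : sigma_finite setT (lebesgue_measure \x m)%E.
Proof.
have /sigma_finiteP[F [TF ndF Foo]] := sigma_finiteT (@lebesgue_measure R).
have /sigma_finiteP[G [TG ndG Goo]] := sigma_finiteT m.
exists (fun k => F k `*` G k).
  rewrite -setXTT TF TG predeqE => -[x y]; split.
    move=> [/= [k _ Fkx] [l _ Gly]]; exists (maxn k l) => //; split.
    - by move: x Fkx; exact/subsetPset/ndF/leq_maxl.
    - by move: y Gly; exact/subsetPset/ndG/leq_maxr.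
  by move=> [k _ []/= ? ?]; split; exists k.
move=> k; have [? ?] := Foo k; have [? ?] := Goo k.
split; first exact: measurableX.
by rewrite product_measure1E// lte_mul_pinfty// ge0_fin_numE.
Qed.

Let sigma_finite_step : sigma_finite setT lebesgue_rV_step.
Proof.
have [F TF Foo] := sigma_finite_prod.
exists (fun k => @rV_uncons R n @^-1` F k).
  by rewrite -preimage_bigcup -TF preimage_setT.
move=> k; have [mF Fk] := Foo k; split.
  by rewrite -[X in measurable X]setTI; exact: measurable_rV_uncons.
rewrite /lebesgue_rV_step /pushforward -comp_preimage.
rewrite (_ : _ \o _ = id) ?preimage_id//.
by apply/funext => p; exact: rV_consK.
Qed.

HB.instance Definition _ := Measure_isSigmaFinite.Build _ _ _ lebesgue_rV_step
  sigma_finite_step.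

End lebesgue_rV_step.

(* Lebesgue measure on R^n, by iterating the product with Lebesgue measure on
   R; on the one-point space R^0 it is the unit mass. *)
Fixpoint lebesgue_rV {R : realType} (n : nat) :
    {sigma_finite_measure set 'rV[R]_n -> \bar R} :=
  if n is k.+1 then lebesgue_rV_step (lebesgue_rV k) else \d_(0 : 'rV[R]_0).

Lemma lebesgue_rV_box (R : realType) n (A : 'I_n -> set R) :
  (forall i, measurable (A i)) ->
  lebesgue_rV n [set x : 'rV[R]_n | forall i, A i (x ord0 i)] =
  (\prod_(i < n) lebesgue_measure (A i))%E.
Proof.
elim: n A => [|n ih] A mA.
  by rewrite big_ord0 /= diracE mem_set//= => -[].
rewrite big_ord_recl /= /lebesgue_rV_step /pushforward.
rewrite (_ : _ @^-1` _ = A ord0 `*`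
  [set x : 'rV[R]_n | forall i, A (lift ord0 i) (x ord0 i)]); last first.
  apply/seteqP; split=> -[a x] /=.
    move=> H; split; first by have := H ord0; rewrite mxE unlift_none.
    by move=> i; have := H (lift ord0 i); rewrite mxE liftK.
  move=> [Aa H] i; rewrite mxE.
  by case: unliftP => [j|] ->.
rewrite product_measure1E//; [by congr (_ * _)%E; exact: ih|exact: mA|].
rewrite (_ : [set _ | _] = \bigcap_(i in [set: 'I_n])
  (@rV_coord R n i @^-1` A (lift ord0 i))); last first.
  by apply/seteqP; split=> [x H i _|x H i]; apply: H.
apply: fin_bigcap_measurable; first exact: finite_finset.
move=> i _.
rewrite -[X in measurable X]setTI.
exact: measurable_rV_coord.
Qed.

Section kernels.
Context {R : realType} {d : nat}.
Implicit Types (x y xi : 'rV[R]_d) (K : 'rV[R]_d -> R).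

Definition dotv x y : R := \sum_(i < d) x ord0 i * y ord0 i.

(* The library's norm on 'rV[R]_d is the sup norm. *)
Definition enorm x : R := Num.sqrt (dotv x x).

Definition mixed_growth_kernel K : Prop :=
  [/\ measurable_fun setT K,
      {ae lebesgue_rV d, forall x, 0 < K x /\ K x = K (- x)},
      (\int[lebesgue_rV d]_y (Num.min 1 (enorm y ^+ 2) * K y)%:E < +oo)%E &
      exists phi : R -> R,
      [/\ forall r, 0 < r -> 0 < phi r,
          forall r s, 0 < r -> r <= s -> phi r <= phi s,
          exists2 C : R, 1 < C &
            forall x, x != 0 ->
              C^-1 / (enorm x ^+ d * phi (enorm x)) <= K x
                <= C / (enorm x ^+ d * phi (enorm x)) &
          exists l1 l2 b1 b2 : R,
            [/\ 0 < l1, 0 < l2, 0 < b1, b1 <= b2 &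
              forall r s, 0 < r -> r <= s ->
                l1 * (s / r) `^ b1 <= phi s / phi r <= l2 * (s / r) `^ b2]]].

Definition nonlocal_op K (u : 'rV[R]_d -> R) x : R :=
  \int[lebesgue_rV d]_y ((u x - (u (x + y) + u (x - y)) / 2) * K y).

Definition levy_symbol K xi : R :=
  \int[lebesgue_rV d]_y ((1 - cos (dotv xi y)) * K y).

(* The last two clauses are the real and imaginary parts of
   int e^{i<xi,x>} P_t(x) dx = e^{-t m(xi)}. *)
Definition is_heat_kernel K (P : R -> 'rV[R]_d -> R) : Prop :=
  forall t, 0 < t ->
  [/\ continuous (P t),
      forall x, 0 <= P t x,
      (\int[lebesgue_rV d]_x (P t x)%:E = 1)%E,
      forall xi, \int[lebesgue_rV d]_x (cos (dotv xi x) * P t x) =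
                 expR (- (t * levy_symbol K xi)) &
      forall xi, \int[lebesgue_rV d]_x (sin (dotv xi x) * P t x) = 0].

End kernels.

Section function_spaces.
Context {R : realType}.

Definition csupport (V : topologicalType) (f : V -> R) : set V :=
  closure [set x | f x != 0].

Fixpoint iter_derive (V : normedModType R) (vs : seq V) (f : V -> R) : V -> R :=
  if vs is v :: vs' then fun x => 'D_v (iter_derive vs' f) x else f.

Definition smooth (V : normedModType R) (f : V -> R) : Prop :=
  forall (vs : seq V) (x : V), differentiable (iter_derive vs f) x.

(* C_c^oo(U), the functions being extended by 0 outside U. *)
Definition test_function (V : normedModType R) (U : set V) (f : V -> R) : Prop :=
  [/\ smooth f, compact (csupport f) & csupport f `<=` U].

Definition Cc (V : topologicalType) (f : V -> R) : Prop :=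
  continuous f /\ compact (csupport f).

End function_spaces.

(* Signed Radon measures, as the dual of C_c(R^d): continuity for the inductive
   limit topology is boundedness on the functions supported in a given
   compact set. *)
Record radon_measure (R : realType) (d : nat) := RadonMeasure {
  radon_int :> ('rV[R]_d -> R) -> R ;
  radon_int_linear : forall (a : R) (f g : 'rV[R]_d -> R), Cc f -> Cc g ->
    radon_int (fun x => a * f x + g x) = a * radon_int f + radon_int g ;
  radon_int_bounded : forall C : set 'rV[R]_d, compact C ->
    exists M : R, forall (f : 'rV[R]_d -> R) (B : R),
      Cc f -> csupport f `<=` C -> (forall x, `|f x| <= B) ->
      `|radon_int f| <= M * B
}.

Section equation.
Context {R : realType} {d : nat}.
Implicit Types (K : 'rV[R]_d -> R) (P : R -> 'rV[R]_d -> R) (T : R).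
Implicit Types u : 'rV[R]_d * R -> R.

(* Lebesgue measure on R^d x R *)
Definition lebesgue_xt :
    {measure set ('rV[R]_d * measurableTypeR R)%type -> \bar R} :=
  (lebesgue_rV d \x lebesgue_measure)%E.

Definition cylinder T : set ('rV[R]_d * R) := [set: 'rV[R]_d] `*` `]0, T[.

Definition L1loc_cylinder T u : Prop :=
  measurable_fun (cylinder T) u /\
  forall C, compact C -> C `<=` cylinder T ->
    lebesgue_xt.-integrable C (EFin \o u).

Definition nonlocal_op_x K (theta : 'rV[R]_d * R -> R) (z : 'rV[R]_d * R) : R :=
  nonlocal_op K (fun x => theta (x, z.2)) z.1.

Definition time_derive (theta : 'rV[R]_d * R -> R) (z : 'rV[R]_d * R) : R :=
  derive1 (fun t => theta (z.1, t)) z.2.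

Definition very_weak_solution K T u : Prop :=
  L1loc_cylinder T u /\
  forall theta, test_function (cylinder T) theta ->
    (\int[lebesgue_xt]_(z in cylinder T)
       (`|u z| * `|nonlocal_op_x K theta z|)%:E < +oo)%E /\
    \int[lebesgue_xt]_(z in cylinder T)
       (u z * (time_derive theta z - nonlocal_op_x K theta z)) = 0.

Definition Linfty_L1P1 P T u : Prop :=
  (ess_sup (mrestr lebesgue_measure (measurable_itv `]0%R, T[))
     (fun t => \int[lebesgue_rV d]_x (`|u (x, t)| * P 1 x)%:E) < +oo)%E.

Definition ess_cvg_at0 (g : R -> R) (l : R) : Prop :=
  exists2 N : set R, lebesgue_measure.-negligible N &
    g @ within (~` N) 0^'+ --> l.

Definition has_initial_trace u (mu0 : radon_measure R d) : Prop :=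
  forall psi : 'rV[R]_d -> R, Cc psi ->
    ess_cvg_at0 (fun t => \int[lebesgue_rV d]_x (psi x * u (x, t))) (mu0 psi).

End equation.

(* Main.v *)
Require Import Defs.
From HB Require Import structures.
From mathcomp Require Import all_boot all_order all_algebra.
From mathcomp Require Import all_classical all_reals all_analysis.
From mathcomp Require Import ess_sup_inf measurable_realfun.
From mathcomp Require Import ring lra.

Set Implicit Arguments.
Unset Strict Implicit.
Unset Printing Implicit Defensive.

Import Order.TTheory GRing.Theory Num.Theory.
Import numFieldNormedType.Exports.

Local Open Scope classical_set_scope.
Local Open Scope ring_scope.

(** Let [w] be the difference of the two solutions: it solves the equation
    with zero initial trace, and [int |w(y,t)| P_1(y) dy] is bounded in [t].
    The claim is [w = 0].

    The weight. Up to constants [K(y)] is [a(|y|)], where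
    [a(r) = 1 / (r^d phi(r))] is nonincreasing and doubling
    ([mixed_growth_profile]). The function [om(x) = a(1 + |x|)] is integrable
    and almost constant at unit scale, and [P_1 >= c om] ([heat_lower]): a walk
    that starts at 0 stays in a fixed ball with probability at least 1/2 while
    it performs its small jumps, and one big jump then reaches a neighbourhood
    of [x] with density at least a multiple of [om(x)]. As only the Fourier
    transform of [P_1] is given, this bound is passed to the limit along
    compound Poisson walks by testing with products of the functions
    [1 / (1 + u^2)], which are averages of cosines. Hence [int |w(.,t)| om] is
    bounded in [t].

    The estimate. For [0 < e <= 1] put [lam = int_(|y| > e) K] and
    [m = int_(|y| <= e) |y|^2 K], so that [m] tends to 0 with [e] while [lam]
    may blow up. For a bump [psi], the function
    [h(x,t) = int w(y,t) psi(x - y) dy] satisfies for each fixed [x], in the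
    weak sense, [(e^(lam t) h)' = - e^(lam t) b], where
    [b = w * (L psi - lam psi)] consists of [w * near psi], of size [m], and of
    minus the convolution of [h] with the part of [K] outside the ball of radius
    [e]. As [h] starts from 0,
    [(kap + lam) int e^(-kap t) |h| dt <= int e^(-kap t) |b| dt]
    ([time_estimate]). This is integrated in [x] against a regularization [Om]
    of [om], for which the convolution with the far part of [K] is at most
    [(lam + C1) Om] with [C1] independent of [e] ([far_convolve_Om]). With [J]
    the integral of [Om e^(-kap t) |h|] over space and time and [W] a bound of
    [int |w(.,t)| om], the result is
    [(kap + lam) J <= c m W T + (lam + C1) J]. The large number [lam] cancels;
    with [kap = C1 + 1], [J <= c m W T], and [J = 0] on letting [e] tend to 0
    ([mollify_ae0]). No dual problem has to be solved, and [w] is never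
    differentiated.

    All mollifications of [w(.,t)] thus vanish for almost every [t], which
    forces [w = 0] ([mollify_injective]). *)

(** * Measurability and integration on row vectors *)

Section norm_rV.
Context {R : realType} {n : nat}.
Implicit Type x : 'rV[R]_n.

Lemma rV_norm_leP x (e : R) : 0 <= e ->
  `|x| <= e <-> forall i, `|x ord0 i| <= e.
Proof.
move=> e0; rewrite /Num.Def.normr/= mx_normrE; split.
  by move/bigmax_leP => [_ h] i; exact: (h (ord0, i)).
by move=> h; apply/bigmax_leP; split => // -[i j] _ /=; rewrite ord1 h.
Qed.

Lemma rV_norm_ltP x (e : R) : 0 < e ->
  `|x| < e <-> forall i, `|x ord0 i| < e.
Proof.
move=> e0; rewrite /Num.Def.normr/= mx_normrE; split.
  by move/bigmax_ltP => [_ h] i; exact: (h (ord0, i)).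
by move=> h; apply/bigmax_ltP; split => // -[i j] _ /=; rewrite ord1 h.
Qed.

Lemma rV_coord_le_norm x i : `|x ord0 i| <= `|x|.
Proof. by have [+ _] := rV_norm_leP x (normr_ge0 x); apply. Qed.

End norm_rV.

Section measurability_rV.
Context {R : realType}.

Lemma measurable_rV_box n (A : 'I_n -> set R) : (forall i, measurable (A i)) ->
  measurable [set x : 'rV[R]_n | forall i, A i (x ord0 i)].
Proof.
move=> mA; rewrite (_ : [set _ | _] = \bigcap_(i in [set: 'I_n])
  (@rV_coord R n i @^-1` A i)); last first.
  by apply/seteqP; split=> [x H i _|x H i]; apply: H.
apply: fin_bigcap_measurable; first exact: finite_finset.
by move=> i _; rewrite -[X in measurable X]setTI; exact: measurable_rV_coord.
Qed.

(** The sigma-algebra is generated by the coordinates, so an open set has to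
    be written as a countable union of boxes, here with rational centres and
    radii [1 / (k + 1)]. *)
Lemma open_measurable_rV n (U : set 'rV[R]_n) : open U -> measurable U.
Proof.
move=> oU.
pose B (p : nat * 'rV[rat]_n) : set 'rV[R]_n :=
  [set x | forall i, ball (ratr (p.2 ord0 i) : R) p.1.+1%:R^-1 (x ord0 i)].
rewrite (_ : U = \bigcup_(p in [set p | B p `<=` U]) B p); last first.
  apply/seteqP; split => [x Ux|x [p /= BU] /BU//].
  have /nbhs_ballP[e /= e0 xeU] := open_nbhs_nbhs (conj oU Ux).
  have [k ke] : exists k : nat, k.+1%:R^-1 < e / 2.
    have e20 : 0 < e / 2 by rewrite divr_gt0.
    have [k /ltW] := ltr_add_invr e20.
    rewrite add0r => h; exists k.+1; apply: lt_le_trans h.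
    by rewrite ltf_pV2 ?posrE// ltr_nat.
  have q i : {q : rat | `|x ord0 i - ratr q| < k.+1%:R^-1}.
    apply: cid; have lt1 : x ord0 i - k.+1%:R^-1 < x ord0 i + k.+1%:R^-1.
      by rewrite ltrD2l gtrN// invr_gt0.
    have [q /=] := rat_in_itvoo lt1.
    rewrite in_itv/= => /andP[q1 q2]; exists q.
    by rewrite distrC ltr_distl q1 q2.
  exists (k, \row_i sval (q i)) => /=.
    move=> y By; apply: xeU; rewrite -ball_normE /ball_/=.
    apply/rV_norm_ltP => // j.
    have := By j; rewrite /ball/= mxE => yj.
    have := svalP (q j) => xj.
    rewrite !mxE -[x _ _](subrK (ratr (sval (q j)))) -addrA.
    by rewrite (le_lt_trans (ler_normD _ _))// (splitr e) ltrD// (lt_trans _ ke).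
  by move=> i; rewrite /ball/= mxE distrC; exact: svalP (q i).
rewrite bigcup_mkcond; apply: countable_bigcupT_measurable => // p; case: ifP => // _; 
apply: (@measurable_rV_box _ (fun i => ball (ratr (p.2 ord0 i) : R) p.1.+1%:R^-1)) => i.
by rewrite ball_itv; exact: measurable_itv.
Qed.

Lemma continuous_measurable_rV n (f : 'rV[R]_n -> R) : continuous f ->
  measurable_fun setT f.
Proof.
move=> /continuousP cf; apply: (measurability _ (RGenOpens.measurableE R)).
move=> _ [_ [a [b ->] <-]]; rewrite setTI; apply: open_measurable_rV.
exact/cf/interval_open.
Qed.

Lemma measurable_norm_rV n : measurable_fun setT (fun x : 'rV[R]_n => `|x|).
Proof. apply: continuous_measurable_rV; exact: norm_continuous. Qed.

Context d (T : measurableType d).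

Lemma measurable_rVD n (f g : T -> 'rV[R]_n) : measurable_fun setT f ->
  measurable_fun setT g -> measurable_fun setT (fun x => f x + g x).
Proof.
move=> mf mg; apply: measurable_fun_rVP => i.
rewrite (_ : _ \o _ = (rV_coord i \o f) \+ (rV_coord i \o g)); last first.
  by apply/funext => x; rewrite /= /rV_coord mxE.
by apply: measurable_funD; apply: measurableT_comp => //;
  exact: measurable_rV_coord.
Qed.

Lemma measurable_rVN n (f : T -> 'rV[R]_n) : measurable_fun setT f ->
  measurable_fun setT (fun x => - f x).
Proof.
move=> mf; apply: measurable_fun_rVP => i.
rewrite (_ : _ \o _ = \- (rV_coord i \o f)); last first.
  by apply/funext => x; rewrite /= /rV_coord mxE.
by apply: measurable_funN; apply: measurableT_comp => //;
  exact: measurable_rV_coord.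
Qed.

Lemma measurable_rVB n (f g : T -> 'rV[R]_n) : measurable_fun setT f ->
  measurable_fun setT g -> measurable_fun setT (fun x => f x - g x).
Proof. by move=> mf mg; apply: measurable_rVD => //; exact: measurable_rVN. Qed.

End measurability_rV.

Section partial_integrals.
Context d1 d2 (T1 : measurableType d1) (T2 : measurableType d2) {R : realType}.
Variables (m1 : {sigma_finite_measure set T1 -> \bar R})
  (m2 : {sigma_finite_measure set T2 -> \bar R}).
Local Open Scope ereal_scope.
Variable f : T1 -> T2 -> \bar R.
Hypothesis mf : measurable_fun setT (fun z : T1 * T2 => f z.1 z.2).
Hypothesis f0 : forall x y, 0 <= f x y.

Lemma measurable_int_snd :
  measurable_fun setT (fun x : T1 => \int[m2]_y f x y : \bar R).
Proof. exact: (@measurable_fun_fubini_tonelli_F _ _ _ _ _ m2 _ mf (fun z => f0 z.1 z.2)). Qed.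

Lemma measurable_int_fst :
  measurable_fun setT (fun y : T2 => \int[m1]_x f x y : \bar R).
Proof. exact: (@measurable_fun_fubini_tonelli_G _ _ _ _ _ m1 _ mf (fun z => f0 z.1 z.2)). Qed.

Lemma tonelli_swap :
  \int[m1]_x \int[m2]_y f x y = \int[m2]_y \int[m1]_x f x y.
Proof. exact: (@fubini_tonelli _ _ _ _ _ m1 m2 _ mf (fun z => f0 z.1 z.2)). Qed.

Lemma tonelli_prod : \int[m1 \x m2]_z f z.1 z.2 = \int[m1]_x \int[m2]_y f x y.
Proof. exact: (fubini_tonelli1 _ mf (fun z => f0 z.1 z.2)). Qed.

End partial_integrals.

Section invariance.
Context {R : realType}.
Local Open Scope ereal_scope.
Notation leb := (@lebesgue_measure R).

Lemma ge0_integral_shiftR (f : R -> \bar R) (a : R) :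
  measurable_fun setT f -> (forall x, 0 <= f x) ->
  \int[leb]_x f (x + a)%R = \int[leb]_x f x.
Proof.
move=> mf f0.
have mD : measurable_fun setT (fun x : measurableTypeR R => (x + a)%R : measurableTypeR R).
  by apply: measurable_funD.
have := ge0_integral_pushforward mD leb measurableT mf (fun y _ => f0 y).
rewrite preimage_setT /comp => <-.
apply: eq_measure_integral => A mA _; apply/esym.
apply: lebesgue_measure_unique mA => X [[u v] _ <-] /=.
rewrite /pushforward (_ : _ @^-1` _ = [set` `](u - a)%R, (v - a)%R]]).
  rewrite !lebesgue_measure_itv/= !lte_fin ltrD2r.
  by case: ifPn => //= _; rewrite -!EFinD; congr EFin; rewrite opprB addrA subrK.
by apply/seteqP; split => x /=; rewrite !in_itv/= ltrBlDr lerBrDr.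
Qed.

Lemma ge0_integral_oppR (f : R -> \bar R) :
  measurable_fun setT f -> (forall x, 0 <= f x) ->
  \int[leb]_x f (- x)%R = \int[leb]_x f x.
Proof.
move=> mf f0.
have mN : measurable_fun setT (-%R : measurableTypeR R -> measurableTypeR R).
  exact: measurable_funN.
have := ge0_integral_pushforward mN leb measurableT mf (fun y _ => f0 y).
rewrite preimage_setT /comp => <-.
by apply: eq_measure_integral => A mA _; exact: lebesgue_measureN.
Qed.

(** The measure in dimension [n + 1] is the image of a product measure; this
    form of Tonelli's theorem drives the inductions on the dimension below. *)
Lemma ge0_integral_rVS n (f : 'rV[R]_n.+1 -> \bar R) :
  measurable_fun setT f -> (forall x, 0 <= f x) ->
  \int[lebesgue_rV n.+1]_x f x =
  \int[leb]_a \int[lebesgue_rV n]_x f (rV_cons (a, x)).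
Proof.
move=> mf f0.
rewrite [LHS](_ : _ = \int[pushforward (leb \x lebesgue_rV n) (@rV_cons R n)]_x f x)//.
rewrite ge0_integral_pushforward//; last exact: measurable_rV_cons.
rewrite preimage_setT fubini_tonelli1//; last by move=> x; exact: f0.
by apply: measurableT_comp => //; exact: measurable_rV_cons.
Qed.

Lemma ge0_integral_rV_shift n (f : 'rV[R]_n -> \bar R) a :
  measurable_fun setT f -> (forall x, 0 <= f x) ->
  \int[lebesgue_rV n]_x f (x + a)%R = \int[lebesgue_rV n]_x f x.
Proof.
elim: n => [|n ih] in f a *; move=> mf f0.
  by apply: eq_integral => x _; congr f; apply/rowP => -[].
have mD : measurable_fun setT (fun x : 'rV[R]_n.+1 => (x + a)%R).
  by apply: measurable_rVD => //; exact: measurable_id.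
rewrite [LHS]ge0_integral_rVS; [|exact: measurableT_comp|by []].
rewrite [RHS]ge0_integral_rVS; [|exact: mf|exact: f0].
pose F (b : R) : \bar R := \int[lebesgue_rV n]_x f (rV_cons (b, x)).
have mF : measurable_fun setT F.
  apply: (@measurable_int_snd _ _ _ _ _ _ (fun (b : R) (x : 'rV[R]_n) => f (rV_cons (b, x)))) => //.
  rewrite (_ : (fun _ => _) = f \o @rV_cons R n); last by apply/funext => -[].
  by apply: measurableT_comp => //; exact: measurable_rV_cons.
transitivity (\int[leb]_b F (b + a ord0 ord0)%R); last first.
  by rewrite ge0_integral_shiftR// => b; exact: integral_ge0.
apply: eq_integral => b _; rewrite /F.
rewrite -[RHS](ih _ (\row_j a ord0 (lift ord0 j))%R).
- apply: eq_integral => x _; congr f; apply/rowP => i.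
  by rewrite !mxE/=; case: unliftP => [j|] ->; rewrite ?mxE.
- apply: measurableT_comp => //; apply: measurableT_comp => //.
  exact: measurable_rV_cons.
- by [].
Qed.

Lemma ge0_integral_rV_opp n (f : 'rV[R]_n -> \bar R) :
  measurable_fun setT f -> (forall x, 0 <= f x) ->
  \int[lebesgue_rV n]_x f (- x)%R = \int[lebesgue_rV n]_x f x.
Proof.
elim: n => [|n ih] in f *; move=> mf f0.
  by apply: eq_integral => x _; congr f; apply/rowP => -[].
have mD : measurable_fun setT (fun x : 'rV[R]_n.+1 => (- x)%R).
  by apply: measurable_rVN; exact: measurable_id.
rewrite [LHS]ge0_integral_rVS; [|exact: measurableT_comp|by []].
rewrite [RHS]ge0_integral_rVS; [|exact: mf|exact: f0].
pose F (b : R) : \bar R := \int[lebesgue_rV n]_x f (rV_cons (b, x)).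
have mF : measurable_fun setT F.
  apply: (@measurable_int_snd _ _ _ _ _ _ (fun (b : R) (x : 'rV[R]_n) => f (rV_cons (b, x)))) => //.
  rewrite (_ : (fun _ => _) = f \o @rV_cons R n); last by apply/funext => -[].
  by apply: measurableT_comp => //; exact: measurable_rV_cons.
transitivity (\int[leb]_b F (- b)%R); last first.
  by rewrite ge0_integral_oppR// => b; exact: integral_ge0.
apply: eq_integral => b _; rewrite /F.
rewrite -[RHS]ih.
- apply: eq_integral => x _; congr f; apply/rowP => i.
  by rewrite !mxE/=; case: unliftP => [j _|_]; rewrite ?mxE.
- apply: measurableT_comp => //; apply: measurableT_comp => //.
  exact: measurable_rV_cons.
- by [].
Qed.

End invariance.

(** [meas] proves measurability along the syntax of a function. Atoms are
    looked up in the context, so the measurability of kernels and weights is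
    introduced there before a call. *)
Ltac meas_hyp :=
  match goal with
  | H : measurable_fun _ ?f |- measurable_fun _ ?f => exact: H
  end.
Ltac meas_step :=
  lazymatch goal with
  | |- measurable_fun _ (fun _ => EFin _) => apply/measurable_EFinP
  | |- measurable_fun _ (fun _ => (_ * _)%R) =>
      first [apply: measurable_funM | apply: emeasurable_funM]
  | |- measurable_fun _ (fun _ => (_ * _)%E) => apply: emeasurable_funM
  | |- measurable_fun _ (fun _ => (_ + _)%R) =>
      first [apply: measurable_funD | apply: measurable_rVD
            | apply: emeasurable_funD]
  | |- measurable_fun _ (fun _ => (_ + _)%E) => apply: emeasurable_funD
  | |- measurable_fun _ (fun _ => (- _)%R) =>
      first [apply: measurable_funN | apply: measurable_rVN]
  | |- measurable_fun _ (-%R) =>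
      first [apply: measurable_funN; exact: measurable_id
            | apply: measurable_rVN; exact: measurable_id]
  | |- measurable_fun _ (fun _ => (_ ^+ _)%R) => apply: measurable_funX
  | |- measurable_fun _ (fun x => Num.min (@?f x) (@?g x)) =>
      apply: (measurable_minr (f := f) (g := g))
  | |- measurable_fun _ (fun x => `| @?f x |%R) =>
      first [apply: (measurableT_comp (@measurable_norm_rV _ _))
            | apply: (measurableT_comp (@normr_measurable _ setT))]
  | |- measurable_fun _ Num.Def.normr =>
      first [exact: measurable_norm_rV | exact: normr_measurable]
  | |- measurable_fun _ (\1_ _) => exact: measurable_indic
  | |- measurable_fun _ (fun x => x) => exact: measurable_id
  | |- measurable_fun _ (fun x => x.1) => exact: measurable_fst
  | |- measurable_fun _ (fun x => x.2) => exact: measurable_snd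
  | |- measurable_fun _ (fun _ => ?c) => exact: measurable_cst
  | |- measurable_fun _ (fun x => ?F (@?g x)) =>
      apply: (@measurableT_comp _ _ _ _ _ _ F _ g);
      first (first [meas_hyp | exact: measurable_indic | by []])
  end.
Ltac meas :=
  repeat lazymatch goal with
  | |- measurable_fun _ _ => first [meas_hyp | meas_step]
  | |- _ => by []
  end.

Section real_ge0_integrals.
Context d (T : measurableType d) {R : realType}.
Variable m : {measure set T -> \bar R}.
Implicit Types f g : T -> R.

Lemma ge0_intZ (k : R) f : 0 <= k -> measurable_fun setT f ->
  (forall x, 0 <= f x) ->
  (\int[m]_x (k * f x)%:E = k%:E * \int[m]_x (f x)%:E)%E.
Proof.
move=> k0 mf f0; under eq_integral do rewrite EFinM.
by rewrite ge0_integralZl//; [meas|move=> x _; rewrite lee_fin].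
Qed.

Lemma ge0_intD f g : measurable_fun setT f -> measurable_fun setT g ->
  (forall x, 0 <= f x) -> (forall x, 0 <= g x) ->
  (\int[m]_x (f x + g x)%:E = \int[m]_x (f x)%:E + \int[m]_x (g x)%:E)%E.
Proof.
move=> mf mg f0 g0; under eq_integral do rewrite EFinD.
by rewrite ge0_integralD//; [move=> x _; rewrite lee_fin|meas
  |move=> x _; rewrite lee_fin|meas].
Qed.

Lemma ge0_intle f g : measurable_fun setT f -> measurable_fun setT g ->
  (forall x, 0 <= f x) -> (forall x, f x <= g x) ->
  (\int[m]_x (f x)%:E <= \int[m]_x (g x)%:E)%E.
Proof.
move=> mf mg f0 fg; apply: ge0_le_integral => //.
- by move=> x _; rewrite lee_fin.
- by meas.
- by meas.
- by move=> x _; rewrite lee_fin.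
Qed.

Lemma int_ge0 f : (forall x, 0 <= f x) -> (0 <= \int[m]_x (f x)%:E)%E.
Proof. by move=> f0; apply: integral_ge0 => x _; rewrite lee_fin. Qed.

End real_ge0_integrals.

Section rV_integrals.
Context {R : realType} {d : nat}.
Notation mu := (@lebesgue_rV R d).
Local Open Scope ereal_scope.

Lemma lebesgue_rV_ball_fin (r : R) :
  mu [set x : 'rV[R]_d | (`|x| <= r)%R] < +oo.
Proof.
have [r0|r0] := ltP r 0%R.
  rewrite (_ : [set _ | _] = set0) ?measure0//.
  by apply/seteqP; split => x //= /le_lt_trans /(_ r0); rewrite normr_lt0.
rewrite (_ : [set _ | _] =
  [set x : 'rV[R]_d | forall i, (fun=> `[(- r)%R, r]%classic) i (x ord0 i)]).
  rewrite (@lebesgue_rV_box R d (fun=> `[(- r)%R, r]%classic)); last first.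
    by move=> i; exact: measurable_itv.
  rewrite ltey_eq; apply/orP; left.
  elim/big_ind: _ => [//|x y xfin yfin|i _]; first exact: fin_numM.
  by rewrite lebesgue_measure_itv/=; case: ifP.
apply/seteqP; split => x /=.
  by move=> /(rV_norm_leP _ r0) h i; rewrite in_itv/= -ler_norml.
by move=> h; apply/(rV_norm_leP _ r0) => i; rewrite ler_norml; have := h i; rewrite in_itv.
Qed.

Lemma measurable_rV_ball (r : R) : measurable [set x : 'rV[R]_d | (`|x| <= r)%R].
Proof.
rewrite -[X in measurable X]setTI.
apply: (measurable_norm_rV (n := d) measurableT (Y := [set y : R | (y <= r)%R])).
rewrite (_ : [set _ | _] = `]-oo, r]%classic) //.
Qed.

End rV_integrals.


(** * The profile and the weight of a mixed-growth kernel *)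

Section doubling_profile.
Context {R : realType}.
Variables (a : R -> R) (D : R).
Hypothesis a_ninc : forall r s, 0 < r -> r <= s -> a s <= a r.
Hypothesis D1 : 1 <= D.
Hypothesis a_dbl : forall r, 0 < r -> a r <= D * a (2 * r).

Lemma a_scale k r : 0 < r -> a r <= D ^+ k * a (2 ^+ k * r).
Proof.
move=> r0; elim: k => [|k ih]; first by rewrite !expr0 !mul1r.
rewrite (le_trans ih)// exprSr -mulrA ler_wpM2l ?exprn_ge0//.
  by rewrite (le_trans _ D1).
by rewrite [2 ^+ _.+1]exprS -mulrA a_dbl// mulr_gt0// exprn_gt0.
Qed.

(** The doubling inequality, iterated about [log_2 A] times. *)
Lemma a_factor (A : R) : exists2 B : R, 0 < B &
  forall r s, 0 < r -> 0 < s -> s <= A * r -> a r <= B * a s.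
Proof.
have [k Ak] : exists k : nat, A <= 2 ^+ k.
  have /archi_boundP/ltW Ab := normr_ge0 A.
  exists (Num.bound `|A|); rewrite (le_trans (ler_norm _))// (le_trans Ab)//.
  by rewrite -natrX ler_nat ltnW// ltn_expl.
exists (D ^+ k); first by rewrite exprn_gt0// (lt_le_trans _ D1).
move=> r s r0 s0 sA; rewrite (le_trans (a_scale k r0))//.
rewrite ler_wpM2l ?exprn_ge0 ?(le_trans _ D1)// a_ninc//.
by rewrite (le_trans sA)// ler_wpM2r// ltW.
Qed.

End doubling_profile.

(** What the argument retains of a mixed-growth kernel, with [a r] standing
    for [1 / (r^d phi r)]: the upper scaling bound on [phi] is reduced to
    doubling, and the sup norm replaces the Euclidean one. *)
Record kernel_profile {R : realType} {d : nat} (a : R -> R) (D C : R)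
    (K : 'rV[R]_d -> R) : Prop := KernelProfile {
  kp_gt0 : forall r, 0 < r -> 0 < a r ;
  kp_ninc : forall r s, 0 < r -> r <= s -> a s <= a r ;
  kp_D1 : 1 <= D ;
  kp_dbl : forall r, 0 < r -> a r <= D * a (2 * r) ;
  kp_C0 : 0 < C ;
  kp_meas : measurable_fun setT K ;
  kp_even : {ae lebesgue_rV d, forall y, K y = K (- y)} ;
  kp_int : (\int[lebesgue_rV d]_y (Num.min 1 (`|y| ^+ 2) * K y)%:E < +oo)%E ;
  kp_bound : forall y, y != 0 -> C^-1 * a `|y| <= K y <= C * a `|y| }.

Section kernel_weight.
Context {R : realType} {d : nat}.
Notation mu := (@lebesgue_rV R d).
Variables (a : R -> R) (D C : R) (K : 'rV[R]_d -> R).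
Hypothesis kp : kernel_profile a D C K.
Let a_gt0 := kp_gt0 kp.
Let a_ninc := kp_ninc kp.
Let D1 := kp_D1 kp.
Let a_dbl := kp_dbl kp.
Let C0 := kp_C0 kp.
Let mK := kp_meas kp.
Let Keven := kp_even kp.
Let Kint := kp_int kp.
Let Kbd := kp_bound kp.
Let a_factor := a_factor a_ninc D1 a_dbl.

(** Comparable to the kernel at distance at least 1 from the origin, and
    bounded near it. *)
Definition decay_weight (x : 'rV[R]_d) : R := a (1 + `|x|).

Definition far_kernel (e : R) (y : 'rV[R]_d) : R := if e < `|y| then K y else 0.

Definition near_kernel (e : R) (y : 'rV[R]_d) : R :=
  if 0 < `|y| <= e then K y else 0.

Notation om := decay_weight.
Notation far := far_kernel.
Notation near0 := near_kernel.

Lemma K_ge0 y : y != 0 -> 0 <= K y.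
Proof.
move=> y0; have /andP[+ _] := Kbd y0; apply: le_trans.
by rewrite mulr_ge0// ?invr_ge0 ltW// a_gt0// normr_gt0.
Qed.

Lemma om_gt0 x : 0 < om x. Proof. by apply: a_gt0; rewrite ltr_wpDr. Qed.

Lemma om_le1 x : om x <= a 1.
Proof. by apply: a_ninc => //; rewrite lerDl. Qed.

Lemma measurable_om : measurable_fun setT om.
Proof.
pose b (r : R) := a (1 + Num.max r 0).
have mb : measurable_fun setT b.
  apply: nonincreasing_measurable => // r s rs; apply: a_ninc.
    by rewrite ltr_wpDr// le_max lexx orbT.
  by rewrite lerD2l ge_max !le_max rs/= lexx orbT.
rewrite (_ : om = b \o (fun x => `|x|)).
  by apply: measurableT_comp => //; exact: measurable_norm_rV.
by apply/funext => x; rewrite /om /b/= max_l.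
Qed.

Lemma om_shift (r : R) : exists2 B : R, 0 < B &
  forall x y, `|x - y| <= r -> om x <= B * om y.
Proof.
have [B B0 aB] := a_factor (1 + `|r|); exists B => // x y xyr.
apply: aB; rewrite ?ltr_wpDr//.
have -> : y = x - (x - y) by rewrite opprB addrC subrK.
rewrite (@le_trans _ _ (1 + (`|x| + `|x - y|)))// ?lerD2l ?ler_normB//.
have := le_trans xyr (ler_norm r).
have := normr_ge0 x; have := normr_ge0 r; nra.
Qed.

Let kq y := Num.min 1 (`|y| ^+ 2) * K y.

Let mkq : measurable_fun setT kq.
Proof.
by rewrite /kq; meas. Qed.

Let kq_ge0 y : 0 <= kq y.
Proof.
rewrite /kq; have [->|y0] := eqVneq y 0.
  by rewrite normr0 expr0n/= min_r// mul0r.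
by rewrite mulr_ge0 ?K_ge0// le_min ler01 sqr_ge0.
Qed.

Lemma measurable_far e : measurable_fun setT (far e).
Proof.
rewrite /far; apply: measurable_fun_if => //.
- apply: measurable_fun_ltr => //; exact: measurable_norm_rV.
- exact: measurable_funTS.
Qed.

Lemma measurable_near0 e : measurable_fun setT (near0 e).
Proof.
rewrite /near0; apply: measurable_fun_if => //.
- apply: measurable_and.
    by apply: measurable_fun_ltr => //; exact: measurable_norm_rV.
  by apply: measurable_fun_ler => //; exact: measurable_norm_rV.
- exact: measurable_funTS.
Qed.

Lemma far_ge0 e y : 0 <= e -> 0 <= far e y.
Proof.
by move=> e0; rewrite /far; case: ifPn => // ey; rewrite K_ge0// -normr_gt0 (le_lt_trans e0).
Qed.

Lemma near0_ge0 e y : 0 <= near0 e y.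
Proof.
by rewrite /near0; case: ifPn => // /andP[y0 _]; rewrite K_ge0// -normr_gt0.
Qed.

Lemma far_even e : {ae mu, forall y, far e y = far e (- y)}.
Proof.
by apply: filterS Keven => y Ky; rewrite /far normrN Ky.
Qed.

Lemma K_split e y : 0 <= e -> y != 0 -> K y = near0 e y + far e y.
Proof.
move=> e0 y0; rewrite /near0 /far normr_gt0 y0/=; case: leP => ey;
  by rewrite ?addr0 ?add0r.
Qed.

Local Open Scope ereal_scope.

(** The weight is bounded on the unit ball; outside, it is at most [C] times
    the kernel, whose tail is integrable. *)
Lemma integral_om_fin : \int[mu]_x (om x)%:E < +oo.
Proof.
pose A := [set x : 'rV[R]_d | (`|x| <= 1)%R].
have mA : measurable A by exact: measurable_rV_ball.
have le x : (om x <= a 1 * \1_A x + C * kq x)%R.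
  rewrite indicE /kq; have [x1|x1] := leP `|x|%R 1%R.
    by rewrite mem_set//= mulr1 (le_trans (om_le1 x))// lerDl mulr_ge0 ?kq_ge0 ?ltW.
  rewrite memNset/=; last by move=> /= /(lt_le_trans x1); rewrite ltxx.
  have x0 : x != 0%R by rewrite -normr_gt0 (lt_trans _ x1).
  rewrite mulr0 add0r min_l; last by rewrite expr_ge1// ltW.
  rewrite mul1r (@le_trans _ _ (a `|x|%R))//.
    by rewrite a_ninc ?normr_gt0// lerDr.
  by have /andP[+ _] := Kbd x0; rewrite mulrC ler_pdivrMr// mulrC.
have mom := measurable_om.
apply: (@le_lt_trans _ _ (\int[mu]_x (a 1 * \1_A x + C * kq x)%:E)).
  by apply: ge0_intle => //; [meas|move=> x; exact/ltW/om_gt0].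
have a1 := ltW (a_gt0 ltr01).
rewrite ge0_intD; [|by meas|by meas|by move=> x; rewrite mulr_ge0
  |by move=> x; rewrite mulr_ge0// ltW].
rewrite (ge0_intZ _ a1); [|by meas|by []].
rewrite (ge0_intZ _ (ltW C0)); [|by meas|by []].
rewrite integral_indic// setIT lte_add_pinfty// lte_mul_pinfty ?lee_fin// ?ltW//.
exact: lebesgue_rV_ball_fin.
Qed.

Lemma integral_far_fin e : (0 < e)%R -> \int[mu]_y (far e y)%:E < +oo.
Proof.
move=> e0; pose B := (1 + e ^- 2)%R.
have B0 : (0 <= B)%R by rewrite addr_ge0// invr_ge0 exprn_ge0// ltW.
have mfar := measurable_far e.
apply: (@le_lt_trans _ _ (\int[mu]_y (B * kq y)%:E)).
  apply: ge0_intle => //; [by meas|by move=> y; rewrite far_ge0// ltW|].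
  move=> y; rewrite /far; case: ifPn => ey; last by rewrite mulr_ge0.
  have y0 : y != 0%R by rewrite -normr_gt0 (lt_trans e0).
  rewrite /kq mulrA ler_peMl ?K_ge0//.
  have [y1|y1] := leP 1%R (`|y| ^+ 2)%R.
    by rewrite mulr1 lerDl invr_ge0 exprn_ge0// ltW.
  rewrite mulrDl mul1r ler_wpDl ?sqr_ge0// mulrC ler_pdivlMr ?exprn_gt0//.
  by rewrite mul1r lerXn2r ?nnegrE ?(ltW ey)// ltW.
by rewrite ge0_intZ// lte_mul_pinfty.
Qed.

(** If [|x| <= 2 |y|], then [K y] is at most a multiple of [om x] and
    [om (x - y)] is integrable in [y]. Otherwise [|x - y| >= |x| / 2], so that
    [om (x - y) <= D * om x], and the truncated kernel has finite mass. *)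
Lemma far_convolve_om e : (0 < e)%R -> exists2 B : R, (0 < B)%R &
  forall x, \int[mu]_y (far e y * om (x - y))%:E <= (B * om x)%:E.
Proof.
move=> e0.
have [B1 B10 aB1] := a_factor (e^-1 + 2)%R.
have lam0 : 0 <= \int[mu]_y (far e y)%:E.
  by apply: integral_ge0 => y _; rewrite lee_fin far_ge0// ltW.
have om0 : 0 <= \int[mu]_y (om y)%:E.
  by apply: integral_ge0 => y _; rewrite lee_fin ltW// om_gt0.
have lfin : \int[mu]_y (far e y)%:E \is a fin_num.
  by rewrite ge0_fin_numE// integral_far_fin.
have ofin : \int[mu]_y (om y)%:E \is a fin_num.
  by rewrite ge0_fin_numE// integral_om_fin.
pose B := (C * B1 * fine (\int[mu]_y (om y)%:E) + D * fine (\int[mu]_y (far e y)%:E) + 1)%R.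
exists B.
  by rewrite ltr_wpDl// addr_ge0// !mulr_ge0 ?fine_ge0 ?(le_trans _ D1)// ltW.
have mfar := measurable_far e.
have mom := measurable_om.
move=> x.
have le y : (far e y * om (x - y) <= C * B1 * om x * om (x - y) + D * om x * far e y)%R.
  rewrite /far; case: ifPn => ey; last first.
    by rewrite mul0r mulr0 addr0 !mulr_ge0// ltW// om_gt0.
  have y0 : y != 0%R by rewrite -normr_gt0 (lt_trans e0).
  have K0 := K_ge0 y0.
  have [xy|xy] := leP `|x|%R (2 * `|y|)%R.
    rewrite ler_wpDr//; first by rewrite !mulr_ge0 ?(le_trans _ D1)// ltW// om_gt0.
    rewrite ler_wpM2r ?(ltW (om_gt0 _))//.
    have /andP[_ /le_trans] := Kbd y0; apply.
    rewrite -mulrA ler_wpM2l ?(ltW C0)// aB1 ?normr_gt0 ?ltr_wpDr//.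
    rewrite mulrDl lerD// mulrC ler_pdivlMr// mul1r ltW//.
  rewrite ler_wpDl//; first by rewrite !mulr_ge0// ltW// om_gt0.
  rewrite mulrC ler_wpM2r//.
  rewrite /om (le_trans (a_dbl _)) ?ltr_wpDr// ler_wpM2l ?(le_trans _ D1)//.
  apply: a_ninc; rewrite ?ltr_wpDr//.
  have : (`|x| <= `|x - y| + `|y|)%R by rewrite -[x in leLHS](subrK y) ler_normD.
  by move: xy; lra.
have momx : measurable_fun setT (fun y : 'rV[R]_d => om (x - y)) by meas.
have om1 y : (0 <= om y)%R by rewrite ltW// om_gt0.
have far0 y : (0 <= far e y)%R by rewrite far_ge0// ltW.
have cc1 : (0 <= C * B1 * om x)%R by rewrite !mulr_ge0// ltW.
have cc2 : (0 <= D * om x)%R by rewrite !mulr_ge0 ?(le_trans _ D1)// ltW.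
apply: (@le_trans _ _ (\int[mu]_y (C * B1 * om x * om (x - y) + D * om x * far e y)%:E)).
  by apply: ge0_intle => //; [meas|meas|move=> y; rewrite mulr_ge0].
rewrite ge0_intD; [|by meas|by meas|by move=> y; rewrite mulr_ge0
  |by move=> y; rewrite mulr_ge0].
rewrite !ge0_intZ//.
have -> : \int[mu]_y (om (x - y))%:E = \int[mu]_y (om y)%:E.
  have := @ge0_integral_rV_opp R d (fun y => (om (x + y))%:E).
  move=> ->; last 2 first.
  - by meas.
  - by move=> y; rewrite lee_fin ltW// om_gt0.
  under eq_integral do rewrite addrC.
  by rewrite (@ge0_integral_rV_shift R d (fun y => (om y)%:E)); [|meas|].
rewrite -(fineK lfin) -(fineK ofin) -!EFinM -EFinD lee_fin /B.
have := om_gt0 x; nra.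
Qed.

End kernel_weight.

Lemma measurable_dotvv (R : realType) d : measurable_fun setT (fun x : 'rV[R]_d => dotv x x).
Proof.
by apply: measurable_sum => i; apply: measurable_funM; exact: measurable_rV_coord.
Qed.

Section mixed_growth.
Context {R : realType} {d : nat}.
Implicit Types x y : 'rV[R]_d.

Lemma dotv_ge0 x : 0 <= dotv x x.
Proof. by apply: sumr_ge0 => i _; rewrite -expr2 sqr_ge0. Qed.

Lemma norm_le_enorm x : `|x| <= enorm x.
Proof.
apply/rV_norm_leP => [|i]; first exact: sqrtr_ge0.
rewrite -sqrtr_sqr ler_wsqrtr// /dotv (bigD1 i)//= expr2 lerDl.
by apply: sumr_ge0 => j _; rewrite -expr2 sqr_ge0.
Qed.

Lemma enorm_le_norm x : enorm x <= d%:R * `|x|.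
Proof.
rewrite -[leRHS]ger0_norm ?mulr_ge0// -sqrtr_sqr ler_wsqrtr// exprMn.
rewrite (@le_trans _ _ (\sum_(i < d) `|x| ^+ 2))//.
  apply: ler_sum => i _; rewrite -expr2 -real_normK ?num_real//.
  by rewrite lerXn2r ?nnegrE// rV_coord_le_norm.
rewrite sumr_const card_ord -[leLHS]mulr_natl ler_wpM2r ?sqr_ge0//.
by rewrite expr2 -natrM ler_nat; case: d => // n; rewrite leq_pmulr.
Qed.

(** Doubling of [1 / (r^d phi r)] is the upper scaling bound at ratio 2. It
    also absorbs the comparison [|x| <= enorm x <= d |x|] of the two norms into
    the constant of the two-sided bound. *)
Lemma mixed_growth_profile (K : 'rV[R]_d -> R) : (0 < d)%N ->
  mixed_growth_kernel K -> exists a D C, kernel_profile a D C K.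
Proof.
move=> d0 [mK Kpe Kint [phi [phi0 phind [C C1 KC]]]].
move=> [l1 [l2 [b1 [b2 [l10 l20 b10 b12 phib]]]]].
pose a r := (r ^+ d * phi r)^-1.
have C0 : 0 < C by rewrite (lt_trans _ C1).
have a_gt0 r : 0 < r -> 0 < a r.
  by move=> r0; rewrite invr_gt0 mulr_gt0 ?exprn_gt0// phi0.
have a_ninc r s : 0 < r -> r <= s -> a s <= a r.
  move=> r0 rs; have s0 := lt_le_trans r0 rs.
  rewrite lef_pV2 ?posrE ?mulr_gt0 ?exprn_gt0 ?phi0//.
  apply: ler_pM; [exact/exprn_ge0/ltW|exact/ltW/phi0| |exact: phind].
  by rewrite lerXn2r ?nnegrE// ltW.
pose D := Num.max 1 (2 ^+ d * (l2 * 2 `^ b2)).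
have D1 : 1 <= D by rewrite le_max lexx.
have a_dbl r : 0 < r -> a r <= D * a (2 * r).
  move=> r0; have r20 : 0 < 2 * r by rewrite mulr_gt0.
  have /andP[_] := phib r (2 * r) r0 (ler_peMl (ltW r0) (ler1n _ 2)).
  rewrite mulfK ?gt_eqF// ler_pdivrMr ?phi0// => h.
  rewrite (@le_trans _ _ (2 ^+ d * (l2 * 2 `^ b2) * a (2 * r)))//; last first.
    by rewrite ler_wpM2r ?(ltW (a_gt0 _ _))// le_max lexx orbT.
  rewrite /a exprMn ler_pdivlMr ?mulr_gt0 ?exprn_gt0 ?phi0//.
  rewrite mulrC ler_pdivrMr ?mulr_gt0 ?exprn_gt0 ?phi0//.
  have -> : 2 ^+ d * (l2 * 2 `^ b2) * (r ^+ d * phi r) =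
    2 ^+ d * r ^+ d * (l2 * 2 `^ b2 * phi r) by ring.
  by rewrite ler_wpM2l// mulr_ge0// exprn_ge0// ltW.
have [B B0 aB] := a_factor a_ninc D1 a_dbl d%:R.
have en0 y : y != 0 -> 0 < `|y| /\ 0 < enorm y.
  move=> y0; have n0 : 0 < `|y| by rewrite normr_gt0.
  by split => //; rewrite (lt_le_trans n0)// norm_le_enorm.
have Kb y : y != 0 -> C^-1 * a (enorm y) <= K y <= C * a (enorm y) by exact: KC.
have K0 y : y != 0 -> 0 <= K y.
  move=> y0; have /andP[+ _] := Kb y y0; apply: le_trans.
  apply: mulr_ge0; first by rewrite invr_ge0 ltW.
  by apply/ltW/a_gt0; have [] := en0 _ y0.
exists a, D, (C * (1 + B)); split => //.
- by rewrite mulr_gt0// addr_gt0.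
- by apply: filterS Kpe => y [].
- apply: le_lt_trans Kint; apply: ge0_intle.
  + by meas.
  + rewrite (_ : (fun _ => _) = fun x => Num.min 1 (dotv x x) * K x); last first.
      by apply/funext => x; rewrite sqr_sqrtr ?dotv_ge0.
    by have := @measurable_dotvv R d => mdot; meas.
  + move=> y; have [->|y0] := eqVneq y 0.
      by rewrite normr0 expr0n/= min_r// mul0r.
    by rewrite mulr_ge0 ?K0// le_min ler01 sqr_ge0.
  + move=> y; have [->|y0] := eqVneq y 0.
      rewrite normr0 expr0n/= min_r// mul0r /enorm /dotv big1; last first.
        by move=> i _; rewrite mxE mulr0.
      by rewrite sqrtr0 expr0n/= min_r// mul0r.
    rewrite ler_wpM2r ?K0// le_min ge_min lexx/= ge_min; apply/orP; right.
    by rewrite lerXn2r ?nnegrE ?norm_le_enorm// sqrtr_ge0.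
- move=> y y0; have /andP[K1 K2] := Kb _ y0; have [n0 e0] := en0 _ y0.
  apply/andP; split.
    apply: le_trans K1; rewrite invfM -mulrA ler_wpM2l ?invr_ge0 ?(ltW C0)//.
    rewrite mulrC ler_pdivrMr ?addr_gt0//.
    rewrite (le_trans (aB _ (enorm y) n0 e0 (enorm_le_norm y)))//.
    by rewrite mulrC ler_wpM2l ?lerDr//; exact/ltW/a_gt0.
  apply: (le_trans K2); rewrite -mulrA ler_wpM2l ?(ltW C0)//.
  rewrite (@le_trans _ _ (a `|y|))//; first by rewrite a_ninc// norm_le_enorm.
  by rewrite ler_peMl ?lerDl//; [exact/ltW/a_gt0|exact: ltW].
Qed.

End mixed_growth.


(** * Real-valued integrals and even kernels *)

Section real_integrals.
Context d (T : measurableType d) {R : realType}.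
Variable m : {measure set T -> \bar R}.
Implicit Types f g : T -> R.

Lemma integrable_absP f : measurable_fun setT f ->
  (\int[m]_x (`|f x|)%:E < +oo)%E -> m.-integrable setT (EFin \o f).
Proof.
move=> mf fi; apply/integrableP; split => //.
exact/measurable_EFinP.
Qed.

Lemma Rint_fin f : m.-integrable setT (EFin \o f) ->
  (\int[m]_x f x)%:E = (\int[m]_x (f x)%:E)%E.
Proof. by move=> fi; rewrite /Rintegral fineK//; exact: integrable_fin_num. Qed.

Lemma abs_Rint_le f : measurable_fun setT f ->
  ((`|\int[m]_x f x|)%:E <= \int[m]_x (`|f x|)%:E)%E.
Proof.
move=> mf; have [fi|fi] := ltP (\int[m]_x (`|f x|)%:E)%E +oo%E.
  have fint := integrable_absP mf fi.
  have nint : m.-integrable setT (EFin \o (fun x => `|f x|)).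
    by have := integrable_norm fint.
  by rewrite -(Rint_fin nint) lee_fin le_normr_Rintegral.
by rewrite (le_trans _ fi)// leey.
Qed.

End real_integrals.

Section real_partial_integrals.
Context d1 d2 (T1 : measurableType d1) (T2 : measurableType d2) {R : realType}.
Variables (m1 : {sigma_finite_measure set T1 -> \bar R})
  (m2 : {sigma_finite_measure set T2 -> \bar R}).
Variable f : T1 -> T2 -> R.
Hypothesis mf : measurable_fun setT (fun z : T1 * T2 => f z.1 z.2).

Let mf1 x : measurable_fun setT (f x).
Proof. exact: (measurableT_comp mf (measurable_pair1 x)). Qed.

Let mf2 y : measurable_fun setT (f ^~ y).
Proof. exact: (measurableT_comp mf (measurable_pair2 y)). Qed.

Lemma measurable_Rint_snd :
  measurable_fun setT (fun x : T1 => \int[m2]_y f x y : R).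
Proof.
apply: (@measurableT_comp _ _ _ _ _ _ (@fine R) _ (fun x : T1 => (\int[m2]_y (f x y)%:E)%E)) => //.
under eq_fun do rewrite integralE.
apply: emeasurable_funB.
- apply: measurable_int_snd => //.
  rewrite (_ : (fun _ => _) = (fun z : T1 * T2 => (f z.1 z.2)%:E)^\+%E); last first.
    by apply/funext => z; rewrite !funeposE.
  by apply: measurable_funepos; apply/measurable_EFinP.
- apply: measurable_int_snd => //.
  rewrite (_ : (fun _ => _) = (fun z : T1 * T2 => (f z.1 z.2)%:E)^\-%E); last first.
    by apply/funext => z; rewrite !funenegE.
  by apply: measurable_funeneg; apply/measurable_EFinP.
Qed.

Hypothesis fi1 : forall x, (\int[m2]_y (`|f x y|)%:E < +oo)%E.
Hypothesis fi2 : forall y, (\int[m1]_x (`|f x y|)%:E < +oo)%E.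
Hypothesis fi : (\int[m1]_x \int[m2]_y (`|f x y|)%:E < +oo)%E.

Lemma Rint_swap : \int[m1]_x (\int[m2]_y f x y) = \int[m2]_y (\int[m1]_x f x y) :> R.
Proof.
have int : (m1 \x m2)%E.-integrable setT (EFin \o (fun z : T1 * T2 => f z.1 z.2)).
  apply: integrable_absP => //.
  rewrite (tonelli_prod m1 m2 (f := fun x y => (`|f x y|)%:E))//.
  by apply/measurable_EFinP; exact: measurableT_comp.
rewrite /Rintegral; congr fine.
transitivity (\int[m1]_x (\int[m2]_y (f x y)%:E))%E.
  by apply: eq_integral => x _; rewrite -Rint_fin//; exact: integrable_absP.
rewrite [LHS](Fubini int).
by apply: eq_integral => y _; rewrite -Rint_fin//; exact: integrable_absP.
Qed.

End real_partial_integrals.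

Section even_kernels.
Context {R : realType} {d : nat}.
Notation mu := (@lebesgue_rV R d).

Lemma integral_rV_opp (f : 'rV[R]_d -> \bar R) : measurable_fun setT f ->
  (\int[mu]_x f (- x)%R = \int[mu]_x f x)%E.
Proof.
move=> mf; rewrite [LHS]integralE [RHS]integralE; congr (_ - _)%E.
- rewrite -(ge0_integral_rV_opp (f := f^\+%E))//; last exact: measurable_funepos.
  by apply: eq_integral => x _; rewrite !funeposE.
- rewrite -(ge0_integral_rV_opp (f := f^\-%E))//; last exact: measurable_funeneg.
  by apply: eq_integral => x _; rewrite !funenegE.
Qed.

Variable k : 'rV[R]_d -> R.
Hypothesis mk : measurable_fun setT k.
Hypothesis k_even : {ae mu, forall y, k y = k (- y)}.

Lemma integral_even_kernel (f : 'rV[R]_d -> R) : measurable_fun setT f ->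
  (\int[mu]_y (k y * f (- y))%:E = \int[mu]_y (k y * f y)%:E)%E.
Proof.
move=> mf; rewrite -[RHS]integral_rV_opp; last by meas.
apply: ae_eq_integral => //; [by meas|by meas|].
by apply: filterS k_even => y ky _; rewrite /= ky.
Qed.

Lemma integral_even_shift (f : 'rV[R]_d -> R) x : measurable_fun setT f ->
  (\int[mu]_y (k y * f (x + y))%:E = \int[mu]_y (k y * f (x - y))%:E)%E.
Proof.
move=> mf; rewrite -(integral_even_kernel (f := fun y => f (x - y))); last by meas.
by apply: eq_integral => y _; rewrite opprK.
Qed.

Lemma Rint_even_shift (f : 'rV[R]_d -> R) x : measurable_fun setT f ->
  \int[mu]_y (k y * f (x + y)) = \int[mu]_y (k y * f (x - y)) :> R.
Proof. by move=> mf; rewrite /Rintegral integral_even_shift. Qed.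

End even_kernels.


(** * Near and far parts of the operator, and the regularized weight *)

(** Second differences are all the regularity that the operator sees. *)
Record bump {R : realType} {d : nat} (r M : R) (psi : 'rV[R]_d -> R) : Prop := Bump {
  bump_meas : measurable_fun setT psi ;
  bump_bound : forall x, `|psi x| <= M ;
  bump_supp : forall x, r < `|x| -> psi x = 0 ;
  bump_diff2 : forall x y,
    `|psi (x + y) + psi (x - y) - 2 * psi x| <= M * `|y| ^+ 2 }.

Section weights.
Context {R : realType} {d : nat}.
Notation mu := (@lebesgue_rV R d).
Variables (a : R -> R) (D C : R) (K : 'rV[R]_d -> R).
Hypothesis kp : kernel_profile a D C K.
Notation om := (decay_weight a).
Notation far := (far_kernel K).
Notation near0 := (near_kernel K).
Let K0 := K_ge0 kp.
Let om0 x : 0 <= om x := ltW (om_gt0 kp x).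
Let mom : measurable_fun setT om := measurable_om kp.
Let mfar e : measurable_fun setT (far e) := measurable_far kp e.
Let mnear e : measurable_fun setT (near0 e) := measurable_near0 kp e.
Let near_ge0 e y : 0 <= near0 e y := near0_ge0 kp e y.

(** As [e] tends to 0 the mass of the far part may diverge, whereas the moment
    of the near part vanishes; every bound below has to keep track of the two
    separately. *)
Definition far_mass e : R := fine (\int[mu]_y (far e y)%:E)%E.
Definition near_moment e : R := fine (\int[mu]_y (near0 e y * `|y| ^+ 2)%:E)%E.

Lemma far_massE e : 0 < e -> (\int[mu]_y (far e y)%:E = (far_mass e)%:E)%E.
Proof.
move=> e0; rewrite fineK// ge0_fin_numE ?(integral_far_fin kp e0)//.
by apply: int_ge0 => y; rewrite (far_ge0 kp)// ltW.
Qed.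

Lemma near_sqr_le e y : e <= 1 ->
  near0 e y * `|y| ^+ 2 <= Num.min 1 (`|y| ^+ 2) * K y.
Proof.
move=> e1; rewrite /near0; have [->|y0] := eqVneq y 0.
  by rewrite normr0 expr0n/= mulr0 min_r// mul0r.
case: ifPn => [/andP[_ ye]|_]; last by rewrite mul0r mulr_ge0 ?K0// le_min ler01 sqr_ge0.
by rewrite min_r; [rewrite mulrC|rewrite expr_le1// (le_trans ye)].
Qed.

Lemma near_momentE e : e <= 1 ->
  (\int[mu]_y (near0 e y * `|y| ^+ 2)%:E = (near_moment e)%:E)%E.
Proof.
move=> e1; rewrite fineK// ge0_fin_numE.
  apply: le_lt_trans (kp_int kp); apply: ge0_intle; [by meas| | |].
  - by have := kp_meas kp => mK; meas.
  - by move=> y; rewrite mulr_ge0// sqr_ge0.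
  - by move=> y; exact: near_sqr_le.
by apply: int_ge0 => y; rewrite mulr_ge0// sqr_ge0.
Qed.

Lemma near_moment_ge0 e : 0 <= near_moment e.
Proof. by apply/fine_ge0/int_ge0 => y; rewrite mulr_ge0// sqr_ge0. Qed.

Lemma near_moment_cvg0 : near_moment n.+1%:R^-1 @[n --> \oo] --> (0 : R).
Proof.
have inv1 n : (n.+1%:R^-1 : R) <= 1 by rewrite invf_le1// ler1n.
have mK := kp_meas kp.
have kint : mu.-integrable setT (EFin \o (fun y => Num.min 1 (`|y| ^+ 2) * K y)).
  apply: integrable_absP; first by meas.
  under eq_integral do rewrite ger0_norm ?(le_trans _ (near_sqr_le _ (lexx 1))) ?mulr_ge0 ?sqr_ge0//.
  exact: kp_int kp.
have [] := @dominated_convergence _ _ R mu setT measurableT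
  (fun n y => (near0 n.+1%:R^-1 y * `|y| ^+ 2)%:E) (cst 0%E)
  (EFin \o (fun y => Num.min 1 (`|y| ^+ 2) * K y)) => //.
- by move=> n; meas.
- apply: aeW => y _; apply: cvg_EFin; first exact: nearW.
  have [->|y0] := eqVneq y 0.
    rewrite (_ : (fun _ => _) = cst 0); first exact: cvg_cst.
    by apply/funext => n /=; rewrite normr0 expr0n/= mulr0.
  have yp : 0 < `|y| by rewrite normr_gt0.
  apply: (@cvg_trans _ ((fun _ : nat => 0 : R) @ \oo)); last exact: cvg_cst.
  apply: near_eq_cvg; near=> n; rewrite /= /near0 normr_gt0 y0/=.
  rewrite leNgt (_ : n.+1%:R^-1 < `|y|) ?mul0r//=.
  near: n; exact: (near_infty_natSinv_lt (PosNum yp)).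
- apply: aeW => y n _; rewrite /= ger0_norm ?mulr_ge0 ?sqr_ge0// lee_fin.
  exact: near_sqr_le.
move=> _ _; rewrite integral0 => /fine_cvgP[_]; apply: cvg_trans.
by apply: near_eq_cvg; apply: nearW.
Unshelve. all: by end_near. Qed.

Definition ballv (r : R) : R := fine (mu [set x : 'rV[R]_d | `|x| <= r]).

(** By [om_shift], averaging the weight over a bounded region does not change
    its order of magnitude. *)
Lemma local_convolution (r : R) : exists2 B : R, 0 < B &
  forall (g : 'rV[R]_d -> R) G x, measurable_fun setT g ->
   (forall z, `|g z| <= G) -> (forall z, r < `|z| -> g z = 0) ->
   (\int[mu]_z (om z * `|g (x - z)|)%:E <= (G * B * om x)%:E)%E /\
   (\int[mu]_z (om z * `|g (z - x)|)%:E <= (G * B * om x)%:E)%E.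
Proof.
have [B B0 omB] := om_shift kp r.
pose A := [set x : 'rV[R]_d | `|x| <= r].
have mA : measurable A by exact: measurable_rV_ball.
have VE : mu A = (ballv r)%:E.
  by rewrite fineK// ge0_fin_numE ?lebesgue_rV_ball_fin.
have V0 : 0 <= ballv r by rewrite fine_ge0.
exists (B * (1 + ballv r)); first by rewrite mulr_gt0// ltr_wpDr.
move=> g G x mg gG gs.
have G0 : 0 <= G by rewrite (le_trans _ (gG 0)).
have aux (e : 'rV[R]_d -> 'rV[R]_d) : measurable_fun setT e ->
    (forall z, `|z - x| = `|e z|) ->
    (\int[mu]_z (om z * `|g (e z)|)%:E <= (G * (B * (1 + ballv r)) * om x)%:E)%E.
  move=> me ez.
  apply: (@le_trans _ _ (\int[mu]_z (G * B * om x * \1_A (z - x))%:E)%E).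
    apply: ge0_intle; [by meas| |by move=> z; rewrite mulr_ge0|].
      by have m1 : measurable_fun setT (\1_A : _ -> R) by []; meas.
    move=> z; rewrite indicE; have [zx|zx] := leP `|z - x| r; last first.
      by rewrite gs ?normr0 ?mulr0 ?mulr_ge0 ?(ltW B0)// -ez.
    rewrite mem_set// mulr1 mulrC -mulrA ler_pM//; exact: omB.
  rewrite ge0_intZ; [|by rewrite !mulr_ge0 ?(ltW B0)| |by []]; last first.
    by have m1 : measurable_fun setT (\1_A : _ -> R) by []; meas.
  rewrite (@ge0_integral_rV_shift R d (fun z => (\1_A z)%:E)); [|by meas|].
    rewrite integral_indic// setIT.
    rewrite [X in (_ * X)%E](_ : _ = (ballv r)%:E)//.
    rewrite -EFinM lee_fin.
    rewrite -!mulrA ler_wpM2l// ler_wpM2l ?(ltW B0)// mulrC.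
    by rewrite ler_wpM2r// lerDr.
  by move=> z; rewrite lee_fin.
split; apply: aux => //; [by meas|by move=> z; rewrite distrC|by meas].
Qed.


Section smooth_weight.
Variables (rho : 'rV[R]_d -> R) (r0 Mr : R).
Hypothesis brho : bump r0 Mr rho.
Hypothesis rho0 : forall x, 0 <= rho x.
Hypothesis rho_pos : (0 < \int[mu]_x (rho x)%:E)%E.
Let mrho := bump_meas brho.

(** [om] may be discontinuous, and [nonlocal_op] cannot be applied to it; its
    convolution with a bump is comparable to it and has second differences
    bounded by [|y|^2 om]. *)
Definition Om (x : 'rV[R]_d) : R := \int[mu]_z (om z * rho (x - z)).

Let Mr0 : 0 <= Mr. Proof. by rewrite (le_trans _ (bump_bound brho 0)). Qed.

Let int_om (g : 'rV[R]_d -> R) G : measurable_fun setT g ->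
  (forall z, `|g z| <= G) -> mu.-integrable setT (EFin \o (fun z => om z * g z)).
Proof.
move=> mg gG; have G0 : 0 <= G by rewrite (le_trans _ (gG 0)).
apply: integrable_absP; first by meas.
apply: (@le_lt_trans _ _ (\int[mu]_z (G * om z)%:E)%E).
  apply: ge0_intle; [by meas|by meas|by []|move=> z].
  by rewrite normrM (ger0_norm (om0 z)) mulrC ler_wpM2r.
rewrite ge0_intZ// lte_mul_pinfty//; exact: (integral_om_fin kp).
Qed.

Let mrx x : measurable_fun setT (fun z : 'rV[R]_d => rho (x - z)).
Proof. by meas. Qed.

Lemma OmE x : (\int[mu]_z (om z * rho (x - z))%:E = (Om x)%:E)%E.
Proof.
rewrite Rint_fin//; apply: (@int_om (fun z => rho (x - z)) Mr) => // z.
exact: bump_bound brho _.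
Qed.

Lemma Om_le : exists2 B : R, 0 < B & forall x, Om x <= B * om x.
Proof.
have [B B0 HB] := local_convolution r0.
exists ((Mr + 1) * B); first by rewrite mulr_gt0// ltr_wpDl.
move=> x; rewrite -lee_fin -OmE.
have [+ _] := HB rho Mr x mrho (bump_bound brho) (bump_supp brho).
under eq_integral do rewrite ger0_norm//.
move=> /le_trans; apply; rewrite lee_fin -!mulrA ler_wpM2r ?lerDl//.
by rewrite mulr_ge0// ltW.
Qed.

Lemma Om_ge : exists2 c : R, 0 < c & forall x, c * om x <= Om x.
Proof.
have [B B0 omB] := om_shift kp r0.
pose I := fine (\int[mu]_x (rho x)%:E)%E.
have IE : (\int[mu]_x (rho x)%:E = I%:E)%E.
  rewrite fineK// ge0_fin_numE ?(ltW rho_pos)//.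
  have [c c0 omc] : exists2 c, 0 < c & forall x, rho x <= c * om x.
    have [B' B'0 omB'] := om_shift kp r0.
    have o0 := om_gt0 kp (0 : 'rV[R]_d).
    exists ((Mr + 1) * (B' / om (0 : 'rV[R]_d))); first by rewrite mulr_gt0 ?divr_gt0// ltr_wpDl.
    move=> x; have [xr|xr] := leP `|x| r0; last first.
      by rewrite (bump_supp brho)// mulr_ge0// mulr_ge0 ?addr_ge0// divr_ge0 ?ltW.
    rewrite (@le_trans _ _ (Mr + 1))//.
      by rewrite (le_trans (ler_norm _))// (le_trans (bump_bound brho x))// lerDl.
    rewrite -mulrA ler_peMr ?addr_ge0// mulrAC ler_pdivlMr// mul1r omB'//.
    by rewrite sub0r normrN.
  apply: (@le_lt_trans _ _ (\int[mu]_x (c * om x)%:E)%E).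
    by apply: ge0_intle => //; meas.
  by rewrite ge0_intZ ?(ltW c0)// lte_mul_pinfty ?lee_fin ?(ltW c0)//; exact: (integral_om_fin kp).
have I0 : 0 < I by rewrite -lte_fin -IE.
exists (B^-1 * I); first by rewrite mulr_gt0// invr_gt0.
move=> x; rewrite -lee_fin -OmE.
apply: (@le_trans _ _ (\int[mu]_z (B^-1 * om x * rho (x - z))%:E)%E); last first.
  apply: ge0_intle; [by meas|by meas| |].
    by move=> z; rewrite mulr_ge0// mulr_ge0// invr_ge0 ltW.
  move=> z; have [xr|xr] := leP `|x - z| r0; last first.
    by rewrite (bump_supp brho)// !mulr0.
  by rewrite ler_wpM2r// mulrC ler_pdivrMr// mulrC omB.
rewrite ge0_intZ//; last by rewrite mulr_ge0// invr_ge0 ltW.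
rewrite (_ : (\int[mu]_z (rho (x - z))%:E)%E = I%:E).
  by rewrite -EFinM lee_fin mulrAC.
have := @ge0_integral_rV_opp R d (fun y => (rho (x + y))%:E).
move=> ->; last 2 first.
- by meas.
- by move=> y; rewrite lee_fin.
under eq_integral do rewrite addrC.
by rewrite (@ge0_integral_rV_shift R d (fun y => (rho y)%:E)); [|meas|].
Qed.

Lemma measurable_Om : measurable_fun setT Om.
Proof. by apply: measurable_Rint_snd; meas. Qed.

Lemma Om_ge0 x : 0 <= Om x.
Proof. by apply: Rintegral_ge0 => z _; rewrite mulr_ge0. Qed.

(** The second difference falls on the bump [rho], and what remains is a local
    average of [om]. *)
Lemma Om_diff2 : exists2 B : R, 0 < B & forall x y, `|y| <= 1 ->
  Om (x + y) + Om (x - y) <= 2 * Om x + B * `|y| ^+ 2 * om x.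
Proof.
have [B B0 HB] := local_convolution (r0 + 1).
exists ((Mr + 1) * B); first by rewrite mulr_gt0// ltr_wpDl.
move=> x y y1.
pose g z := rho (z + y) + rho (z - y) - 2 * rho z.
have mg : measurable_fun setT g by rewrite /g; meas.
have gG z : `|g z| <= Mr * `|y| ^+ 2 by exact: bump_diff2 brho _ _.
have gs z : r0 + 1 < `|z| -> g z = 0.
  move=> rz; have zy : `|z| <= `|z + y| + `|y|.
    by rewrite -[in leLHS](addrK y z) ler_normB.
  have zy' : `|z| <= `|z - y| + `|y|.
    by rewrite -[in leLHS](subrK y z) ler_normD.
  by rewrite /g !(bump_supp brho) ?mulr0 ?subr0 ?addr0//; lra.
have iO x' : mu.-integrable setT (EFin \o (fun z => om z * rho (x' - z))).
  apply: (@int_om (fun z => rho (x' - z)) Mr) => // z; exact: bump_bound brho _.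
have : Om (x + y) + Om (x - y) - 2 * Om x <= \int[mu]_z (om z * g (x - z)).
  rewrite /Om -RintegralD// -RintegralZl// -RintegralB//.
  - rewrite le_eqVlt; apply/orP; left; apply/eqP/eq_Rintegral => z _; rewrite /g.
    have -> : x - z + y = x + y - z by rewrite addrAC.
    have -> : x - z - y = x - y - z by rewrite addrAC.
    by ring.
  - by have := integrableD measurableT (iO (x + y)) (iO (x - y)).
  - by have := integrableZl measurableT 2 (iO x).
rewrite lerBlDl => /le_trans; apply; rewrite lerD2l.
have [h _] := HB g (Mr * `|y| ^+ 2) x mg gG gs.
rewrite -lee_fin (@le_trans _ _ (\int[mu]_z (om z * `|g (x - z)|)%:E)%E)//.
  have mogx : measurable_fun setT (fun z => om z * g (x - z)) by meas.
  apply: (@le_trans _ _ (`|\int[mu]_z (om z * g (x - z))|%:E)).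
    by rewrite lee_fin ler_norm.
  apply: (le_trans (abs_Rint_le _ mogx)).
  by under eq_integral do rewrite normrM (ger0_norm (om0 _)).
apply: (le_trans h); rewrite lee_fin ler_wpM2r//.
by rewrite mulrAC ler_wpM2r ?sqr_ge0// ler_wpM2r ?lerDl// ltW.
Qed.

Let mOm := measurable_Om.

(** The point is that the coefficient of [far_mass e] is exactly 1 and that
    [C1] does not depend on [e]. Over [e < |v| <= 1] the kernel is even, so
    [Om (x + v)] may be replaced by the mean of [Om (x + v)] and [Om (x - v)],
    which exceeds [Om x] by a multiple of [|v|^2 om x], and [|v|^2] is
    integrable against the kernel near 0. Over [|v| > 1] no cancellation is
    needed and [far_convolve_om] applies. *)
Lemma far_convolve_Om : exists2 C1 : R, 0 < C1 & forall e x, 0 < e -> e <= 1 ->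
  (\int[mu]_v (far e v * Om (x + v))%:E <= ((far_mass e + C1) * Om x)%:E)%E.
Proof.
have [B B0 OB] := Om_le; have [c c0 Oc] := Om_ge.
have [B' B'0 O2] := Om_diff2.
have [B2 B20 fB2] := far_convolve_om kp ltr01.
exists (B' * (1 + near_moment 1) / c + B * B2 / c).
  by rewrite addr_gt0// divr_gt0 ?mulr_gt0// ltr_wpDr// near_moment_ge0.
move=> e x e0 e1.
pose mid v := far e v - far 1 v.
have midE v : mid v = if e < `|v| <= 1 then K v else 0.
  rewrite /mid /far_kernel; have [v1|v1] := leP `|v| 1.
    by rewrite subr0 andbT.
  by rewrite (le_lt_trans e1 v1) subrr.
have mmid : measurable_fun setT mid.
  by have := mfar e; have := mfar 1; rewrite /mid => ? ?; meas.
have mid0 v : 0 <= mid v.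
  rewrite midE; case: ifPn => // /andP[ev _].
  by rewrite K0// -normr_gt0 (lt_trans e0).
have far10 v : 0 <= far 1 v by rewrite (far_ge0 kp).
have fare0 v : 0 <= far e v by rewrite (far_ge0 kp)// ltW.
have mid_even : {ae mu, forall v, mid v = mid (- v)}.
  by apply: filterS (kp_even kp) => v Kv; rewrite !midE normrN Kv.
have O0 := Om_ge0.
have I1 : (\int[mu]_v (mid v * Om (x + v))%:E <=
    (far_mass e * Om x + B' * (1 + near_moment 1) * om x)%:E)%E.
  pose A := far_mass e * Om x + B' * (1 + near_moment 1) * om x.
  (* twice the integral: symmetrizing must not subtract infinite quantities *)
  have hle : (\int[mu]_v (mid v * Om (x + v))%:E +
      \int[mu]_v (mid v * Om (x + v))%:E <= (2 * A)%:E)%E.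
    rewrite {2}(integral_even_shift mmid mid_even x mOm) -ge0_intD; [|by meas|by meas|by move=> v; rewrite mulr_ge0..].
    apply: (@le_trans _ _ (\int[mu]_v (2 * Om x * far e v + B' * om x * (near0 1 v * `|v| ^+ 2))%:E)%E).
      have mn := mnear 1; have mfe := mfar e.
      apply: ge0_intle; [by meas|by meas|by move=> v; rewrite addr_ge0// mulr_ge0|].
      move=> v; rewrite -mulrDr midE; case: ifPn => [/andP[ev v1]|_]; last first.
        rewrite mul0r addr_ge0// ?mulr_ge0//; exact: ltW.
      have v0 : 0 < `|v| := lt_trans e0 ev.
      rewrite /far_kernel ev /near_kernel v0 v1/=.
      have Kv : 0 <= K v by rewrite K0// -normr_gt0.
      rewrite (@le_trans _ _ (K v * (2 * Om x + B' * `|v| ^+ 2 * om x)))//.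
        by rewrite ler_wpM2l// O2.
      by rewrite le_eqVlt; apply/orP; left; apply/eqP; ring.
    have mn := mnear 1; have mfe := mfar e.
    have cc : 0 <= B' * om x by rewrite mulr_ge0// ltW.
    rewrite ge0_intD; [|by meas|by meas|by move=> v; rewrite !mulr_ge0|
      by move=> v; rewrite mulr_ge0// mulr_ge0// sqr_ge0].
    rewrite ge0_intZ//; last by rewrite mulr_ge0.
    rewrite ge0_intZ//; [|by meas|by move=> v; rewrite mulr_ge0// sqr_ge0].
    rewrite far_massE// near_momentE// -!EFinM -EFinD lee_fin /A.
    by have := om0 x; have := near_moment_ge0 1; nra.
  move: hle; rewrite -/A.
  case: (\int[mu]_v (mid v * Om (x + v))%:E)%E => [q| |]//=.
    by rewrite -EFinD !lee_fin; lra.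
  by move=> _; exact: leNye.
have I2 : (\int[mu]_v (far 1 v * Om (x + v))%:E <= (B * B2 * om x)%:E)%E.
  have mf1 := mfar 1.
  apply: (@le_trans _ _ (\int[mu]_v (B * (far 1 v * om (x + v)))%:E)%E).
    apply: ge0_intle; [by meas|by meas|by move=> v; rewrite mulr_ge0|].
    by move=> v; rewrite mulrCA ler_wpM2l.
  rewrite ge0_intZ ?(ltW B0)//; [|by meas|by move=> v; rewrite mulr_ge0].
  rewrite (integral_even_shift mf1 (far_even kp 1) x mom) -mulrA EFinM lee_wpmul2l ?lee_fin ?(ltW B0)//.
have -> : (\int[mu]_v (far e v * Om (x + v))%:E =
   \int[mu]_v (mid v * Om (x + v))%:E + \int[mu]_v (far 1 v * Om (x + v))%:E)%E.
  have mf1 := mfar 1.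
  rewrite -ge0_intD; [|by meas|by meas|by move=> v; rewrite mulr_ge0..].
  by apply: eq_integral => v _; rewrite -mulrDl /mid subrK.
apply: (le_trans (leeD I1 I2)); rewrite -EFinD lee_fin.
have hx X : 0 <= X -> X * om x <= X / c * Om x.
  by move=> X0; rewrite -mulrA ler_wpM2l// mulrC ler_pdivlMr// mulrC.
have nm := near_moment_ge0 1.
rewrite [leRHS]mulrDl -addrA lerD2l [leRHS]mulrDl lerD// hx// mulr_ge0//.
- exact: ltW.
- exact: addr_ge0.
- exact: ltW.
- exact: ltW.
Qed.

End smooth_weight.


Section nonlocal_decomposition.
Variables (psi : 'rV[R]_d -> R) (r M : R).
Hypothesis bpsi : bump r M psi.
Let mpsi := bump_meas bpsi.
Let psiM x : `|psi x| <= M := bump_bound bpsi x.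
Let M0 : 0 <= M. Proof. by rewrite (le_trans _ (psiM 0)). Qed.

Definition near_op e z : R :=
  \int[mu]_y (near0 e y * (psi z - (psi (z + y) + psi (z - y)) / 2)).
Definition far_convolution e z : R := \int[mu]_y (far e y * psi (z - y)).

Notation far_conv := far_convolution.

Let half z y := psi z - (psi (z + y) + psi (z - y)) / 2.

Let half_sqr z y : `|half z y| <= M * `|y| ^+ 2.
Proof.
have := bump_diff2 bpsi z y; rewrite /half.
rewrite (_ : psi z - _ = - (psi (z + y) + psi (z - y) - 2 * psi z) / 2); last by field.
rewrite normrM normrN ger0_norm//.
by have := normr_ge0 (psi (z + y) + psi (z - y) - 2 * psi z); lra.
Qed.

Let mhalf z : measurable_fun setT (half z). Proof. by rewrite /half; meas. Qed.

Let near_int e z : e <= 1 ->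
  mu.-integrable setT (EFin \o (fun y => near0 e y * half z y)).
Proof.
move=> e1; have mn := mnear e; have mh := mhalf z.
apply: integrable_absP; first by meas.
apply: (@le_lt_trans _ _ (\int[mu]_y (M * (near0 e y * `|y| ^+ 2))%:E)%E).
  apply: ge0_intle; [by meas|by meas|by []|move=> y].
  by rewrite normrM (ger0_norm (near_ge0 _ _)) mulrCA ler_wpM2l.
rewrite ge0_intZ//; [|by meas|by move=> y; rewrite mulr_ge0// sqr_ge0].
by rewrite near_momentE// -EFinM ltry.
Qed.

Let far_bnd_int e (g : 'rV[R]_d -> R) B : 0 < e -> measurable_fun setT g ->
  (forall y, `|g y| <= B) ->
  mu.-integrable setT (EFin \o (fun y => far e y * g y)).
Proof.
move=> e0 mg gB; have mf := mfar e.
have f0 y : 0 <= far e y by rewrite (far_ge0 kp)// ltW.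
have B0 : 0 <= B by rewrite (le_trans _ (gB 0)).
apply: integrable_absP; first by meas.
apply: (@le_lt_trans _ _ (\int[mu]_y (B * far e y)%:E)%E).
  apply: ge0_intle; [by meas|by meas|by []|move=> y].
  by rewrite normrM (ger0_norm (f0 _)) mulrC ler_wpM2r.
by rewrite ge0_intZ// far_massE// -EFinM ltry.
Qed.

Lemma nonlocal_integrable z : mu.-integrable setT
  (EFin \o (fun y => (psi z - (psi (z + y) + psi (z - y)) / 2) * K y)).
Proof.
have mh := mhalf z.
have h2 y : `|half z y| <= M + (M + M) / 2.
  rewrite (le_trans (ler_normB _ _))// lerD// normrM [X in _ * X]ger0_norm// ler_wpM2r//.
  by rewrite (le_trans (ler_normD _ _))// lerD.
have hf := far_bnd_int ltr01 mh h2.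
have hn := near_int z (lexx 1).
apply: eq_integrable (integrableD measurableT hn hf) => //= y _; rewrite -EFinD; congr EFin.
have [->|y0] := eqVneq y 0; last by rewrite -mulrDl -(K_split _ ler01 y0) mulrC.
by rewrite /near_kernel /far_kernel /half normr0 ltxx/= ltNge ler01/= addr0 subr0; field.
Qed.

(** The value [psi z] can be separated from its neighbours only outside a
    ball, because the kernel is not integrable at the origin. *)
Lemma nonlocal_split e z : 0 < e -> e <= 1 ->
  nonlocal_op K psi z = near_op e z + far_mass e * psi z - far_conv e z.
Proof.
move=> e0 e1.
have mf := mfar e.
have f0 y : 0 <= far e y by rewrite (far_ge0 kp)// ltW.
have mpz1 : measurable_fun setT (fun y : 'rV[R]_d => psi (z + y)) by meas.
have mpz2 : measurable_fun setT (fun y : 'rV[R]_d => psi (z - y)) by meas.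
have i0 : mu.-integrable setT (EFin \o (fun y => far e y)).
  apply: integrable_absP => //.
  under eq_integral do rewrite ger0_norm//.
  by rewrite far_massE// ltry.
have i1 : mu.-integrable setT (EFin \o (fun y => far e y * psi (z + y))).
  exact: far_bnd_int.
have i2 : mu.-integrable setT (EFin \o (fun y => far e y * psi (z - y))).
  exact: far_bnd_int.
have i0' : mu.-integrable setT (EFin \o (fun y => psi z * far e y)).
  by have := integrableZl measurableT (psi z) i0.
have i12 : mu.-integrable setT (EFin \o (fun y => far e y * psi (z + y) + far e y * psi (z - y))).
  by have := integrableD measurableT i1 i2.
have i12' : mu.-integrable setT (EFin \o (fun y => 2^-1 * (far e y * psi (z + y) + far e y * psi (z - y)))).
  by have := integrableZl measurableT (2^-1) i12.
have if_ : mu.-integrable setT (EFin \o (fun y => psi z * far e y - 2^-1 * (far e y * psi (z + y) + far e y * psi (z - y)))).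
  by have := integrableB measurableT i0' i12'.
transitivity (\int[mu]_y (near0 e y * half z y + (psi z * far e y - 2^-1 * (far e y * psi (z + y) + far e y * psi (z - y))))).
  apply: eq_Rintegral => y _; have [->|y0] := eqVneq y 0.
    rewrite /near_kernel /far_kernel /half normr0 ltxx/= ltNge (ltW e0)/= addr0 subr0.
    by field.
  by rewrite (K_split _ (ltW e0) y0) /half; field.
rewrite RintegralD//; last exact: near_int.
rewrite -addrA; congr (_ + _).
rewrite RintegralB// RintegralZl// RintegralZl// RintegralD//.
rewrite (Rint_even_shift mf (far_even kp e) z mpsi).
rewrite /far_conv [X in psi z * X](_ : _ = far_mass e)//.
by field.
Qed.

Lemma near_op_bound e z : e <= 1 -> `|near_op e z| <= M * near_moment e.
Proof.
move=> e1; have mn := mnear e; have mh := mhalf z.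
rewrite -lee_fin (le_trans (abs_Rint_le _ _))//; first by rewrite -/(half z _); meas.
apply: (@le_trans _ _ (\int[mu]_y (M * (near0 e y * `|y| ^+ 2))%:E)%E).
  apply: ge0_intle; [by meas|by meas|by []|move=> y].
  by rewrite normrM (ger0_norm (near_ge0 _ _)) mulrCA ler_wpM2l// half_sqr.
rewrite ge0_intZ//; [|by meas|by move=> y; rewrite mulr_ge0// sqr_ge0].
by rewrite near_momentE// -EFinM.
Qed.

Lemma near_op_supp e z : e <= 1 -> r + 1 < `|z| -> near_op e z = 0.
Proof.
move=> e1 rz; rewrite /near_op (@eq_Rintegral _ _ _ _ _ (cst 0)).
  by rewrite Rintegral_cst// mul0r.
move=> y _; rewrite /near_kernel; case: ifPn => [/andP[_ ye]|_]; last by rewrite mul0r.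
have zy : `|z| <= `|z + y| + `|y| by rewrite -[in leLHS](addrK y z) ler_normB.
have zy' : `|z| <= `|z - y| + `|y| by rewrite -[in leLHS](subrK y z) ler_normD.
by rewrite !(bump_supp bpsi) ?addr0 ?mul0r ?subr0 ?mulr0//; lra.
Qed.

Lemma measurable_near_op e : measurable_fun setT (near_op e).
Proof. by have mn := mnear e; apply: measurable_Rint_snd; meas. Qed.

Lemma measurable_far_conv e : measurable_fun setT (far_conv e).
Proof. by have mn := mfar e; apply: measurable_Rint_snd; meas. Qed.

Lemma bump_le_om : exists2 B : R, 0 < B & forall x, `|psi x| <= B * om x.
Proof.
have [B B0 omB] := om_shift kp r.
have o0 := om_gt0 kp (0 : 'rV[R]_d).
exists ((M + 1) * (B / om (0 : 'rV[R]_d))).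
  by rewrite mulr_gt0 ?divr_gt0// ltr_wpDl.
move=> x; have [xr|xr] := leP `|x| r; last first.
  by rewrite (bump_supp bpsi)// normr0 mulr_ge0// mulr_ge0 ?addr_ge0// divr_ge0 ?ltW.
rewrite (@le_trans _ _ (M + 1))//; first by rewrite (le_trans (psiM x))// lerDl.
rewrite -mulrA ler_peMr ?addr_ge0// mulrAC ler_pdivlMr// mul1r omB//.
by rewrite sub0r normrN.
Qed.

Lemma far_conv_le_om e : 0 < e ->
  exists2 B : R, 0 < B & forall x, (\int[mu]_y (far e y * `|psi (x - y)|)%:E <= (B * om x)%:E)%E.
Proof.
move=> e0; have [B B0 pB] := bump_le_om.
have [B' B'0 fB] := far_convolve_om kp e0.
have mf := mfar e.
have f0 y : 0 <= far e y by rewrite (far_ge0 kp)// ltW.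
exists (B * B'); first by rewrite mulr_gt0.
move=> x; apply: (@le_trans _ _ (\int[mu]_y (B * (far e y * om (x - y)))%:E)%E).
  apply: ge0_intle; [by meas|by meas|by move=> y; rewrite mulr_ge0|].
  by move=> y; rewrite mulrCA ler_wpM2l.
rewrite ge0_intZ ?(ltW B0)//; [|by meas|by move=> y; rewrite mulr_ge0].
by rewrite -mulrA EFinM lee_wpmul2l ?lee_fin ?(ltW B0).
Qed.

End nonlocal_decomposition.

End weights.


(** * The estimate in space *)

Section space_estimate.
Context {R : realType} {d : nat}.
Notation mu := (@lebesgue_rV R d).
Variables (a : R -> R) (D C : R) (K : 'rV[R]_d -> R).
Hypothesis kp : kernel_profile a D C K.
Notation om := (decay_weight a).
Notation far := (far_kernel K).
Notation far_mass := (far_mass K).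
Notation near_moment := (near_moment K).
Let om0 x : 0 <= om x := ltW (om_gt0 kp x).
Let mom : measurable_fun setT om := measurable_om kp.
Let mfar e : measurable_fun setT (far e) := measurable_far kp e.
Variables (psi : 'rV[R]_d -> R) (r M : R).
Hypothesis bpsi : bump r M psi.
Let mpsi := bump_meas bpsi.
Let psiM x : `|psi x| <= M := bump_bound bpsi x.
Let M0 : 0 <= M. Proof. by rewrite (le_trans _ (psiM 0)). Qed.
Notation near_op := (near_op K psi).
Notation far_conv := (far_convolution K psi).

Lemma eq_refl_le (x y : R) : x = y -> x <= y. Proof. by move=> ->. Qed.

Section one_function.
Variable w : 'rV[R]_d -> R.
Hypothesis mw : measurable_fun setT w.
Hypothesis wfin : (\int[mu]_y (`|w y| * om y)%:E < +oo)%E.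

Definition mollify (g : 'rV[R]_d -> R) (x : 'rV[R]_d) : R :=
  \int[mu]_y (w y * g (x - y)).

Lemma weighted_int_lty (g : 'rV[R]_d -> R) c : measurable_fun setT g ->
  (forall y, `|g y| <= c * om y) -> (\int[mu]_y (`|w y * g y|)%:E < +oo)%E.
Proof.
move=> mg gc.
have c0 : 0 <= c.
  by have := le_trans (normr_ge0 _) (gc 0); rewrite pmulr_lge0// (om_gt0 kp).
apply: (@le_lt_trans _ _ (\int[mu]_y (c * (`|w y| * om y))%:E)%E).
  apply: ge0_intle; [by meas|by meas|by []|move=> y].
  by rewrite normrM mulrCA ler_wpM2l.
by rewrite ge0_intZ//; [rewrite lte_mul_pinfty|meas|move=> y; rewrite mulr_ge0].
Qed.

Lemma om_le_shift (g : 'rV[R]_d -> R) c x : (forall y, `|g y| <= c * om y) ->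
  0 <= c -> exists c', forall y, `|g (x - y)| <= c' * om y.
Proof.
move=> gc c0; have [B B0 omB] := om_shift kp `|x|.
exists (c * B) => y; apply: (le_trans (gc _)); rewrite -mulrA ler_wpM2l//.
have -> : om y = om (- y) by rewrite /decay_weight normrN.
by apply: omB; rewrite opprK subrK.
Qed.

Lemma mollify_int (g : 'rV[R]_d -> R) c x : measurable_fun setT g ->
  (forall y, `|g y| <= c * om y) -> 0 <= c ->
  mu.-integrable setT (EFin \o (fun y => w y * g (x - y))).
Proof.
move=> mg gc c0; have [c' gc'] := om_le_shift x gc c0.
apply: integrable_absP; first by meas.
by apply: (@weighted_int_lty (fun y => g (x - y)) c'); [meas|].
Qed.

Lemma mollify_far_conv e x : 0 < e ->
  mollify (far_conv e) x = \int[mu]_v (far e v * mollify psi (x - v)).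
Proof.
move=> e0.
have f0 y : 0 <= far e y by rewrite (far_ge0 kp)// ltW.
have mfe := mfar e.
have [B B0 pB] := bump_le_om kp bpsi.
have [B' B'0 fB] := far_conv_le_om kp bpsi e0.
pose f y v := w y * (far e v * psi (x - y - v)).
have mf : measurable_fun setT (fun z : 'rV[R]_d * 'rV[R]_d => f z.1 z.2).
  by rewrite /f; meas.
have absE y v : `|f y v| = `|w y| * (far e v * `|psi (x - y - v)|).
  by rewrite !normrM (ger0_norm (f0 v)).
have inner y : (\int[mu]_v (`|f y v|)%:E = `|w y|%:E * \int[mu]_v (far e v * `|psi (x - y - v)|)%:E)%E.
  under eq_integral do rewrite absE.
  by rewrite ge0_intZ//; [meas|move=> v; rewrite mulr_ge0].
have fi1 y : (\int[mu]_v (`|f y v|)%:E < +oo)%E.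
  by rewrite inner lte_mul_pinfty// (le_lt_trans (fB _))// ltry.
have fi2 v : (\int[mu]_y (`|f y v|)%:E < +oo)%E.
  have [c' gc'] := om_le_shift (x - v) pB (ltW B0).
  apply: (@weighted_int_lty (fun y => far e v * psi (x - y - v)) (far e v * c')).
    by meas.
  move=> y; rewrite normrM (ger0_norm (f0 v)) -mulrA ler_wpM2l//.
  by rewrite [x - y - v]addrAC.
have fi : (\int[mu]_y \int[mu]_v (`|f y v|)%:E < +oo)%E.
  have [c' gc'] := @om_le_shift (fun y => B' * om y) B' x
    (fun y => eq_refl_le (ger0_norm (mulr_ge0 (ltW B'0) (om0 y)))) (ltW B'0).
  apply: (@le_lt_trans _ _ (\int[mu]_y (`|w y * (B' * om (x - y))|)%:E)%E).
    apply: ge0_le_integral => //.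
    - by move=> y _; apply: int_ge0.
    - apply: measurable_int_snd => //.
      by apply/measurable_EFinP; exact: measurableT_comp.
    - by meas.
    - move=> y _; rewrite inner normrM EFinM lee_wpmul2l ?lee_fin//.
      by rewrite ger0_norm ?mulr_ge0// ltW.
  apply: (@weighted_int_lty (fun y => B' * om (x - y)) c'); first by meas.
  by move=> y; exact: gc'.
transitivity (\int[mu]_y \int[mu]_v f y v).
  apply: eq_Rintegral => y _; rewrite /far_convolution /f.
  have ifar : mu.-integrable setT (EFin \o (fun v => far e v * psi (x - y - v))).
    apply: integrable_absP; first by meas.
    under eq_integral do rewrite normrM (ger0_norm (f0 _)).
    by rewrite (le_lt_trans (fB _))// ltry.
  by rewrite -RintegralZl.
rewrite (Rint_swap mf fi1 fi2 fi).
apply: eq_Rintegral => v _; rewrite /mollify /f -RintegralZl//.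
  by apply: eq_Rintegral => y _; rewrite mulrCA; congr (_ * (_ * psi _)); rewrite addrAC.
exact: mollify_int pB (ltW B0).
Qed.

Let nl e z := nonlocal_op K psi z - far_mass e * psi z.

(** Once the rate [far_mass e] is removed, the operator is the near part minus
    the convolution with the far kernel, and that convolution commutes with
    the mollification. *)
Lemma mollify_nonlocal e x : 0 < e -> e <= 1 ->
  ((`|mollify (nl e) x|)%:E <= \int[mu]_y (`|w y| * `|near_op e (x - y)|)%:E +
    \int[mu]_v (far e v * `|mollify psi (x - v)|)%:E)%E.
Proof.
move=> e0 e1.
have f0 y : 0 <= far e y by rewrite (far_ge0 kp)// ltW.
have mfe := mfar e.
have mn := measurable_near_op kp bpsi e.
have mfc := measurable_far_conv kp bpsi e.
have [B B0 fB] := far_conv_le_om kp bpsi e0.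
have i2 : mu.-integrable setT (EFin \o (fun y => w y * far_conv e (x - y))).
  apply: (@mollify_int (far_conv e) B) => // [y|]; last exact: ltW.
  have mm : measurable_fun setT (fun v => far e v * psi (y - v)) by meas.
  rewrite -lee_fin (le_trans (abs_Rint_le _ mm))//.
  by under eq_integral do rewrite normrM (ger0_norm (f0 _)).
have [c cn] : exists c, forall y, `|near_op e (x - y)| <= c * om y.
  have [B1 B10 omB] := om_shift kp (r + 1).
  have ox := om_gt0 kp x.
  exists (M * near_moment e * (B1 / om x)) => y.
  have Mn : 0 <= M * near_moment e by rewrite mulr_ge0// (near_moment_ge0 kp).
  have [xy|xy] := leP `|x - y| (r + 1); last first.
    rewrite (near_op_supp K bpsi e1 xy) normr0 mulr_ge0// mulr_ge0//.
    by rewrite divr_ge0// ltW.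
  apply: (le_trans (near_op_bound kp bpsi (x - y) e1)).
  by rewrite -mulrA ler_peMr// mulrAC ler_pdivlMr// mul1r omB.
have mnx : measurable_fun setT (fun y : 'rV[R]_d => near_op e (x - y)) by meas.
have i1 : mu.-integrable setT (EFin \o (fun y => w y * near_op e (x - y))).
  by apply: integrable_absP; [meas|exact: weighted_int_lty cn].
have -> : mollify (nl e) x = \int[mu]_y (w y * near_op e (x - y)) - mollify (far_conv e) x.
  rewrite /mollify -RintegralB//; apply: eq_Rintegral => y _.
  by rewrite /nl (nonlocal_split kp bpsi _ e0 e1); ring.
rewrite (@le_trans _ _ (`|\int[mu]_y (w y * near_op e (x - y))|%:E + `|mollify (far_conv e) x|%:E)%E)//.
  by rewrite -EFinD lee_fin ler_normB.
apply: leeD.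
  apply: (le_trans (abs_Rint_le _ _)); first by meas.
  by under eq_integral do rewrite normrM.
rewrite mollify_far_conv//; apply: (le_trans (abs_Rint_le _ _)).
  have mm : measurable_fun setT (mollify psi) by apply: measurable_Rint_snd; meas.
  by meas.
by under eq_integral do rewrite normrM (ger0_norm (f0 _)).
Qed.

End one_function.

Let nl e z := nonlocal_op K psi z - far_mass e * psi z.

Variables (rho : 'rV[R]_d -> R) (r0 Mr : R).
Hypothesis brho : bump r0 Mr rho.
Hypothesis rho0 : forall x, 0 <= rho x.
Hypothesis rho_pos : (0 < \int[mu]_x (rho x)%:E)%E.
Notation Om := (Om a rho).

(** [mollify_nonlocal] is integrated against [Om]. The far convolution is moved
    onto the weight, where [far_convolve_Om] applies; the near part costs only
    [near_moment e]. The factor [far_mass e + C1] of the last integral is the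
    one that the gain [(kap + far_mass e)^-1] of [time_estimate] absorbs. *)
Lemma space_estimate : exists c C1 : R, [/\ 0 <= c, 0 < C1 &
  forall (w : 'rV[R]_d -> R) (W e : R), measurable_fun setT w ->
    (\int[mu]_y (`|w y| * om y)%:E <= W%:E)%E -> 0 < e -> e <= 1 ->
    (\int[mu]_x (Om x * `|mollify w (nl e) x|)%:E <=
     (c * near_moment e * W)%:E +
     (far_mass e + C1)%:E * \int[mu]_x (Om x * `|mollify w psi x|)%:E)%E].
Proof.
have [BO BO0 OB] := Om_le kp brho rho0.
have [B B0 LB] := local_convolution kp (r + 1).
have [C1 C10 FO] := far_convolve_Om kp brho rho0 rho_pos.
have mOm := measurable_Om kp brho.
have Om0 := Om_ge0 kp rho0.
exists (BO * (M * B)), C1; split => //.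
  by rewrite mulr_ge0 ?mulr_ge0 ?(ltW BO0) ?(ltW B0).
move=> w W e mw wW e0 e1.
have wfin : (\int[mu]_y (`|w y| * om y)%:E < +oo)%E by rewrite (le_lt_trans wW) ?ltry.
have f0 y : 0 <= far e y by rewrite (far_ge0 kp)// ltW.
have mfe := mfar e.
have mn := measurable_near_op kp bpsi e.
have mh : measurable_fun setT (mollify w psi) by apply: measurable_Rint_snd; meas.
have mnl : measurable_fun setT (nl e).
  rewrite /nl (_ : (fun z => _) = fun z => near_op e z - far_conv e z).
    by have mfc := measurable_far_conv kp bpsi e; meas.
  by apply/funext => z; rewrite (nonlocal_split kp bpsi _ e0 e1); ring.
have mb : measurable_fun setT (mollify w (nl e)) by apply: measurable_Rint_snd; meas.
have [G GE] : exists G, G = fun x => (\int[mu]_y (`|w y| * `|near_op e (x - y)|)%:E)%E.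
  by eexists.
pose H' x := (\int[mu]_v (far e v * `|mollify w psi (x - v)|)%:E)%E.
have [H HE] : exists H, H = H' by exists H'.
rewrite /H' in HE.
have mG : measurable_fun setT G.
  by rewrite GE; apply: measurable_int_snd; [meas|move=> x y; rewrite lee_fin mulr_ge0].
have mH : measurable_fun setT H.
  by rewrite HE; apply: measurable_int_snd; [meas|move=> x y; rewrite lee_fin mulr_ge0].
have mOG : measurable_fun setT (fun x => (Om x)%:E * G x)%E.
  by apply: emeasurable_funM; [meas|exact: mG].
have mOH : measurable_fun setT (fun x => (Om x)%:E * H x)%E.
  by apply: emeasurable_funM; [meas|exact: mH].
have G0 x : (0 <= G x)%E by rewrite GE; apply: int_ge0 => y; rewrite mulr_ge0.
have H0 x : (0 <= H x)%E by rewrite HE; apply: int_ge0 => y; rewrite mulr_ge0.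
apply: (@le_trans _ _ (\int[mu]_x ((Om x)%:E * G x + (Om x)%:E * H x))%E).
  apply: ge0_le_integral => //.
  - by move=> x _; rewrite lee_fin mulr_ge0.
  - by meas.
  - by apply: emeasurable_funD; [exact: mOG|exact: mOH].
  - move=> x _; rewrite -ge0_muleDr// EFinM lee_wpmul2l ?lee_fin//.
    by rewrite GE HE; exact: mollify_nonlocal.
rewrite (ge0_integralD _ measurableT _ mOG _ mOH); last 2 first.
- by move=> x _; rewrite mule_ge0// lee_fin.
- by move=> x _; rewrite mule_ge0// lee_fin.
apply: leeD.
  apply: (@le_trans _ _ (\int[mu]_x \int[mu]_y (Om x * (`|w y| * `|near_op e (x - y)|))%:E)%E).
    apply: ge0_le_integral => //.
    - by move=> x _; rewrite mule_ge0// lee_fin.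
    - apply: measurable_int_snd; [by meas|by move=> x y; rewrite lee_fin !mulr_ge0].
    - move=> x _; rewrite GE ge0_intZ//; by [meas|move=> y; rewrite mulr_ge0].
  rewrite tonelli_swap//; [|by meas|by move=> x y; rewrite lee_fin !mulr_ge0].
  apply: (@le_trans _ _ (\int[mu]_y (BO * (M * B) * near_moment e * (`|w y| * om y))%:E)%E).
    apply: ge0_le_integral => //.
    - by move=> y _; apply: int_ge0 => x; rewrite !mulr_ge0.
    - apply: measurable_int_fst; [by meas|by move=> x y; rewrite lee_fin !mulr_ge0].
    - by meas.
    - move=> y _.
      apply: (@le_trans _ _ (\int[mu]_x (BO * `|w y| * (om x * `|near_op e (x - y)|))%:E)%E).
        apply: ge0_intle; [by meas|by meas|by move=> x; rewrite !mulr_ge0|].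
        move=> x; rewrite mulrA [Om x * _]mulrC -!mulrA [BO * _]mulrC -!mulrA ler_wpM2l//.
        by rewrite mulrCA ler_wpM2l// mulrC OB.
      have cc : 0 <= BO * `|w y| by rewrite mulr_ge0// ltW.
      rewrite ge0_intZ//; [|by meas|by move=> x; rewrite !mulr_ge0].
      have [_ h] := LB (near_op e) (M * near_moment e) y mn
        (fun z => near_op_bound kp bpsi z e1) (fun z => near_op_supp K bpsi e1).
      apply: (@le_trans _ _ ((BO * `|w y|)%:E * (M * near_moment e * B * om y)%:E)%E).
        by rewrite lee_wpmul2l ?lee_fin.
      rewrite -EFinM lee_fin le_eqVlt; apply/orP; left; apply/eqP; ring.
  have cc : 0 <= BO * (M * B) * near_moment e.
    by rewrite !mulr_ge0 ?(near_moment_ge0 kp) ?(ltW BO0) ?(ltW B0).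
  rewrite ge0_intZ//; [|by meas|by move=> x; rewrite !mulr_ge0].
  by rewrite [leRHS]EFinM lee_wpmul2l ?lee_fin.
have -> : (\int[mu]_x ((Om x)%:E * H x) =
    \int[mu]_x \int[mu]_v (Om x * (far e v * `|mollify w psi (x - v)|))%:E)%E.
  apply: eq_integral => x _; rewrite HE ge0_intZ//; by [meas|move=> y; rewrite mulr_ge0].
rewrite tonelli_swap//; [|by meas|by move=> x y; rewrite lee_fin !mulr_ge0].
have -> : (\int[mu]_v \int[mu]_x (Om x * (far e v * `|mollify w psi (x - v)|))%:E =
    \int[mu]_v \int[mu]_x (`|mollify w psi x| * (far e v * Om (x + v)))%:E)%E.
  apply: eq_integral => v _.
  rewrite -(@ge0_integral_rV_shift R d (fun x => (Om x * (far e v * `|mollify w psi (x - v)|))%:E) v).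
  - by apply: eq_integral => x _; rewrite addrK; congr EFin; ring.
  - by meas.
  - by move=> x; rewrite lee_fin !mulr_ge0.
rewrite tonelli_swap//; [|by meas|by move=> x y; rewrite lee_fin !mulr_ge0].
have cc : 0 <= far_mass e + C1.
  by rewrite addr_ge0 ?(ltW C10)//; apply/fine_ge0/int_ge0 => v; exact: f0.
rewrite -ge0_intZ//; [|by meas|by move=> x; rewrite mulr_ge0].
apply: ge0_le_integral => //.
- by move=> y _; apply: int_ge0 => x; rewrite !mulr_ge0.
- apply: measurable_int_fst; [by meas|by move=> x y; rewrite lee_fin !mulr_ge0].
- by meas.
- move=> x _; rewrite ge0_intZ//; [|by meas|by move=> v; rewrite mulr_ge0].
  apply: (@le_trans _ _ (`|mollify w psi x|%:E * ((far_mass e + C1) * Om x)%:E)%E).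
    by rewrite lee_wpmul2l ?lee_fin// FO.
  by rewrite -EFinM lee_fin le_eqVlt; apply/orP; left; apply/eqP; ring.
Qed.

End space_estimate.


(** * The estimate in time *)

(** A smoothed Heaviside function [s] and its derivative [sg]. Their relation
    enters the time estimate through the weak equation, so that only the
    normalization [step_int] of the rescaled derivatives is recorded. *)
Record smooth_step {R : realType} (s sg : R -> R) (S : R) : Prop := SmoothStep {
  step_meas : measurable_fun setT s ;
  step_dmeas : measurable_fun setT sg ;
  step_dge0 : forall x, 0 <= sg x ;
  step_dbound : forall x, sg x <= S ;
  step_dout : forall x, ~~ (0 < x < 1) -> sg x = 0 ;
  step_01 : forall x, 0 <= s x <= 1 ;
  step_0 : forall x, x <= 0 -> s x = 0 ;
  step_1 : forall x, 1 <= x -> s x = 1 ;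
  step_int : forall b e, 0 < e ->
    (\int[lebesgue_measure]_t (sg ((t - b) / e) / e)%:E = 1)%E }.

Section exponential_tail.
Context {R : realType}.
Notation leb := (@lebesgue_measure R).

Lemma integral_exp_tail (c s : R) : 0 < c ->
  (\int[leb]_t ((\1_[set t | s < t] t) * expR (- c * t))%:E <=
   (c^-1 * expR (- c * s))%:E)%E.
Proof.
move=> c0.
have mi (q : R) : measurable_fun setT (\1_[set t : R | q < t] : R -> R).
  apply: measurable_indic; rewrite (_ : [set _ | _] = `]q, +oo[%classic)//.
  by apply/seteqP; split => x /=; rewrite in_itv/= andbT.
have me : measurable_fun setT (fun t : R => expR (- c * t)).
  by apply: measurableT_comp => //; meas.
have mt : measurable_fun setT (fun t : R => (\1_[set t | s < t] t) * expR (- c * t)).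
  by have := mi s => ?; meas.
rewrite -(ge0_integral_shiftR (f := fun t => ((\1_[set t | s < t] t) * expR (- c * t))%:E) s)//.
- have ip := integral_exponential_pdf c0; pose p := exponential_pdf c.
  apply: (@le_trans _ _ (\int[leb]_t (c^-1 * expR (- c * s) * p t)%:E)%E).
    apply: ge0_intle.
    + apply: (measurableT_comp mt); by meas.
    + by have := measurable_exponential_pdf c => mp; meas.
    + by move=> x; rewrite mulr_ge0// expR_ge0.
    + move=> t; rewrite !indicE /=; have [t0|t0] := ltP 0 t.
        rewrite mem_set/=; last by rewrite ltrDr.
        rewrite mul1r /p exponential_pdfE ?(ltW t0)// mulrDr expRD.
        rewrite mulrACA mulVf ?gt_eqF// mul1r mulrC.
        by rewrite le_eqVlt eqxx.
      rewrite memNset/= ?mul0r; last by rewrite ltrDr; apply/negP; rewrite -leNgt.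
      by rewrite !mulr_ge0 ?expR_ge0 ?invr_ge0 ?(ltW c0)// exponential_pdf_ge0 ?ltW.
  have cc : 0 <= c^-1 * expR (- c * s) by rewrite mulr_ge0 ?expR_ge0 ?invr_ge0 ?ltW.
  rewrite ge0_intZ//; last 2 first.
    exact: measurable_exponential_pdf.
    by move=> t; rewrite exponential_pdf_ge0 ?ltW.
  by rewrite ip mule1.
- by meas.
Qed.

End exponential_tail.

Lemma aeS d (T : measurableType d) (R : realType)
    (m : {measure set T -> \bar R}) (P Q : T -> Prop) :
  (forall x, P x -> Q x) -> {ae m, forall x, P x} -> {ae m, forall x, Q x}.
Proof. by move=> PQ; apply: filterS. Qed.

Lemma aeS2 d (T : measurableType d) (R : realType)
    (m : {measure set T -> \bar R}) (P Q S : T -> Prop) :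
  (forall x, P x -> Q x -> S x) ->
  {ae m, forall x, P x} -> {ae m, forall x, Q x} -> {ae m, forall x, S x}.
Proof. by move=> PQS; apply: filterS2. Qed.

Lemma integral_indic_itv (R : realType) (x y : R) b0 b1 : x < y ->
  (\int[@lebesgue_measure R]_u
     (\1_[set` Interval (BSide b0 x) (BSide b1 y)] u)%:E = (y - x)%:E)%E.
Proof.
move=> xy; rewrite integral_indic// setIT; have := lebesgue_measure_itv (Interval (BSide b0 x) (BSide b1 y)).
by rewrite /= lte_fin xy.
Qed.

Lemma ind_lt (R : realType) (t u : R) :
  (\1_[set v : R | v < t] : R -> R) u = (u < t)%R%:R.
Proof. by rewrite indicE; congr (nat_of_bool _)%:R; apply/idP/idP; rewrite inE. Qed.

Lemma ind_itv (R : realType) (i : interval R) (u : R) :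
  (\1_[set` i] : R -> R) u = (u \in i)%:R.
Proof. by rewrite indicE; congr (nat_of_bool _)%:R; apply/idP/idP; rewrite inE. Qed.

(** [weak] states that [e^(lam t) h] has the weak derivative
    [- e^(lam t) be], with differences of smooth steps as test functions. *)
Section time_estimate.
Context {R : realType}.
Notation leb := (@lebesgue_measure R).
Variables (s sg : R -> R) (S : R).
Hypothesis step : smooth_step s sg S.
Variables (T lam M : R) (h be : R -> R).
Hypothesis T0 : 0 < T.
Hypothesis lam0 : 0 <= lam.
Hypothesis mh : measurable_fun setT h.
Hypothesis mbe : measurable_fun setT be.
Hypothesis hM : forall t, `|h t| <= M.
Hypothesis beM : forall t, `|be t| <= M.
Hypothesis hout : forall t, ~~ (0 < t < T) -> h t = 0.
Hypothesis beout : forall t, ~~ (0 < t < T) -> be t = 0.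
Hypothesis weak : forall a b e, 0 < a -> a < b -> 0 < e -> b + e < T ->
  \int[leb]_t ((sg ((t - a) / e) / e - sg ((t - b) / e) / e) * (expR (lam * t) * h t)) =
  \int[leb]_t ((s ((t - a) / e) - s ((t - b) / e)) * (expR (lam * t) * be t)).
Hypothesis trace : forall e, 0 < e -> exists2 tau : R, 0 < tau &
  {ae leb, forall t, 0 < t < tau -> `|h t| <= e}.

Let M0 : 0 <= M. Proof. by rewrite (le_trans _ (hM 0)). Qed.
Let S0 : 0 <= S. Proof. by rewrite (le_trans _ (step_dbound step 0)) ?(step_dge0 step). Qed.
Let ms := step_meas step.
Let msg := step_dmeas step.
Let me : measurable_fun setT (fun t : R => expR (lam * t)).
Proof. by apply: measurableT_comp => //; meas. Qed.

Let f t := expR (lam * t) * h t.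
Let g t := expR (lam * t) * be t.
Let E := expR (lam * T).

Let fE t : `|f t| <= E * M.
Proof.
rewrite /f; have [t0T|t0T] := boolP (0 < t < T); last first.
  by rewrite hout// mulr0 normr0 mulr_ge0// expR_ge0.
rewrite normrM ger0_norm ?expR_ge0// ler_pM ?expR_ge0//.
by rewrite ler_expR ler_wpM2l// ltW//; have /andP[] := t0T.
Qed.

Let gE t : `|g t| <= E * M.
Proof.
rewrite /g; have [t0T|t0T] := boolP (0 < t < T); last first.
  by rewrite beout// mulr0 normr0 mulr_ge0// expR_ge0.
rewrite normrM ger0_norm ?expR_ge0// ler_pM ?expR_ge0//.
by rewrite ler_expR ler_wpM2l// ltW//; have /andP[] := t0T.
Qed.

Let mf : measurable_fun setT f. Proof. by rewrite /f; meas. Qed.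
Let mg : measurable_fun setT g. Proof. by rewrite /g; meas. Qed.

Let avg b e := \int[leb]_t ((sg ((t - b) / e) / e) * f t).

Let msgb b e : measurable_fun setT (fun t : R => sg ((t - b) / e) / e).
Proof. by meas. Qed.

Let sgb0 b e t : 0 < e -> 0 <= sg ((t - b) / e) / e.
Proof. by move=> e0; rewrite divr_ge0 ?(step_dge0 step)// ltW. Qed.

Let sgb_out b e t : 0 < e -> ~~ (b < t < b + e) -> sg ((t - b) / e) / e = 0.
Proof.
move=> e0 bt; rewrite (step_dout step) ?mul0r//; apply: contraNN bt.
rewrite pmulr_lgt0 ?invr_gt0// subr_gt0 ltr_pdivrMr// mul1r ltrBlDl.
by [].
Qed.

Let avg_int b e (p : R -> R) X : 0 < e -> measurable_fun setT p ->
  (forall t, `|p t| <= X) ->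
  leb.-integrable setT (EFin \o (fun t => (sg ((t - b) / e) / e) * p t)).
Proof.
move=> e0 mp pX; have m1 := msgb b e; have X0 : 0 <= X by rewrite (le_trans _ (pX 0)).
apply: integrable_absP; first by meas.
apply: (@le_lt_trans _ _ (\int[leb]_t (X * (sg ((t - b) / e) / e))%:E)%E).
  apply: ge0_intle; [by meas|by meas|by []|move=> t].
  by rewrite normrM ger0_norm ?sgb0// mulrC ler_wpM2r ?sgb0.
rewrite ge0_intZ//; last by move=> t; exact: sgb0.
by rewrite (step_int step)// mule1 ltry.
Qed.

Let avg_le b e X : 0 < e -> 0 <= X ->
  {ae leb, forall t, b < t < b + e -> `|f t| <= X} -> `|avg b e| <= X.
Proof.
move=> e0 X0 fX; have m1 := msgb b e.
have m2 : measurable_fun setT (fun t : R => (sg ((t - b) / e) / e) * f t) by meas.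
rewrite -lee_fin; apply: (le_trans (abs_Rint_le leb m2)).
apply: (@le_trans _ _ (\int[leb]_t (X * (sg ((t - b) / e) / e))%:E)%E).
  apply: ae_ge0_le_integral => //.
  - by meas.
  - by move=> t _; rewrite lee_fin mulr_ge0// sgb0.
  - by meas.
  - apply: (aeS _ fX) => t ft _; rewrite lee_fin normrM ger0_norm ?sgb0// mulrC.
    have [bt|bt] := boolP (b < t < b + e); last by rewrite sgb_out// !mulr0.
    by rewrite ler_wpM2r ?sgb0// ft.
rewrite ge0_intZ//; last by move=> t; exact: sgb0.
by rewrite (step_int step)// mule1.
Qed.

(** The averaging density is at most [S / e] and is supported in the ball of
    radius [e] around [b]: the average converges at Lebesgue points. *)
Let avg_davg b e : 0 < e -> ((`|avg b e - f b|)%:E <= (2 * S)%:E * davg f b e)%E.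
Proof.
move=> e0; have m1 := msgb b e.
have -> : avg b e - f b = \int[leb]_t ((sg ((t - b) / e) / e) * (f t - f b)).
  transitivity (avg b e - \int[leb]_t ((sg ((t - b) / e) / e) * f b)).
    rewrite RintegralZr//; last first.
      apply: integrable_absP; first exact: m1.
      under eq_integral do rewrite ger0_norm ?sgb0//.
      by rewrite (step_int step)// ltry.
    rewrite [X in _ = _ - X * _](_ : _ = 1) ?mul1r//.
    by rewrite /Rintegral (step_int step).
  rewrite -RintegralB//; [|exact: avg_int|].
    by apply: eq_Rintegral => t _; rewrite mulrBr.
  exact: (avg_int _ _ _ (fun=> lexx `|f b|)).
have m2 : measurable_fun setT (fun t : R => f t - f b) by meas.
apply: (le_trans (abs_Rint_le _ _)); first by meas.
have mB : measurable (ball b e) by exact: measurable_ball.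
have mi : measurable_fun setT (\1_(ball b e) : R -> R) by exact: measurable_indic.
apply: (@le_trans _ _ (\int[leb]_t (S / e * (`|f t - f b| * \1_(ball b e) t))%:E)%E).
  apply: ge0_intle; [by meas|by meas|by []|move=> t].
  rewrite normrM ger0_norm ?sgb0// indicE.
  have [bt|bt] := boolP (b < t < b + e).
    rewrite mem_set/=; last first.
      rewrite ball_itv /= in_itv/=; case/andP: bt => bt1 ->; rewrite andbT.
      by rewrite (le_lt_trans _ bt1)// gerBl ltW.
    by rewrite mulr1 ler_wpM2r// ler_wpM2r ?invr_ge0 ?(ltW e0)// (step_dbound step).
  by rewrite sgb_out// mul0r mulr_ge0 ?divr_ge0 ?(ltW e0)// mulr_ge0.
have Se0 : 0 <= S / e by rewrite divr_ge0// ltW.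
rewrite ge0_intZ; [|exact: Se0|by meas|by move=> t; rewrite mulr_ge0].
rewrite /davg /iavg lebesgue_measure_ball ?(ltW e0)//.
have -> : (\int[leb]_x (`|f x - f b| * \1_(ball b e) x)%:E =
    \int[leb]_(y in ball b e) `|((center (f b) \o f) y)%:E|)%E.
  rewrite [RHS]integral_mkcond; apply: eq_integral => x _.
  rewrite patchE indicE; case: ifPn => _; first by rewrite mulr1.
  by rewrite mulr0.
rewrite inver mulrn_eq0/= gt_eqF// muleA -EFinM.
rewrite (_ : 2 * S * (e *+ 2)^-1 = S / e)//.
by rewrite -mulr_natl; field; rewrite gt_eqF.
Qed.

Let phi t := (\int[leb]_u (\1_[set u | u < t] u * `|g u|)%:E)%E.

Let mind (t : R) : measurable_fun setT (\1_[set u : R | u < t] : R -> R).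
Proof.
apply: measurable_indic; rewrite (_ : [set _ | _] = `]-oo, t[%classic)//.
Qed.

Let phi_lt t : phi t \is a fin_num.
Proof.
have phi0 : (0 <= phi t)%E by apply: int_ge0 => u; rewrite mulr_ge0.
have mi := mind t.
rewrite ge0_fin_numE//.
have mT : measurable (`]0, T[%classic : set R) by exact: measurable_itv.
have miT : measurable_fun setT (\1_`]0, T[ : R -> R) by exact: measurable_indic.
apply: (@le_lt_trans _ _ (\int[leb]_u (E * M * \1_`]0, T[ u)%:E)%E).
  apply: ge0_intle; [by meas|by meas|by move=> u; rewrite mulr_ge0|move=> u].
  rewrite [X in _ <= _ * X]indicE; have [u0T|u0T] := boolP (0 < u < T).
    rewrite mem_set/= ?in_itv// mulr1 (le_trans _ (gE u))// ler_piMl//.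
  rewrite /g beout// mulr0 normr0 mulr0 mulr_ge0// mulr_ge0//.
  exact: expR_ge0.
rewrite ge0_intZ//; last by rewrite mulr_ge0// expR_ge0.
by rewrite integral_indic_itv// -EFinM ltry.
Qed.

Let phi_add b e : 0 < e -> (phi (b + e)%R <= phi b + (E * M * e)%:E)%E.
Proof.
move=> e0; have m1 := mind b; have m2 := mind (b + e).
have mI : measurable_fun setT (\1_`[b, b + e[ : R -> R) by exact: measurable_indic.
have EM0 : 0 <= E * M by rewrite mulr_ge0// expR_ge0.
apply: (@le_trans _ _ (\int[leb]_u (\1_[set u | u < b] u * `|g u| + E * M * \1_`[b, b + e[ u)%:E)%E).
  apply: ge0_intle; [by meas|by meas|by move=> u; rewrite mulr_ge0|move=> u].
  rewrite !ind_lt ind_itv in_itv/=; have [ub|ub] := ltP u b.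
    by rewrite (lt_trans ub) ?ltrDl//= !mul1r mulr0 addr0.
  rewrite mul0r add0r; have [ube|ube] /= := ltP u (b + e).
    by rewrite mul1r mulr1 gE.
  by rewrite mul0r mulr0.
rewrite ge0_intD; [|by meas|by meas|by move=> u; rewrite mulr_ge0|by move=> u; rewrite mulr_ge0].
rewrite ge0_intZ// leeD2l// integral_indic_itv ?ltrDl//.
by rewrite addrAC subrr add0r EFinM.
Qed.

(** The test function is the difference of the steps at [a] and [b], where [a]
    is so small that the trace condition bounds the average at [a] by [eps]. *)
Let avg_phi b eps : 0 < b -> b < T -> 0 < eps -> exists2 d0 : R, 0 < d0 &
  forall e, 0 < e -> e < d0 -> (`|avg b e|%:E <= phi (b + e)%R + eps%:E)%E.
Proof.
move=> b0 bT eps0.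
have E0 : 0 < E := expR_gt0 _.
have [tau tau0 htau] := trace (divr_gt0 eps0 E0).
(* the support (a, a + e) of the average lies below tau *)
pose a := Num.min (b / 2) (tau / 2).
have a0 : 0 < a by rewrite lt_min !divr_gt0.
have ab : a < b by rewrite gt_min ltr_pdivrMr// ltr_pMr// ltr1n.
have atau : a <= tau / 2 by rewrite ge_min lexx orbT.
exists (Num.min (tau / 2) (T - b)).
  by rewrite lt_min divr_gt0// subr_gt0.
move=> e e0; rewrite lt_min => /andP[etau eT].
have beT : b + e < T by rewrite addrC -ltrBrDr.
have aT : a + e < T by rewrite (lt_trans _ beT)// ltrD2r.
have m1 := msgb a e; have m2 := msgb b e.
have mia := mind (b + e).
have hw : avg b e = avg a e - \int[leb]_t ((s ((t - a) / e) - s ((t - b) / e)) * g t).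
  have := weak a0 ab e0 beT; rewrite -/(g _) => hw.
  rewrite -[X in avg a e - X]hw.
  have -> : \int[leb]_t ((sg ((t - a) / e) / e - sg ((t - b) / e) / e) * (expR (lam * t) * h t)) = avg a e - avg b e.
    rewrite /avg -RintegralB//; last 2 first.
      exact: avg_int.
      exact: avg_int.
    by apply: eq_Rintegral => t _; rewrite /f mulrBl.
  by rewrite opprB addrC subrK.
rewrite hw (@le_trans _ _ ((`|avg a e| + `|\int[leb]_t ((s ((t - a) / e) - s ((t - b) / e)) * g t)|)%:E))//.
  by rewrite lee_fin ler_normB.
rewrite EFinD addeC leeD//.
  have ms1 : measurable_fun setT (fun t : R => s ((t - a) / e)) by meas.
  have ms2 : measurable_fun setT (fun t : R => s ((t - b) / e)) by meas.
  apply: (le_trans (abs_Rint_le _ _)); first by meas.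
  apply: ge0_intle; [by meas|by meas|by []|move=> t].
  rewrite normrM ler_wpM2r// indicE; have [tb|tb] := ltP t (b + e).
    rewrite mem_set//=.
    have /andP[s1 s2] := step_01 step ((t - a) / e).
    have /andP[s3 s4] := step_01 step ((t - b) / e).
    by rewrite ler_norml; apply/andP; split; lra.
  rewrite !(step_1 step) ?subrr ?normr0//.
    by rewrite ler_pdivlMr// mul1r lerBrDl.
  by rewrite ler_pdivlMr// mul1r lerBrDl (le_trans _ tb)// lerD2r ltW.
rewrite lee_fin; apply: avg_le => //; first exact: ltW.
apply: (aeS _ htau) => t ht /andP[at_ tae].
have t0 : 0 < t := lt_trans a0 at_.
have tT : t < T := lt_trans tae aT.
have ttau : t < tau.
  by rewrite (lt_le_trans tae)// [tau]splitr lerD// ltW.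
rewrite /f normrM ger0_norm ?expR_ge0//.
rewrite (@le_trans _ _ (E * (eps / E)))//.
  rewrite ler_pM ?expR_ge0//; last by apply: ht; rewrite t0 ttau.
  by rewrite ler_expR ler_wpM2l// ltW.
by rewrite mulrC divfK ?gt_eqF.
Qed.

Let f_loc : locally_integrable setT f.
Proof.
split => //; first exact: openT.
move=> A _ cA; have mA := compact_measurable cA.
apply: (@le_lt_trans _ _ (\int[leb]_(x in A) (cst (E * M)%:E x))%E).
  apply: ge0_le_integral => //.
  - by apply: measurable_funTS; meas.
  - by move=> x _; rewrite lee_fin.
by rewrite integral_cst// lte_mul_pinfty ?lee_fin ?mulr_ge0 ?expR_ge0//; exact: compact_finite_measure.
Qed.

(** At a Lebesgue point [b] the averages of [e^(lam t) h] tend to its value,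
    while [avg_phi] bounds them by the primitive of the right-hand side. *)
Lemma abs_le_primitive : {ae leb, forall b, 0 < b < T ->
  ((expR (lam * b) * `|h b|)%:E <=
   \int[leb]_u (\1_[set u | u < b] u * (expR (lam * u) * `|be u|))%:E)%E}.
Proof.
apply: (aeS _ (lebesgue_differentiation f_loc)) => b lb /andP[b0 bT].
have -> : (\int[leb]_u (\1_[set u | u < b] u * (expR (lam * u) * `|be u|))%:E = phi b)%E.
  by apply: eq_integral => u _; rewrite /g normrM (ger0_norm (expR_ge0 _)).
have -> : expR (lam * b) * `|h b| = `|f b| by rewrite /f normrM (ger0_norm (expR_ge0 _)).
apply/lee_addgt0Pr => eps eps0.
have e3 : 0 < eps / 3 by rewrite divr_gt0.
have [d0 d00 hd] := avg_phi b0 bT e3.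
have S1 : 0 < 2 * S + 1 by rewrite ltr_wpDl// mulr_ge0.
have EM1 : 0 < E * M + 1 by rewrite ltr_wpDl// mulr_ge0// expR_ge0.
have dav0 : 0 < eps / 3 / (2 * S + 1) by rewrite divr_gt0.
have em0 : 0 < eps / 3 / (E * M + 1) by rewrite divr_gt0.
have near1 : \forall r \near (0 : R)^'+, (davg f b r < (eps / 3 / (2 * S + 1))%:E)%E.
  have /lb : nbhs (0%E : \bar R) [set u | (u < (eps / 3 / (2 * S + 1))%:E)%E].
    by apply: open_ereal_lt'; rewrite lte_fin.
  exact.
have near2 := nbhs_right_lt d00.
have near3 := nbhs_right_lt em0.
have near4 := @nbhs_right_gt _ (0 : R).
near (0 : R)^'+ => e.
have h1 : (davg f b e < (eps / 3 / (2 * S + 1))%:E)%E by near: e.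
have h2 : e < d0 by near: e.
have h3 : e < eps / 3 / (E * M + 1) by near: e.
have h4 : 0 < e by near: e.
apply: (@le_trans _ _ (`|avg b e|%:E + `|avg b e - f b|%:E)%E).
  rewrite -EFinD lee_fin distrC; have := ler_normD (f b - avg b e) (avg b e).
  by rewrite subrK addrC.
have k1 := hd e h4 h2.
have k2 := phi_add b h4.
have k3 := avg_davg b h4.
have k4 : (`|avg b e - f b|%:E <= (eps / 3)%:E)%E.
  apply: (le_trans k3).
  apply: (@le_trans _ _ ((2 * S)%:E * (eps / 3 / (2 * S + 1))%:E)%E).
    by rewrite lee_wpmul2l ?lee_fin ?mulr_ge0// ltW.
  rewrite -EFinM lee_fin mulrA ler_pdivrMr//.
  by have := S0; have := e3; nra.
have k5 : ((E * M * e)%:E <= (eps / 3)%:E)%E.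
  rewrite lee_fin (@le_trans _ _ (E * M * (eps / 3 / (E * M + 1))))//.
    by rewrite ler_wpM2l ?mulr_ge0 ?expR_ge0// ltW.
  rewrite mulrA ler_pdivrMr//.
  have : 0 <= E * M by rewrite mulr_ge0 ?expR_ge0.
  by have := e3; nra.
have := phi_lt b; case: (phi b) k1 k2 => [q| |]// k1 k2 _.
move: k1 k2 k4 k5; have := phi_lt (b + e); case: (phi (b + e)) => [q'| |]// _.
by rewrite -!EFinD !lee_fin; lra.
Unshelve. all: by end_near. Qed.

(** [abs_le_primitive] is multiplied by [e^(-(kap + lam) t)] and integrated;
    after exchanging the integrals, the tail of the exponential yields the
    factor [(kap + lam)^-1]. The gain of [lam] is what makes the truncation of
    the kernel harmless. *)
Lemma time_estimate (kap : R) : 0 < kap ->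
  (\int[leb]_t (expR (- kap * t) * `|h t|)%:E <=
   (kap + lam)^-1%:E * \int[leb]_t (expR (- kap * t) * `|be t|)%:E)%E.
Proof.
move=> kap0; pose c := kap + lam.
have c0 : 0 < c by rewrite ltr_wpDr.
have mek : measurable_fun setT (fun t : R => expR (- kap * t)).
  by apply: measurableT_comp => //; meas.
have mec : measurable_fun setT (fun t : R => expR (- c * t)).
  by apply: measurableT_comp => //; meas.
pose p (t u : R) : R := if u < t then 1 else 0.
have pE t u : p t u = (\1_[set v : R | v < t] : R -> R) u.
  by rewrite ind_lt /p; case: ifP.
have p0 t u : 0 <= p t u by rewrite /p; case: ifP.
have mp : measurable_fun setT (fun z : R * R => p z.1 z.2).
  by apply: measurable_fun_ifT => //; apply: measurable_fun_ltr.
have mp1 t : measurable_fun setT (p t).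
  exact: (measurableT_comp mp (measurable_pair1 t)).
have mp2 u : measurable_fun setT (p ^~ u).
  exact: (measurableT_comp mp (measurable_pair2 u)).
pose F (t u : R) : R := expR (- c * t) * (p t u * (expR (lam * u) * `|be u|)).
have mF : measurable_fun setT (fun z : R * R => F z.1 z.2) by rewrite /F; meas.
have F0 t u : 0 <= F t u by rewrite !mulr_ge0 ?expR_ge0.
apply: (@le_trans _ _ (\int[leb]_t \int[leb]_u (F t u)%:E)%E).
  apply: ae_ge0_le_integral => //.
  - by meas.
  - by move=> t _; apply: int_ge0.
  - apply: measurable_int_snd; first exact/measurable_EFinP.
    by move=> *; rewrite lee_fin.
  - apply: (aeS _ abs_le_primitive) => t ht _.
    have [t0T|t0T] := boolP (0 < t < T); last first.
      by rewrite hout// normr0 mulr0; apply: int_ge0.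
    rewrite /F ge0_intZ ?expR_ge0//; [|by have := mp1 t => ?; meas|].
      rewrite (_ : expR (- kap * t) * `|h t| = expR (- c * t) * (expR (lam * t) * `|h t|)).
        rewrite EFinM lee_wpmul2l ?lee_fin ?expR_ge0//.
        apply: (le_trans (ht t0T)); rewrite le_eqVlt; apply/orP; left; apply/eqP.
        by apply: eq_integral => u _; rewrite pE.
      by rewrite mulrA -expRD; congr (expR _ * _); rewrite /c; ring.
    by move=> u; rewrite !mulr_ge0 ?expR_ge0.
rewrite tonelli_swap; [|exact/measurable_EFinP|by move=> *; rewrite lee_fin].
rewrite -ge0_intZ; [|by rewrite invr_ge0 ltW|by meas|
  by move=> t; rewrite mulr_ge0 ?expR_ge0].
apply: ge0_le_integral => //.
- by move=> u _; apply: int_ge0 => t; exact: F0.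
- apply: measurable_int_fst; first exact/measurable_EFinP.
  by move=> *; rewrite lee_fin.
- by meas.
- move=> u _.
  have -> : (\int[leb]_t (F t u)%:E =
      (expR (lam * u) * `|be u|)%:E * \int[leb]_t ((\1_[set t | u < t] t) * expR (- c * t))%:E)%E.
    have mq : measurable_fun setT (fun t : R => p t u * expR (- c * t)).
      by have := mp2 u => ?; meas.
    rewrite -ge0_intZ.
    + apply: eq_integral => t _; rewrite /F indicE /p; congr EFin.
      have [ut|ut] := ltP u t; first by rewrite mem_set//=; ring.
      by rewrite memNset/= ?mul0r ?mulr0//; apply/negP; rewrite -leNgt.
    + by rewrite mulr_ge0 ?expR_ge0.
    + apply: (eq_measurable_fun _ _ mq) => t _ /=.
      rewrite indicE /p; have [ut|ut] := ltP u t; first by rewrite mem_set.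
      by rewrite memNset//=; apply/negP; rewrite -leNgt.
    + by move=> t; rewrite mulr_ge0 ?expR_ge0.
  apply: (@le_trans _ _ ((expR (lam * u) * `|be u|)%:E * (c^-1 * expR (- c * u))%:E)%E).
    by rewrite lee_wpmul2l ?integral_exp_tail// lee_fin mulr_ge0 ?expR_ge0.
  rewrite -EFinM lee_fin le_eqVlt; apply/orP; left; apply/eqP.
  rewrite (_ : expR (- kap * u) = expR (lam * u) * expR (- c * u)); first by ring.
  by rewrite -expRD; congr expR; rewrite /c; ring.
Qed.

End time_estimate.


(** * Smooth functions and smooth steps on the line *)

Section smooth_functions.
Context {R : realType} {V : normedModType R}.
Implicit Types f g : V -> R.

(** Smoothness involves all iterated directional derivatives; it follows from
    membership in any class of differentiable functions that is stable under
    directional derivatives. *)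
Lemma smooth_class (G : (V -> R) -> Prop) :
  (forall f, G f -> (forall x, differentiable f x) /\
    forall v, G (fun x => 'D_v f x)) ->
  forall f, G f -> smooth f.
Proof.
move=> GP f Gf vs; suff : G (iter_derive vs f) by move=> /GP[].
by elim: vs => [//|v vs ih] /=; have [_] := GP _ ih; exact.
Qed.

Lemma smooth_diff f x : smooth f -> differentiable f x.
Proof. by move=> sf; exact: (sf [::] x). Qed.

Lemma smooth_derive f v : smooth f -> smooth (fun x => 'D_v f x).
Proof.
move=> sf vs; suff -> : iter_derive vs (fun x => 'D_v f x) =
  iter_derive (rcons vs v) f by exact: sf.
by elim: vs => [//|u vs ih] /=; rewrite ih.
Qed.

(** Sums and products are generated together because the derivative of a
    product is a sum of products. *)
Inductive smooth_alg : (V -> R) -> Prop :=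
| SmoothGen f : smooth f -> smooth_alg f
| SmoothCst c : smooth_alg (cst c)
| SmoothAdd f g : smooth_alg f -> smooth_alg g -> smooth_alg (f + g)
| SmoothMul f g : smooth_alg f -> smooth_alg g -> smooth_alg (f * g).

Lemma smooth_algE f : smooth_alg f -> smooth f.
Proof.
apply: smooth_class => {f} f.
elim=> {f} [f sf|c|f g _ [df Df] _ [dg Dg]|f g sf [df Df] sg [dg Dg]].
- by split=> [x|v]; [exact: smooth_diff|apply: SmoothGen; exact: smooth_derive].
- split=> [x|v]; first exact: differentiable_cst.
  rewrite (_ : (fun x => _) = cst 0); first exact: SmoothCst.
  by apply/funext => x; rewrite derive_cst.
- split=> [x|v]; first exact: differentiableD.
  rewrite (_ : (fun x => _) = (fun x => 'D_v f x) + (fun x => 'D_v g x)).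
    exact: SmoothAdd.
  by apply/funext => x; rewrite deriveD//; exact: diff_derivable.
- split=> [x|v]; first exact: differentiableM.
  rewrite (_ : (fun x => _) = f * (fun x => 'D_v g x) + g * (fun x => 'D_v f x)).
    by apply: SmoothAdd; exact: SmoothMul.
  by apply/funext => x; rewrite deriveM//; exact: diff_derivable.
Qed.

Lemma smooth_cst c : smooth (cst c : V -> R).
Proof. by apply: smooth_algE; exact: SmoothCst. Qed.

Lemma smoothM f g : smooth f -> smooth g -> smooth (fun x => f x * g x).
Proof.
by move=> sf sg; apply: (@smooth_algE (f * g)); apply: SmoothMul; exact: SmoothGen.
Qed.

Lemma smoothD f g : smooth f -> smooth g -> smooth (fun x => f x + g x).
Proof.
by move=> sf sg; apply: (@smooth_algE (f + g)); apply: SmoothAdd; exact: SmoothGen.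
Qed.

Lemma smoothB f g : smooth f -> smooth g -> smooth (fun x => f x - g x).
Proof.
move=> sf sg; apply: smoothD => //.
rewrite (_ : (fun x => _) = fun x => cst (-1) x * g x); last first.
  by apply/funext => x; rewrite /= mulN1r.
by apply: smoothM => //; exact: smooth_cst.
Qed.

Lemma smooth_prod (I : Type) (r : seq I) (F : I -> V -> R) :
  (forall i, smooth (F i)) -> smooth (fun x => \prod_(i <- r) F i x).
Proof.
move=> sF; elim: r => [|i r ih].
  rewrite (_ : (fun x => _) = cst 1); first exact: smooth_cst.
  by apply/funext => x; rewrite big_nil.
rewrite (_ : (fun x => _) = fun x => F i x * \prod_(j <- r) F j x).
  exact: smoothM.
by apply/funext => x; rewrite big_cons.
Qed.

End smooth_functions.

Section smooth_composition.
Context {R : realType} {V : normedModType R}.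

Lemma smooth_comp_affine (F : R -> R) (l : {linear V -> R}) (c : R) :
  smooth F -> continuous l -> smooth (fun z => F (l z + c)).
Proof.
move=> sF cl.
pose G (f : V -> R) := exists H : R -> R, smooth H /\ f = fun z => H (l z + c).
apply: (@smooth_class R V G); last by exists F.
move=> _ [H [sH ->]].
have dl z : differentiable (fun z => l z + c) z.
  by apply: differentiableD; [exact: linear_differentiable|exact: differentiable_cst].
split.
  move=> z; apply: (differentiable_comp (dl z)).
  exact: (smooth_diff (l z + c) sH).
move=> v; exists (fun x => 'D_(l v) H x); split; first exact: smooth_derive.
apply/funext => z.
rewrite deriveE; last first.
  by apply: (differentiable_comp (dl z)); exact: smooth_diff.
rewrite (diff_comp (dl z) (smooth_diff _ sH)) /=.
rewrite [RHS]deriveE; last exact: smooth_diff.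
congr ('d H _ _).
rewrite (_ : (fun z => l z + c) = (l : V -> R) + cst c)//.
rewrite diffD//; last exact: linear_differentiable.
by rewrite /= diff_cst/= addr0 diff_lin.
Qed.

End smooth_composition.

Section smooth_line.
Context {R : realType}.

Lemma derive_dir (F : R -> R) (x v : R) : differentiable F x ->
  'D_v F x = v * 'D_1 F x.
Proof.
move=> dF; rewrite !deriveE//.
by rewrite -[v in LHS]mulr1 -[v * 1]/(v *: (1 : R^o)) linearZ.
Qed.

Lemma smooth_line_class (G : (R -> R) -> Prop) :
  (forall f, G f -> exists2 g, G g & forall x, is_derive x (1 : R) f (g x)) ->
  (forall f k, G f -> G (fun x => k * f x)) ->
  forall f, G f -> smooth f.
Proof.
move=> GD GZ; apply: smooth_class => f Gf; have [g Gg fg] := GD f Gf.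
have df x : differentiable f x by apply/derivable1_diffP; have [] := fg x.
split => // v; rewrite (_ : (fun x => _) = fun x => v * g x); first exact: GZ.
by apply/funext => x; rewrite derive_dir//; have [_ ->] := fg x.
Qed.

Lemma smooth_expR_lin (lam : R) : smooth (fun t : R => expR (lam * t)).
Proof.
pose G (f : R -> R) := exists k : R, f = fun t => k * expR (lam * t).
apply: (@smooth_line_class G); last by exists 1; apply/funext => x; rewrite mul1r.
  move=> _ [k ->]; exists (fun t => (k * lam) * expR (lam * t)); first by exists (k * lam).
  move=> x.
  have h := is_deriveZ lam (is_derive_id x (1 : R)).
  have h2 := is_deriveZ k (is_derive1_comp (is_derive_expR (lam * x)) h).
  rewrite (_ : k * lam * expR (lam * x) = k *: (expR (lam * x) * (lam *: (1 : R)))).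
    exact: h2.
  by rewrite /GRing.scale/= mulr1 mulrAC -mulrA.
by move=> _ k [k' ->]; exists (k * k'); apply/funext => x; rewrite mulrA.
Qed.

End smooth_line.

Section flat_function.
Context {R : realType}.
Implicit Types p : {poly R}.

(** The functions [p(1/x) e^(-1/x)], extended by 0 to the left, form a class
    that is stable under derivation, through [dflat]. *)
Definition flat p (x : R) : R := if 0 < x then p.[x^-1] * expR (- x^-1) else 0.

Definition dflat p : {poly R} := (p - p^`()) * 'X^2.

Lemma exprn_le_expR (n : nat) (y : R) : 0 <= y -> y ^+ n <= n`!%:R * expR y.
Proof.
case: n => [|n] y0.
  by rewrite expr0 fact0 mul1r -expR0 ler_expR.
have := expR_ge1Dxn n y0; set F := _`!%:R => h.
have F0 : 0 < F by rewrite ltr0n fact_gt0.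
have : y ^+ n.+1 / F <= expR y by rewrite (le_trans _ h)// lerDr.
by rewrite ler_pdivrMr// mulrC.
Qed.

Lemma horner_bound p : exists n (c : R), 0 <= c /\
  forall y, 1 <= y -> `|p.[y]| <= c * y ^+ n.
Proof.
elim/poly_ind: p => [|p a [n [c [c0 ih]]]].
  by exists 0, 0; split => // y _; rewrite horner0 normr0 mul0r.
exists n.+1, (c + `|a|); split; first by rewrite addr_ge0.
move=> y y1; rewrite hornerMXaddC (le_trans (ler_normD _ _))// mulrDl lerD//.
  rewrite normrM exprSr mulrA ler_pM// ?ih// ger0_norm//.
  exact: le_trans y1.
by rewrite ler_peMr// exprn_ege1.
Qed.

(** [e^(-1/x)] beats every power of [1/x]; quadratic decay already gives the
    derivative 0 at the origin. *)
Lemma flat_le_sqr p : exists2 c : R, 0 <= c &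
  forall x, `|x| <= 1 -> `|flat p x| <= c * x ^+ 2.
Proof.
have [n [c [c0 pc]]] := horner_bound p.
exists (c * n.+2`!%:R); first by rewrite mulr_ge0.
move=> x x1; rewrite /flat; case: ifPn => x0; last by rewrite normr0 mulr_ge0 ?sqr_ge0 ?mulr_ge0.
have y0 : 0 < x^-1 by rewrite invr_gt0.
have y1 : 1 <= x^-1 by rewrite invf_ge1// (le_trans _ x1)// ler_norm.
rewrite normrM (ger0_norm (expR_ge0 _)) (le_trans (ler_wpM2r (expR_ge0 _) (pc _ y1)))//.
rewrite -!mulrA ler_wpM2l// expRN ler_pdivrMr ?expR_gt0// -mulrA.
rewrite [x ^+ 2 * _]mulrC mulrA -ler_pdivrMr ?exprn_gt0// -exprVn -exprD addn2.
exact/exprn_le_expR/ltW.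
Qed.

Lemma is_derive_flat p (x : R) : is_derive x (1 : R) (flat p) (flat (dflat p) x).
Proof.
have [x0|x0|->] := ltgtP x 0.
- have -> : flat (dflat p) x = 0 by rewrite /flat (lt_gtF x0).
  have h : is_derive x (1 : R) (cst 0 : R -> R) 0 by exact: is_derive_cst.
  apply: near_eq_is_derive h.
  near=> y; rewrite /flat ifF//; apply/negbTE; rewrite -leNgt ltW//.
  by near: y; exact: lt_nbhsl.
- pose f := fun y : R => p.[y^-1] * expR (- y^-1).
  have nf : \near x, f x = flat p x.
    near=> y; rewrite /flat /f ifT//.
    by near: y; exact: lt_nbhsr.
  apply: (near_eq_is_derive nf).
  have x00 : x != 0 by rewrite gt_eqF.
  have h1 : is_derive x (1 : R) (fun y => y^-1) (- x ^- 2 *: (1 : R)).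
    by apply: is_deriveV.
  have h2 := is_derive1_comp (is_derive_poly p x^-1) h1.
  have h4 : is_derive x (1 : R) (fun y => - y^-1) (- (- x ^- 2 *: (1 : R))).
    exact: is_deriveN h1.
  have h3 := @is_derive1_comp R expR (fun y => - y^-1) x _ _
    (is_derive_expR (- x^-1)) h4.
  have h5 : is_derive x (1 : R) f _ := is_deriveM h2 h3.
  apply: (is_derive_eq h5).
  rewrite /flat x0 /dflat !hornerE /=.
  by rewrite /GRing.scale/=; set E := expR _; field.
- have -> : flat (dflat p) 0 = 0 by rewrite /flat ltxx.
  have f0 : flat p 0 = 0 by rewrite /flat ltxx.
  have [c' c'0 fc'] := flat_le_sqr p.
  pose c := c' + 1; have c0 : 0 < c by rewrite ltr_wpDl.
  have fc y : `|y| <= 1 -> `|flat p y| <= c * y ^+ 2.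
    by move=> /fc' /le_trans -> //; rewrite ler_wpM2r ?sqr_ge0// lerDl.
  have cv : (fun h => h^-1 *: ((flat p \o shift 0) (h *: 1) - flat p 0)) @ 0^' --> (0 : R).
    apply/cvgr0Pnorm_le => e e0; near=> h.
    have h0 : h != 0 by near: h; exact: nbhs_dnbhs_neq.
    rewrite f0 subr0 /= addr0 /GRing.scale/= mulr1 normrM normfV.
    rewrite mulrC ler_pdivrMr ?normr_gt0// (le_trans (fc _ _))//.
      near: h; apply: dnbhs0_le; exact: ltr01.
    rewrite -[h ^+ 2]real_normK ?num_real// expr2 mulrA ler_wpM2r//.
    rewrite mulrC -ler_pdivlMr//.
    by near: h; apply: dnbhs0_le; rewrite divr_gt0.
  by apply: DeriveDef; [apply/cvg_ex; exists 0|exact: cvg_lim cv].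
Unshelve. all: by end_near. Qed.

Lemma smooth_flat p : smooth (flat p).
Proof.
apply: (@smooth_line_class _ (fun f => exists q, f = flat q)); last by exists p.
  move=> _ [q ->]; exists (flat (dflat q)); first by exists (dflat q).
  by move=> x; exact: is_derive_flat.
move=> _ k [q ->]; exists (k *: q); apply/funext => x.
by rewrite /flat; case: ifP => _; rewrite ?mulr0// hornerZ mulrA.
Qed.

End flat_function.

Section unit_bump.
Context {R : realType}.
Notation leb := (@lebesgue_measure R).

Definition ubump (x : R) : R := flat 1 x * flat 1 (1 - x).

Lemma smooth_ubump : smooth ubump.
Proof.
apply: smoothM; first exact: smooth_flat.
pose l : {linear R -> R} := -%R.
have -> : (fun x : R => flat 1 (1 - x)) = fun x => flat 1 (l x + 1).
  by apply/funext => x; rewrite addrC.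
apply: smooth_comp_affine; first exact: smooth_flat.
exact: opp_continuous.
Qed.

Lemma flat1_ge0 (x : R) : 0 <= flat 1 x.
Proof. by rewrite /flat; case: ifP => // _; rewrite hornerE mul1r expR_ge0. Qed.

Lemma ubump_ge0 x : 0 <= ubump x.
Proof. by rewrite mulr_ge0// flat1_ge0. Qed.

Lemma ubump_gt0 x : 0 < x < 1 -> 0 < ubump x.
Proof.
case/andP=> x0 x1; rewrite /ubump /flat subr_gt0 x0 x1 /= !hornerE.
by rewrite !mulr_gt0// expR_gt0.
Qed.

Lemma ubump_out x : ~~ (0 < x < 1) -> ubump x = 0.
Proof.
rewrite negb_and /ubump /flat subr_gt0.
by case/orP => /negbTE ->; rewrite ?mul0r ?mulr0.
Qed.

Lemma smooth_continuous (f : R -> R) : smooth f -> continuous f.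
Proof. by move=> sf x; apply: differentiable_continuous; exact: smooth_diff. Qed.

Lemma smooth_is_derive (f : R -> R) x : smooth f -> is_derive x (1 : R) f ('D_1 f x).
Proof. by move=> sf; apply: DeriveDef => //; apply: diff_derivable; exact: smooth_diff. Qed.

Lemma continuous_supp_bounded (f : R -> R) : continuous f ->
  (forall x, ~~ (0 < x < 1) -> f x = 0) -> exists2 B, 0 <= B & forall x, `|f x| <= B.
Proof.
move=> cf f0.
have [c _ hc] : exists2 c, c \in `[0, 1]%R & forall t, t \in `[0, 1]%R -> `|f t| <= `|f c|.
  apply: EVT_max => //; apply: continuous_subspaceT => x.
  by apply: continuous_comp; [exact: cf|exact: norm_continuous].
exists `|f c| => // x; have [x01|x01] := boolP (0 < x < 1).
  by apply: hc; rewrite in_itv/=; case/andP: x01 => /ltW -> /ltW ->.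
by rewrite f0// normr0.
Qed.

(** At the endpoints 0 and 1 the derivative vanishes by continuity. *)
Lemma derive_supp (f : R -> R) : smooth f ->
  (forall x, ~~ (0 < x < 1) -> f x = 0) ->
  forall x, ~~ (0 < x < 1) -> 'D_1 f x = 0.
Proof.
move=> sf f0.
have out x : (x < 0) || (1 < x) -> 'D_1 f x = 0.
  move=> hx; rewrite (@near_eq_derive _ _ _ f (cst 0)) ?derive_cst//.
  case/orP: hx => hx; near=> y; apply: f0; rewrite negb_and -!leNgt;
      apply/orP; [left|right]; apply/ltW.
    by near: y; exact: lt_nbhsl.
  by near: y; exact: lt_nbhsr.
have cD : continuous (fun x => 'D_1 f x) by apply: smooth_continuous; exact: smooth_derive.
have lim0 (x : R) (u : R ^nat) : u @ \oo --> x ->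
    (forall n, (u n < 0) || (1 < u n)) -> 'D_1 f x = 0.
  move=> ux uout.
  have h := cvg_comp _ _ ux (cD x).
  apply: (cvg_unique _ h); first exact: norm_hausdorff.
  rewrite (_ : _ \o u = cst 0); first exact: cvg_cst.
  by apply/funext => n /=; rewrite out.
move=> x; rewrite negb_and -!leNgt.
rewrite le_eqVlt [X in _ || X]le_eqVlt.
have c1 : (fun n => n.+1%:R^-1) @ \oo --> (0 : R) by exact: cvg_harmonic.
case/orP => /orP[/eqP|h]; [move=> ->|by rewrite out ?h|move=> <-|by rewrite out ?h ?orbT].
- apply: (lim0 0 (fun n => - n.+1%:R^-1)).
    by rewrite -oppr0; exact: cvgN.
  by move=> n; rewrite oppr_lt0 invr_gt0 ltr0n.
- apply: (lim0 1 (fun n => 1 + n.+1%:R^-1)).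
    by rewrite -[X in _ --> X]addr0; apply: cvgD => //; exact: cvg_cst.
  by move=> n; rewrite ltrDl invr_gt0 ltr0n orbT.
Unshelve. all: by end_near. Qed.

End unit_bump.

Section smooth_steps.
Context {R : realType}.
Notation leb := (@lebesgue_measure R).
Notation ub := (@ubump R).

Definition ustep_prim (x : R) : R := \int[leb]_(t in `]-oo, x]) ub t.

Lemma ubump_measurable : measurable_fun setT ub.
Proof. by apply: continuous_measurable_fun; apply/smooth_continuous/smooth_ubump. Qed.

Lemma ubump_integrable : leb.-integrable setT (EFin \o ub).
Proof.
have [B B0 hB] := continuous_supp_bounded (smooth_continuous (@smooth_ubump R)) (@ubump_out R).
apply/integrable_absP; first exact: ubump_measurable.
apply: (@le_lt_trans _ _ (\int[leb]_t (B * \1_`[0, 1] t)%:E)%E).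
  apply: ge0_intle => //.
  - by apply: measurableT_comp => //; exact: ubump_measurable.
  - by apply: measurable_funM => //; apply: measurable_indic.
  - move=> x; rewrite indicE; have [x01|x01] := boolP (0 < x < 1).
      by rewrite mem_set ?mulr1//= in_itv/=; case/andP: x01 => /ltW -> /ltW ->.
    by rewrite ubump_out// normr0 mulr_ge0.
by rewrite ge0_intZ// integral_indic_itv// -EFinM ltry.
Qed.

Lemma is_derive_ustep_prim x : is_derive x (1 : R) ustep_prim (ub x).
Proof.
have [||||d1 d2] := @continuous_FTC1 R ub -oo%O x (x + 1).
- by rewrite ltrDl.
- exact: integrableS ubump_integrable.
- exact: ltNyr.
- exact/smooth_continuous/smooth_ubump.
by apply: DeriveDef; rewrite -?derive1E.
Qed.

Lemma ustep_prim_le0 x : x <= 0 -> ustep_prim x = 0.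
Proof.
move=> x0; rewrite /ustep_prim /Rintegral integral0_eq// => t /=; rewrite in_itv/= => tx.
by rewrite ubump_out// negb_and -leNgt (le_trans tx).
Qed.

Lemma ustep_prim_diff x y : x < y ->
  exists2 c, c \in `]x, y[%R & ustep_prim y - ustep_prim x = ub c * (y - x).
Proof.
move=> xy; apply: MVT => //; first by move=> z _; exact: is_derive_ustep_prim.
apply: continuous_subspaceT => z.
apply: differentiable_continuous; apply/derivable1_diffP.
by have [] := is_derive_ustep_prim z.
Qed.

Lemma ustep_prim_ndec x y : x <= y -> ustep_prim x <= ustep_prim y.
Proof.
rewrite le_eqVlt => /orP[/eqP-> //|xy].
have [c _ h] := ustep_prim_diff xy.
by rewrite -subr_ge0 h mulr_ge0 ?ubump_ge0// subr_ge0 ltW.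
Qed.

Lemma ustep_prim_ge1 x : 1 <= x -> ustep_prim x = ustep_prim 1.
Proof.
rewrite le_eqVlt => /orP[/eqP<- //|x1].
have [c + /eqP] := ustep_prim_diff x1; rewrite in_itv/= => /andP[c1 _].
by rewrite ubump_out ?mul0r ?subr_eq0 => [/eqP //|]; rewrite negb_and -!leNgt (ltW c1) orbT.
Qed.

Lemma ustep_prim1_gt0 : 0 < ustep_prim 1.
Proof.
have [c + h] := @ustep_prim_diff 0 1 ltr01; rewrite in_itv/= => c01.
have : 0 < ustep_prim 1 - ustep_prim 0 by rewrite h subr0 mulr1 ubump_gt0.
by rewrite (@ustep_prim_le0 0)// subr0.
Qed.

Definition ustep (x : R) : R := ustep_prim x / ustep_prim 1.
Definition dustep (x : R) : R := ub x / ustep_prim 1.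

Lemma is_derive_ustep x : is_derive x (1 : R) ustep (dustep x).
Proof.
have h := is_deriveZ (ustep_prim 1)^-1 (is_derive_ustep_prim x).
rewrite (_ : ustep = (ustep_prim 1)^-1 \*: ustep_prim); last first.
  by apply/funext => y; rewrite /ustep mulrC.
by apply: (is_derive_eq h); rewrite /GRing.scale/= mulrC.
Qed.

Lemma smooth_dustep : smooth dustep.
Proof. by apply: smoothM; [exact: smooth_ubump|exact: smooth_cst]. Qed.

Lemma smooth_ustep : smooth ustep.
Proof.
pose G (f : R -> R) := smooth f \/ exists k, f = fun x => k * ustep x.
apply: (@smooth_line_class _ G); last first.
- by right; exists 1; apply/funext => x; rewrite mul1r.
- move=> f k [sf|[q ->]]; [left|right].
    by apply: smoothM => //; exact: smooth_cst.
  by exists (k * q); apply/funext => x; rewrite mulrA.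
- move=> f [sf|[q ->]].
    exists (fun x => 'D_1 f x); first by left; exact: smooth_derive.
    by move=> x; exact: smooth_is_derive.
  exists (fun x => q * dustep x); first by left; apply: smoothM; [exact: smooth_cst|exact: smooth_dustep].
  by move=> x; exact: is_deriveZ (is_derive_ustep x).
Qed.

Lemma ustep_smooth_step : exists S, smooth_step ustep dustep S.
Proof.
have I0 := ustep_prim1_gt0.
have [B B0 hB] := continuous_supp_bounded (smooth_continuous (@smooth_ubump R)) (@ubump_out R).
exists (B / ustep_prim 1); split.
- by apply: continuous_measurable_fun; apply/smooth_continuous/smooth_ustep.
- by apply: continuous_measurable_fun; apply/smooth_continuous/smooth_dustep.
- by move=> x; rewrite divr_ge0 ?ubump_ge0 ?ltW.
- by move=> x; rewrite ler_pM2r ?invr_gt0// (le_trans (ler_norm _) (hB x)).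
- by move=> x x01; rewrite /dustep ubump_out ?mul0r.
- move=> x; rewrite /ustep divr_ge0 ?(ltW I0)//=.
    rewrite ler_pdivrMr// mul1r.
    have [/ustep_prim_ndec//|x1] := leP x 1.
    by rewrite (ustep_prim_ge1 (ltW x1)).
  have [x0|x0] := leP x 0; first by rewrite ustep_prim_le0.
  by rewrite -(@ustep_prim_le0 0)// ustep_prim_ndec// ltW.
- by move=> x x0; rewrite /ustep ustep_prim_le0// mul0r.
- by move=> x x1; rewrite /ustep ustep_prim_ge1// divff// gt_eqF.
- move=> b e e0.
  have e0' : e != 0 by rewrite gt_eqF.
  pose F t := ustep ((t - b) / e).
  have h1 (t : R) : is_derive t (1 : R) (fun t : R => (t - b) / e) e^-1.
    have -> : (fun t : R => (t - b) / e) = (fun t => e^-1 *: (t + (- b))).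
      by apply/funext => y; rewrite mulrC.
    have h0 : is_derive t (1 : R) (fun t : R => e^-1 *: (t + (- b))) _ :=
      is_deriveZ e^-1 (is_deriveD (is_derive_id t (1 : R)) (is_derive_cst (- b) t (1 : R))).
    by apply: (is_derive_eq h0); rewrite addr0 /GRing.scale/= mulr1.
  have dF t : is_derive t (1 : R) F (dustep ((t - b) / e) / e).
    exact: (@is_derive1_comp R ustep (fun t => (t - b) / e) t _ _ (is_derive_ustep _) (h1 t)).
  have -> : (\int[leb]_t (dustep ((t - b) / e)%R / e)%:E =
      \int[leb]_(t in `[b, (b + e)%R]) (dustep ((t - b) / e)%R / e)%:E)%E.
    rewrite [RHS]integral_mkcond; apply: eq_integral => t _.
    rewrite patchE; case: ifPn => //; rewrite notin_setE/= in_itv/= => /negP h.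
    rewrite /dustep ubump_out ?mul0r//.
    apply: contra h => /andP[]; rewrite pmulr_lgt0 ?invr_gt0// subr_gt0 => /ltW ->.
    by rewrite ltr_pdivrMr// mul1r ltrBlDr addrC => /ltW ->.
  have cF : continuous F.
    move=> t; apply: differentiable_continuous; apply/derivable1_diffP.
    by have [] := dF t.
  rewrite (@continuous_FTC2 R _ F).
  + rewrite /F subrr mul0r addrAC subrr add0r divff// /ustep divff ?gt_eqF//.
    by rewrite ustep_prim_le0// mul0r sube0.
  + by rewrite ltrDl.
  + apply: continuous_subspaceT => t.
    apply: (@continuous_comp _ _ _ (fun t : R => (t - b) / e) (fun y : R => dustep y / e)).
      apply: differentiable_continuous; apply/derivable1_diffP.
      by have [] := h1 t.
    apply/smooth_continuous/smoothM; [exact: smooth_dustep|exact: smooth_cst].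
  + split.
    * by move=> t _; have [] := dF t.
    * by apply: cvg_at_right_filter; exact: cF.
    * by apply: cvg_at_left_filter; exact: cF.
  + by move=> t _; rewrite derive1E; have [_ ->] := dF t.
Qed.

End smooth_steps.


(** * Product bumps and space-time test functions *)

Section second_differences.
Context {R : realType} {V : normedModType R}.
Implicit Types f g : V -> R.

(** Unlike a bound on second differences alone, these bounds are stable under
    products. *)
Definition tame (B : R) f : Prop :=
  [/\ forall x, `|f x| <= B,
      forall x y, `|f (x + y) - f x| <= B * `|y| &
      forall x y, `|f (x + y) + f (x - y) - 2 * f x| <= B * `|y| ^+ 2].

Lemma tame_ge0 B f : tame B f -> 0 <= B.
Proof. by case=> /(_ 0) + _ _; exact: le_trans. Qed.

Lemma tameM B B' f g : tame B f -> tame B' g ->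
  tame (4 * (B * B')) (fun x => f x * g x).
Proof.
move=> tf tg; have B0 := tame_ge0 tf; have B'0 := tame_ge0 tg.
case: tf => fb fl f2; case: tg => gb gl g2.
have BB0 : 0 <= B * B' by rewrite mulr_ge0.
split.
- move=> x; rewrite normrM (le_trans (ler_pM _ _ (fb x) (gb x)))//.
  by rewrite ler_peMl// ler1n.
- move=> x y.
  rewrite (_ : _ - _ = f (x + y) * (g (x + y) - g x) + (f (x + y) - f x) * g x); last by ring.
  rewrite (le_trans (ler_normD _ _))// !normrM.
  have h1 := ler_pM (normr_ge0 _) (normr_ge0 _) (fb (x + y)) (gl x y).
  have h2 := ler_pM (normr_ge0 _) (normr_ge0 _) (fl x y) (gb x).
  apply: (le_trans (lerD h1 h2)).
  rewrite (_ : _ + _ = 2 * (B * B') * `|y|); last by ring.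
  by rewrite ler_wpM2r// ler_wpM2r// ler_nat.
- move=> x y; set F := f x; set G := g x.
  set F1 := f (x + y); set F2 := f (x - y); set G1 := g (x + y); set G2 := g (x - y).
  rewrite (_ : _ - _ = (F1 - F) * (G1 - G) + (F2 - F) * (G2 - G) +
     F * (G1 + G2 - 2 * G) + G * (F1 + F2 - 2 * F)); last by ring.
  have h1 := ler_pM (normr_ge0 _) (normr_ge0 _) (fl x y) (gl x y).
  have h2 := ler_pM (normr_ge0 _) (normr_ge0 _) (fl x (- y)) (gl x (- y)).
  have h3 := ler_pM (normr_ge0 _) (normr_ge0 _) (fb x) (g2 x y).
  have h4 := ler_pM (normr_ge0 _) (normr_ge0 _) (gb x) (f2 x y).
  rewrite !normrN -/F -/G -/F1 -/F2 -/G1 -/G2 in h1 h2 h3 h4.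
  rewrite -!normrM in h1 h2 h3 h4.
  apply: (le_trans (ler_normD _ _)); apply: (le_trans (lerD (ler_normD _ _) h4)).
  apply: (le_trans (lerD (lerD (ler_normD _ _) h3) (lexx _))).
  apply: (le_trans (lerD (lerD (lerD h1 h2) (lexx _)) (lexx _))).
  by rewrite le_eqVlt; apply/orP; left; apply/eqP; ring.
Qed.

Lemma tame1 : tame 1 (fun _ : V => 1).
Proof.
split=> [x|x y|x y]; first by rewrite normr1.
- by rewrite subrr normr0 mul1r.
- by rewrite (_ : 1 + 1 - 2 * 1 = 0 :> R) ?normr0 ?mul1r ?sqr_ge0//; ring.
Qed.

Lemma tame_prod (I : Type) (r : seq I) (F : I -> V -> R) :
  (forall i, exists B, tame B (F i)) -> exists B, tame B (fun x => \prod_(i <- r) F i x).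
Proof.
move=> tF; elim: r => [|i r [B tB]].
  by exists 1; under eq_fun do rewrite big_nil; exact: tame1.
have [B' tB'] := tF i; exists (4 * (B' * B)).
by under eq_fun do rewrite big_cons; exact: tameM.
Qed.

Lemma tame_continuous B f : tame B f -> continuous f.
Proof.
move=> tf; have B0 := tame_ge0 tf; case: tf => _ fl _ x.
apply/cvgrPdist_le => e e0; near=> y.
rewrite distrC; have := fl x (y - x); rewrite subrKC => /le_trans; apply.
apply: (@le_trans _ _ ((B + 1) * `|y - x|)).
  by rewrite ler_wpM2r// lerDl.
have B1 : 0 < B + 1 by rewrite ltr_wpDl.
rewrite mulrC -ler_pdivlMr// distrC.
near: y; apply: cvgr_dist_le; [exact: cvg_id|by rewrite divr_gt0// ltr_wpDl].
Unshelve. all: by end_near. Qed.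

Lemma reflect_continuous (c : V) : continuous (fun y => c - y).
Proof. by move=> y; apply: cvgB; [exact: cvg_cst|exact: cvg_id]. Qed.

End second_differences.

Section tame_line.
Context {R : realType}.

Lemma smooth_lip (f : R -> R) B : smooth f -> (forall x, `|'D_1 f x| <= B) ->
  forall x y, `|f x - f y| <= B * `|x - y|.
Proof.
move=> sf fB; have lt x y : x < y -> `|f y - f x| <= B * `|y - x|.
  move=> xy; have [||c _ ->] := @MVT R f (fun x => 'D_1 f x) x y xy.
    by move=> z _; exact: smooth_is_derive.
    by apply: continuous_subspaceT; exact: smooth_continuous.
  by rewrite normrM ler_wpM2r.
move=> x y; have [xy|xy|->] := ltgtP x y; last by rewrite !subrr normr0 mulr0.
  by rewrite distrC [in leRHS]distrC lt.
exact: lt.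
Qed.

(** By the mean value theorem a second difference is [y] times a difference of
    two values of the derivative at distance at most [2 |y|]. *)
Lemma smooth_tame (f : R -> R) : smooth f ->
  (forall x, ~~ (0 < x < 1) -> f x = 0) -> exists B, tame B f.
Proof.
move=> sf f0.
have [B0 B00 h0] := continuous_supp_bounded (smooth_continuous sf) f0.
have sf1 := smooth_derive (1 : R) sf; have f1 := derive_supp sf f0.
have [B1 B10 h1] := continuous_supp_bounded (smooth_continuous sf1) f1.
have sf2 := smooth_derive (1 : R) sf1; have f2 := derive_supp sf1 f1.
have [B2 B20 h2] := continuous_supp_bounded (smooth_continuous sf2) f2.
exists (B0 + B1 + 2 * B2); split.
- by move=> x; rewrite (le_trans (h0 x))// -addrA lerDl addr_ge0 ?mulr_ge0.
- move=> x y; rewrite (le_trans (smooth_lip sf h1 _ _))// addrAC subrr add0r.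
  by rewrite ler_wpM2r// addrAC lerDr addr_ge0 ?mulr_ge0.
- have pos x y : 0 < y -> `|f (x + y) + f (x - y) - 2 * f x| <= (B0 + B1 + 2 * B2) * `|y| ^+ 2.
    move=> y0.
    have mv a b : a < b -> exists2 c, c \in `]a, b[%R & f b - f a = 'D_1 f c * (b - a).
      move=> ab; apply: MVT => //; first by move=> z _; exact: smooth_is_derive.
      by apply: continuous_subspaceT; exact: smooth_continuous.
    have [|c1 c1i e1] := mv x (x + y); first by rewrite ltrDl.
    have [|c2 c2i e2] := mv (x - y) x; first by rewrite ltrBlDr ltrDl.
    rewrite (_ : _ - _ = (f (x + y) - f x) - (f x - f (x - y))); last by ring.
    rewrite e1 e2 (_ : x + y - x = y); last by ring.
    rewrite (_ : x - (x - y) = y); last by ring.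
    rewrite -mulrBl normrM expr2 mulrA ler_wpM2r//.
    apply: (le_trans (smooth_lip sf1 h2 _ _)).
    rewrite mulrDl ler_wpDl ?mulr_ge0 ?addr_ge0// mulrAC mulrC ler_wpM2r//.
    rewrite (gtr0_norm y0) ler_norml.
    by move: c1i c2i; rewrite !in_itv/=; lra.
  move=> x y; have [y0|y0|->] := ltgtP y 0; last 2 first.
  + exact: pos.
  + rewrite addr0 subr0 normr0 expr0n/= mulr0 (_ : _ - _ = 0) ?normr0//; ring.
  have := pos x (- y); rewrite oppr_gt0 opprK normrN => /(_ y0).
  by rewrite [f (x - y) + _]addrC.
Qed.

End tame_line.

Section product_bump.
Context {R : realType} {d : nat}.
Implicit Types (x y : 'rV[R]_d).
Notation mu := (@lebesgue_rV R d).

(** Supported in the cube [[0, e]^d] and not around the origin: translates by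
    points of the support then stay inside a box that is open to the right,
    which is how [mollify_injective] uses it. *)
Definition cbump (e : R) x : R := \prod_(i < d) ubump (x ord0 i / e).

Lemma cbump_ge0 e x : 0 <= cbump e x.
Proof. by rewrite prodr_ge0// => i _; exact: ubump_ge0. Qed.

Lemma cbump_supp e x : 0 < e -> cbump e x != 0 ->
  forall i, 0 < x ord0 i < e.
Proof.
move=> e0 h i; apply/negP => /negP xi; case/negP: h.
rewrite /cbump (bigD1 i)//= ubump_out ?mul0r//.
by rewrite ltr_pdivrMr// mul1r pmulr_lgt0 ?invr_gt0.
Qed.

Lemma cbump_out e x : 0 < e -> e < `|x| -> cbump e x = 0.
Proof.
move=> e0 ex; apply/eqP/negPn/negP => /(cbump_supp e0) h.
move: ex; rewrite ltNge => /negP; apply.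
apply/(rV_norm_leP x (ltW e0)) => i; have /andP[h1 h2] := h i.
by rewrite gtr0_norm// ltW.
Qed.

Lemma cbump_tame e : 0 < e -> exists B, tame B (cbump e).
Proof.
move=> e0; apply: tame_prod => i.
have [B tB] := smooth_tame (@smooth_ubump R) (@ubump_out R).
have B0 := tame_ge0 tB; case: tB => b1 b2 b3.
pose b := Num.max 1 e^-1.
have b1' : 1 <= b by rewrite le_max lexx.
have bn y : `|y ord0 i / e| <= b * `|y|.
  rewrite normrM mulrC ler_pM ?rV_coord_le_norm//.
  by rewrite gtr0_norm ?invr_gt0// le_max lexx orbT.
exists (B * b ^+ 2); split.
- by move=> x; rewrite (le_trans (b1 _))// ler_peMr// exprn_ege1.
- move=> x y; rewrite mxE mulrDl (le_trans (b2 _ _))// -mulrA ler_wpM2l//.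
  rewrite (le_trans (bn y))// ler_wpM2r//.
  by rewrite expr2 ler_peMr// (le_trans _ b1').
- move=> x y; have := b3 (x ord0 i / e) (y ord0 i / e).
  rewrite -mulrDl -mulrBl !mxE => /le_trans; apply; rewrite -mulrA ler_wpM2l//.
  by rewrite -exprMn lerXn2r// nnegrE ?mulr_ge0// (le_trans _ b1').
Qed.

Lemma cbump_continuous e : 0 < e -> continuous (cbump e).
Proof. by move=> /cbump_tame [B /tame_continuous]. Qed.

Lemma cbump_bump e : 0 < e -> exists M, bump e M (cbump e).
Proof.
move=> e0; have [B tB] := cbump_tame e0; exists B; case: (tB) => b1 _ b3; split => //.
- by apply: continuous_measurable_rV; exact: cbump_continuous.
- by move=> x; exact: cbump_out.
Qed.

Lemma integral_cbump_gt0 e : 0 < e -> (0 < \int[mu]_x (cbump e x)%:E)%E.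
Proof.
move=> e0.
pose B : set 'rV[R]_d := [set x | forall i, `[e / 4, 3 * e / 4]%classic (x ord0 i)].
have mB : measurable B by apply: (@measurable_rV_box R d (fun _ => `[e / 4, 3 * e / 4]%classic)).
have mc : measurable_fun setT (cbump e) by have [M /bump_meas] := cbump_bump e0.
pose m : R := (expR (- 8)) ^+ d.
apply: (@lt_le_trans _ _ (\int[mu]_x (m * \1_B x)%:E)%E).
  rewrite ge0_intZ ?exprn_ge0 ?expR_ge0//.
  rewrite integral_indic// setIT.
  have mB' : mu B = (\prod_(i < d) lebesgue_measure `[(e / 4)%R, (3 * e / 4)%R]%classic)%E.
    by apply: (lebesgue_rV_box (A := fun _ : 'I_d => `[e / 4, 3 * e / 4]%classic)).
  suff : (0 < m%:E * \prod_(i < d) lebesgue_measure `[(e / 4)%R, (3 * e / 4)%R]%classic)%E.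
    by rewrite -mB'.
  rewrite mule_gt0// ?lte_fin ?exprn_gt0 ?expR_gt0//.
  elim/big_ind: _ => //; first by move=> u v; exact: mule_gt0.
  move=> i _; rewrite lebesgue_measure_itv/= lte_fin.
  by rewrite ifT ?lte_fin; lra.
apply: ge0_intle => //.
  by apply: measurable_funM => //; apply: measurable_indic.
  by move=> x; rewrite mulr_ge0// ?exprn_ge0 ?expR_ge0// indicE.
move=> x; rewrite indicE; have [xB|xB] := pselect (B x); last first.
  by rewrite memNset// mulr0 cbump_ge0.
have -> : m = \prod_(i < d) expR (- 8) by rewrite prodr_const card_ord.
rewrite mem_set// mulr1 /cbump; apply: ler_prod => i _.
rewrite expR_ge0/=; have := xB i; rewrite /= in_itv/= => /andP[h1 h2].
set z := x ord0 i / e.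
have z1 : 4^-1 <= z by rewrite /z ler_pdivlMr// mulrC.
have z2 : 4^-1 <= 1 - z.
  suff : z <= 3 / 4 by lra.
  by rewrite /z ler_pdivrMr// mulrAC.
(* on [e / 4, 3 e / 4] both factors of [ubump] are at least e^(-4) *)
have f4 (y : R) : 4^-1 <= y -> expR (- 4) <= flat 1 y.
  move=> y4; have y0 : 0 < y by lra.
  rewrite /flat y0 hornerE mul1r ler_expR lerN2 -[leRHS]invrK lef_pV2 ?posrE//.
rewrite (_ : - 8 = - 4 + - 4); last by ring.
by rewrite expRD ler_pM ?expR_ge0 ?f4.
Qed.

Lemma csupport_sub (W : topologicalType) (f : W -> R) (A : set W) : closed A ->
  (forall z, f z != 0 -> A z) -> csupport f `<=` A.
Proof.
move=> cA fA; rewrite (closure_id A).1// /csupport.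
by apply: closure_subset => z /=; exact: fA.
Qed.

Lemma compact_csupport (W : topologicalType) (f : W -> R) (A : set W) : closed A ->
  compact A -> (forall z, f z != 0 -> A z) -> compact (csupport f).
Proof.
move=> clA cA fA; apply: (subclosed_compact _ cA); first exact: closed_closure.
exact: csupport_sub.
Qed.

Definition box x (e : R) : set 'rV[R]_d :=
  [set y | forall i, `[x ord0 i - e, x ord0 i]%classic (y ord0 i)].

Lemma compact_box x e : compact (box x e).
Proof. apply: (@rV_compact R d (fun i => `[x ord0 i - e, x ord0 i]%classic)) => i; exact: segment_compact. Qed.

Lemma cbump_box e x y : 0 < e -> cbump e (x - y) != 0 -> box x e y.
Proof.
move=> e0 /(cbump_supp e0) h i /=; have := h i; rewrite !mxE in_itv/=; lra.
Qed.

Lemma Cc_cbump e x : 0 < e -> Cc (fun y => cbump e (x - y)).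
Proof.
move=> e0; split.
  move=> y; apply: (@continuous_comp _ _ _ (fun y => x - y) (cbump e)).
    exact: reflect_continuous.
  exact: cbump_continuous.
apply: (@compact_csupport _ _ (box x e)).
- by apply: compact_closed; [exact: norm_hausdorff|exact: compact_box].
- exact: compact_box.
- by move=> y; exact: cbump_box.
Qed.

End product_bump.

Section test_functions.
Context {R : realType} {d : nat}.
Implicit Types (x y : 'rV[R]_d).
Notation xt := ('rV[R]_d * R)%type.

Lemma smooth_comp_line (V : normedModType R) (F : R -> R) (l : V -> R) (c : R) :
  linear (l : V -> R^o) -> continuous l -> smooth F -> smooth (fun z => F (l z + c)).
Proof.
move=> ll cl sF.
pose L : {linear V -> R} := HB.pack l (GRing.isLinear.Build R V R^o _ l ll).
exact: (@smooth_comp_affine R V F L c sF cl).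
Qed.

(** Paired with a solution, the space factor produces the mollification at [x];
    the exponential removes the rate [lam] from the equation. *)
Definition test_fun (e lam et a b : R) x (z : xt) : R :=
  cbump e (x - z.1) * (expR (lam * z.2) *
    (ustep ((z.2 - a) / et) - ustep ((z.2 - b) / et))).

Lemma smooth_space_coord (F : R -> R) (e : R) x (i : 'I_d) : smooth F ->
  smooth (fun z : xt => F ((x - z.1) ord0 i / e)).
Proof.
move=> sF; pose l (z : xt) : R := - (e^-1 * z.1 ord0 i).
have -> : (fun z : xt => F ((x - z.1) ord0 i / e)) = fun z => F (l z + x ord0 i / e).
  by apply/funext => z; congr F; rewrite /l !mxE; ring.
apply: smooth_comp_line => //.
  by move=> k u v; rewrite /l /= !mxE /GRing.scale/=; ring.
have lE : l = (fun t : R => - e^-1 * t) \o (fun y : 'rV[R]_d => y ord0 i) \o fst.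
  by apply/funext => z; rewrite /l /= mulNr.
rewrite lE => z; apply: continuous_comp; first exact: cvg_fst.
by apply: continuous_comp; [exact: coord_continuous|exact: mulrl_continuous].
Qed.

Lemma smooth_time_coord (F : R -> R) (k c : R) : smooth F ->
  smooth (fun z : xt => F (k * z.2 + c)).
Proof.
move=> sF; pose l (z : xt) : R := k * z.2.
apply: (@smooth_comp_line _ _ l) => //.
  by move=> q u v; rewrite /l /= /GRing.scale/=; ring.
move=> z; apply: (@continuous_comp _ _ _ snd (fun t : R => k * t)).
  exact: cvg_snd.
exact: mulrl_continuous.
Qed.

Lemma smooth_test_fun e lam et a b x : smooth (test_fun e lam et a b x).
Proof.
apply: smoothM; first by apply: smooth_prod => i; apply: smooth_space_coord; exact: smooth_ubump.
have st c : smooth (fun z : xt => ustep ((z.2 - c) / et)).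
  have -> : (fun z : xt => ustep ((z.2 - c) / et)) = fun z => ustep (et^-1 * z.2 + - (c / et)).
    by apply/funext => z; congr ustep; ring.
  by apply: smooth_time_coord; exact: smooth_ustep.
apply: smoothM; last by apply: smoothB.
have -> : (fun z : xt => expR (lam * z.2)) = fun z => expR (lam * z.2 + 0).
  by apply/funext => z; rewrite addr0.
apply: (@smooth_time_coord expR).
have -> : expR = (fun t : R => expR (1 * t)) by apply/funext => t; rewrite mul1r.
exact: smooth_expR_lin.
Qed.

Lemma test_funP (T e lam et a b : R) x : 0 < e -> 0 < et -> 0 < a -> a < b -> b + et < T ->
  test_function (cylinder T) (test_fun e lam et a b x).
Proof.
move=> e0 et0 a0 ab bT.
pose A : set xt := box x e `*` `[a, b + et]%classic.
have cA : compact A by apply: compact_setX; [exact: compact_box|exact: segment_compact].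
have clA : closed A by apply: compact_closed => //; exact: norm_hausdorff.
have tA z : test_fun e lam et a b x z != 0 -> A z.
  move=> h; split.
    apply: (@cbump_box _ _ e x z.1 e0); apply: contra h => /eqP h.
    by rewrite /test_fun h mul0r.
  have [S st] := @ustep_smooth_step R.
  rewrite /= in_itv/=; apply/negP => /negP; rewrite negb_and -!ltNge => ta.
  case/negP: h; rewrite /test_fun.
  suff -> : ustep ((z.2 - a) / et) = ustep ((z.2 - b) / et) by rewrite subrr !mulr0.
  case/orP: ta => ta.
    by rewrite !(step_0 st)// pmulr_lle0 ?invr_gt0//; lra.
  by rewrite !(step_1 st)// ler_pdivlMr//; lra.
split; first exact: smooth_test_fun.
  exact: compact_csupport clA cA tA.
apply: subset_trans (csupport_sub clA tA) _ => z [_ /=].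
by rewrite in_itv/= => zt; split => //=; rewrite in_itv/=; lra.
Qed.

End test_functions.


(** * Positive operators and jump walks *)

Section positive_operators.
Context {R : realType} {d : nat}.
Notation V := 'rV[R]_d.
Notation mu := (@lebesgue_rV R d).
Notation leb := (@lebesgue_measure R).
Notation VR := (V * measurableTypeR R)%type.
Implicit Types (f g : V -> \bar R) (F : VR -> \bar R) (x y : V).
Local Open Scope ereal_scope.

(** Operators that act on nonnegative functions like integration against a
    kernel. Measurability is required jointly with a real parameter so that
    [po_int], exchange with an integral in that parameter, survives
    composition. *)
Record positive_op (Phi : (V -> \bar R) -> V -> \bar R) : Prop := PositiveOp {
  po_ge0 : forall f, (forall x, 0 <= f x) -> forall x, 0 <= Phi f x ;
  po_meas : forall F, measurable_fun setT F -> (forall z, 0 <= F z) ->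
    measurable_fun setT (fun z : VR => Phi (fun x => F (x, z.2)) z.1) ;
  po_le : forall f g, measurable_fun setT f -> measurable_fun setT g ->
    (forall x, 0 <= f x) -> (forall x, f x <= g x) ->
    forall x, Phi f x <= Phi g x ;
  po_add : forall f g, measurable_fun setT f -> measurable_fun setT g ->
    (forall x, 0 <= f x) -> (forall x, 0 <= g x) ->
    forall x, Phi (fun y => f y + g y) x = Phi f x + Phi g x ;
  po_scale : forall (c : R) f, (0 <= c)%R -> measurable_fun setT f ->
    (forall x, 0 <= f x) -> forall x, Phi (fun y => c%:E * f y) x = c%:E * Phi f x ;
  po_int : forall F, measurable_fun setT F -> (forall z, 0 <= F z) ->
    forall x, Phi (fun y => \int[leb]_t F (y, t)) x =
              \int[leb]_t Phi (fun y => F (y, t)) x }.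

Lemma po_meas1 Phi f : positive_op Phi -> measurable_fun setT f -> (forall x, 0 <= f x) ->
  measurable_fun setT (Phi f).
Proof.
move=> pP mf f0.
have mF : measurable_fun setT (fun z : VR => f z.1) by apply: measurableT_comp.
have := po_meas pP mF (fun z => f0 z.1) => mG.
exact: (measurableT_comp mG (pair2_measurable (0%R : measurableTypeR R))).
Qed.

Lemma positive_op_comp Phi Psi : positive_op Phi -> positive_op Psi ->
  positive_op (fun f => Phi (Psi f)).
Proof.
move=> pP pS; have mS f := po_meas1 pS (f := f); split.
- by move=> f f0; apply: po_ge0 => //; exact: po_ge0.
- move=> F mF F0.
  exact: (po_meas pP (po_meas pS mF F0) (fun z => po_ge0 pS (fun x => F0 (x, z.2)) z.1)).
- move=> f g mf mg f0 fg x; have g0 y := le_trans (f0 y) (fg y).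
  by apply: (po_le pP); [exact: mS|exact: mS|exact: (po_ge0 pS)|exact: (po_le pS)].
- move=> f g mf mg f0 g0 x; rewrite -(po_add pP); [|exact: mS|exact: mS|exact: (po_ge0 pS)..].
  by congr (Phi _ x); apply/funext => y; rewrite (po_add pS).
- move=> c f c0 mf f0 x; rewrite -(po_scale pP)//; [|exact: mS|exact: (po_ge0 pS)].
  by congr (Phi _ x); apply/funext => y; rewrite (po_scale pS).
- move=> F mF F0 x.
  have -> : Psi (fun y => \int[leb]_t F (y, t)) = fun y => \int[leb]_t Psi (fun y => F (y, t)) y.
    by apply/funext => y; rewrite (po_int pS).
  exact: (po_int pP (po_meas pS mF F0) (fun z => po_ge0 pS (fun x => F0 (x, z.2)) z.1)).
Qed.

Lemma positive_op_id : positive_op id.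
Proof.
split => //.
by move=> F mF F0; rewrite (_ : (fun z => _) = F)//; apply/funext => -[].
Qed.

Lemma positive_op_iter Phi n : positive_op Phi -> positive_op (iter n Phi).
Proof.
move=> pP; elim: n => [|n ih]; first exact: positive_op_id.
exact: positive_op_comp pP ih.
Qed.

End positive_operators.

Section jump_operators.
Context {R : realType} {d : nat}.
Notation V := 'rV[R]_d.
Notation mu := (@lebesgue_rV R d).
Notation leb := (@lebesgue_measure R).
Notation VR := (V * measurableTypeR R)%type.
Implicit Types (f g : V -> \bar R) (F : VR -> \bar R) (x y : V).
Local Open Scope ereal_scope.

Record jump_kernel (k : V -> R) (lam : R) : Prop := JumpKernel {
  jk_meas : measurable_fun setT k ;
  jk_ge0 : forall y, (0 <= k y)%R ;
  jk_even : {ae mu, forall y, k y = k (- y)%R} ;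
  jk_mass : \int[mu]_y (k y)%:E = lam%:E }.

Definition jump (k : V -> R) f x : \bar R := \int[mu]_y ((k y)%:E * f (x + y)%R).

(** One step of a walk that jumps with probability [lam / N], according to
    [k / lam]. Iterating it [N] times approximates the compound Poisson
    semigroup at time 1 by a polynomial in [jump k]. *)
Definition jstep (k : V -> R) (lam N : R) f x : \bar R :=
  (1 - lam / N)%:E * f x + N^-1%:E * jump k f x.

Variables (k : V -> R) (lam N : R).
Hypothesis jk : jump_kernel k lam.
Hypothesis N0 : (0 < N)%R.
Hypothesis lamN : (lam <= N)%R.
Let mk := jk_meas jk.
Let k0 := jk_ge0 jk.
Let q0 : (0 <= 1 - lam / N)%R.
Proof. by rewrite subr_ge0 ler_pdivrMr// mul1r. Qed.
Let iN0 : (0 <= N^-1)%R. Proof. by rewrite invr_ge0 ltW. Qed.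

Lemma jk_lam_ge0 : (0 <= lam)%R.
Proof. by rewrite -lee_fin -(jk_mass jk); apply: int_ge0. Qed.

Lemma positive_op_jump : positive_op (jump k).
Proof.
have mshift f x : measurable_fun setT f -> measurable_fun setT (fun y : V => (k y)%:E * f (x + y)%R).
  move=> mf; apply: emeasurable_funM; first by meas.
  by apply: measurableT_comp => //; apply: measurable_rVD.
have sg f x : (forall x, 0 <= f x) -> forall y, 0 <= (k y)%:E * f (x + y)%R.
  by move=> f0 y; rewrite mule_ge0// lee_fin.
have mF2 F : measurable_fun setT F -> measurable_fun setT
    (fun p : VR * V => (k p.2)%:E * F ((p.1.1 + p.2)%R, p.1.2)).
  move=> mF; apply: emeasurable_funM.
    by apply/measurable_EFinP; apply: measurableT_comp.
  apply: measurableT_comp => //; apply: measurable_fun_pair => //=.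
    by apply: measurable_rVD => //; apply: measurableT_comp.
  by apply: measurableT_comp.
split.
- by move=> f f0 x; apply: integral_ge0 => y _; exact: sg.
- move=> F mF F0; apply: (measurable_int_snd mu (f := fun (z : VR) y => (k y)%:E * F ((z.1 + y)%R, z.2)) (mF2 _ mF)).
  by move=> z y; rewrite mule_ge0// lee_fin.
- move=> f g mf mg f0 fg x; have g0 y := le_trans (f0 y) (fg y).
  apply: ge0_le_integral => //; [by move=> y _; exact: sg|exact: mshift|exact: mshift|].
  by move=> y _; rewrite lee_wpmul2l// lee_fin.
- move=> f g mf mg f0 g0 x; rewrite -ge0_integralD//; last 4 first.
  + by move=> y _; exact: sg.
  + exact: mshift.
  + by move=> y _; exact: sg.
  + exact: mshift.
  by apply: eq_integral => y _; rewrite ge0_muleDr.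
- move=> c f c0 mf f0 x; rewrite -ge0_integralZl//; last 2 first.
  + exact: mshift.
  + by move=> y _; exact: sg.
  by apply: eq_integral => y _; rewrite muleCA.
- move=> F mF F0 x.
  have mFx y : measurable_fun setT (fun t : measurableTypeR R => F (y, t)).
    exact: (measurableT_comp mF (pair1_measurable y)).
  have -> : jump k (fun y => \int[leb]_t F (y, t)) x =
      \int[mu]_y \int[leb]_t ((k y)%:E * F ((x + y)%R, t)).
    by apply: eq_integral => y _; rewrite ge0_integralZl// lee_fin.
  apply: (tonelli_swap mu leb (f := fun y t => (k y)%:E * F ((x + y)%R, t))).
    apply: emeasurable_funM; first by apply/measurable_EFinP; apply: measurableT_comp.
    apply: measurableT_comp => //; apply: measurable_fun_pair => //=.
    by apply: measurable_rVD.
  by move=> y t; rewrite mule_ge0// lee_fin.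
Qed.

Lemma positive_op_jstep : positive_op (jstep k lam N).
Proof.
have pJ := positive_op_jump.
have mJ f := po_meas1 pJ (f := f).
have pge (c : R) : (0 <= c)%R -> 0 <= c%:E by rewrite lee_fin.
split.
- move=> f f0 x; rewrite adde_ge0// mule_ge0// ?pge//; exact: (po_ge0 pJ).
- move=> F mF F0; have mJF := po_meas pJ mF F0.
  apply: emeasurable_funD; apply: emeasurable_funM => //.
  rewrite [X in measurable_fun _ X](_ : _ = F)//; by apply/funext => -[].
- move=> f g mf mg f0 fg x.
  by rewrite leeD// lee_wpmul2l// ?pge//; exact: (po_le pJ).
- move=> f g mf mg f0 g0 x; rewrite /jstep (po_add pJ)//.
  have Jf := po_ge0 pJ f0 x; have Jg := po_ge0 pJ g0 x.
  rewrite (ge0_muleDr _ (f0 x) (g0 x)) (ge0_muleDr _ Jf Jg).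
  by rewrite addeACA.
- move=> c f c0 mf f0 x; rewrite /jstep (po_scale pJ)//.
  have Jf := po_ge0 pJ f0 x.
  have h1 : 0 <= (1 - lam / N)%:E * f x by rewrite mule_ge0// pge.
  have h2 : 0 <= N^-1%:E * jump k f x by rewrite mule_ge0// pge.
  rewrite (ge0_muleDr _ h1 h2).
  by rewrite muleCA [X in _ + X]muleCA.
- move=> F mF F0 x; rewrite /jstep (po_int pJ)//.
  have mFx y : measurable_fun setT (fun t : measurableTypeR R => F (y, t)).
    exact: (measurableT_comp mF (pair1_measurable y)).
  have mJx : measurable_fun setT (fun t : measurableTypeR R => jump k (fun y => F (y, t)) x).
    exact: (measurableT_comp (po_meas pJ mF F0) (pair1_measurable x)).
  have J0 t : 0 <= jump k (fun y => F (y, t)) x by exact: (po_ge0 pJ).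
  rewrite -!ge0_integralZl//= ?lee_fin//.
  rewrite -ge0_integralD//.
  + by move=> t _; rewrite mule_ge0// lee_fin.
  + by apply: emeasurable_funM.
  + by move=> t _; rewrite mule_ge0// lee_fin.
  + by apply: emeasurable_funM.
Qed.

End jump_operators.

Section jump_on_functions.
Context {R : realType} {d : nat}.
Notation V := 'rV[R]_d.
Notation mu := (@lebesgue_rV R d).
Implicit Types (x y xi : V).
Variables (k : V -> R) (lam : R).
Hypothesis jk : jump_kernel k lam.
Let mk := jk_meas jk.
Let k0 := jk_ge0 jk.

Lemma measurable_dotv d' (T : measurableType d') (f g : T -> V) :
  measurable_fun setT f -> measurable_fun setT g ->
  measurable_fun setT (fun z => dotv (f z) (g z)).
Proof.
move=> mf mg; apply: measurable_sum => i; apply: measurable_funM.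
- exact: (measurableT_comp (measurable_rV_coord i) mf).
- exact: (measurableT_comp (measurable_rV_coord i) mg).
Qed.

Lemma measurable_cos : measurable_fun setT (@cos R).
Proof. by apply: continuous_measurable_fun; exact: continuous_cos. Qed.

Lemma dotvDr xi x y : dotv xi (x + y) = dotv xi x + dotv xi y.
Proof. by rewrite /dotv -big_split; apply: eq_bigr => i _; rewrite mxE mulrDr. Qed.

Lemma dotvNr xi y : dotv xi (- y) = - dotv xi y.
Proof. by rewrite /dotv -sumrN; apply: eq_bigr => i _; rewrite mxE mulrN. Qed.

(** The phase [c] does the work of complex exponentials, with real functions
    for which [1 + wave xi c] is nonnegative. *)
Definition wave xi (c : R) x : R := cos (dotv xi x + c).

Lemma measurable_wave xi c : measurable_fun setT (wave xi c).
Proof.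
apply: (measurableT_comp measurable_cos).
by apply: measurable_funD => //; exact: measurable_dotv.
Qed.

Lemma wave_le1 xi c x : `|wave xi c x| <= 1.
Proof. by rewrite ler_norml cos_geN1 cos_le1. Qed.

Lemma wave_even xi c x y :
  wave xi c (x + y) + wave xi c (x - y) = 2 * wave xi c x * cos (dotv xi y).
Proof.
rewrite /wave !dotvDr dotvNr.
rewrite (_ : _ + c = (dotv xi x + c) + dotv xi y); last by ring.
rewrite [_ - _ + c](_ : _ = (dotv xi x + c) - dotv xi y); last by ring.
by rewrite cosB cosD; ring.
Qed.

(** The integral is compared with itself after [y] is replaced by [-y]; its
    double is computed, since nothing infinite can be subtracted. *)
Lemma jump_half (g h : V -> R) x : measurable_fun setT g -> (forall y, 0 <= g y) ->
  measurable_fun setT h -> (forall y, 0 <= h y) ->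
  (forall y, g (x + y) + g (x - y) = 2 * h y) ->
  jump k (EFin \o g) x = (\int[mu]_y (k y * h y)%:E)%E.
Proof.
move=> mg g0 mh h0 gh.
have JE : jump k (EFin \o g) x = (\int[mu]_y (k y * g (x + y))%:E)%E by [].
have J2 : (jump k (EFin \o g) x + jump k (EFin \o g) x =
    2%:E * \int[mu]_y (k y * h y)%:E)%E.
  rewrite JE {2}(integral_even_shift mk (jk_even jk) x mg) -ge0_intD; last 4 first.
  - by meas.
  - by meas.
  - by move=> y; rewrite mulr_ge0.
  - by move=> y; rewrite mulr_ge0.
  rewrite -ge0_intZ//; [|by meas|by move=> y; rewrite mulr_ge0].
  by apply: eq_integral => y _; rewrite -mulrDr gh mulrCA.
have I0 : (0 <= \int[mu]_y (k y * h y)%:E)%E by apply: int_ge0 => y; rewrite mulr_ge0.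
have J0 : (0 <= jump k (EFin \o g) x)%E.
  by rewrite JE; apply: int_ge0 => y; rewrite mulr_ge0.
move: J2 I0 J0; move: (jump _ _ _) (\int[mu]_y _)%E => [a| |] [b| |]//=.
  by rewrite -EFinD -EFinM => -[h2] _ _; congr EFin; lra.
  by rewrite mulry gtr0_sg// mul1e.
Qed.

Lemma symbol_integrable xi : mu.-integrable setT
  (EFin \o (fun y => (1 - cos (dotv xi y)) * k y)).
Proof.
have md : measurable_fun setT (fun y : V => dotv xi y) by exact: measurable_dotv.
have mc : measurable_fun setT (fun y : V => cos (dotv xi y)) by apply: (measurableT_comp measurable_cos).
apply: integrable_absP; first by meas.
apply: (@le_lt_trans _ _ (\int[mu]_y (2 * k y)%:E)%E).
  apply: ge0_intle => //; [by meas|by meas|] => y.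
  rewrite normrM (ger0_norm (k0 y)) ler_wpM2r// ger0_norm ?subr_ge0 ?cos_le1//.
  by rewrite lerBlDr -lerBlDl; have := cos_geN1 (dotv xi y); lra.
by rewrite ge0_intZ// (jk_mass jk) -EFinM ltry.
Qed.

Lemma symbol_ge0 xi : 0 <= levy_symbol k xi.
Proof. by apply/fine_ge0/int_ge0 => y; rewrite mulr_ge0// subr_ge0 cos_le1. Qed.

Lemma symbol_le xi : levy_symbol k xi <= 2 * lam.
Proof.
have md : measurable_fun setT (fun y : V => dotv xi y) by exact: measurable_dotv.
have mc : measurable_fun setT (fun y : V => cos (dotv xi y)) by apply: (measurableT_comp measurable_cos).
rewrite -lee_fin /levy_symbol Rint_fin; last exact: symbol_integrable.
rewrite EFinM -(jk_mass jk) -ge0_intZ//.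
apply: ge0_intle; [by meas|by meas|by move=> y; rewrite mulr_ge0// subr_ge0 cos_le1|] => y.
by rewrite ler_wpM2r//; have := cos_geN1 (dotv xi y); lra.
Qed.

(** Waves are eigenfunctions of every even kernel; the constant 1 keeps the
    functions nonnegative. *)
Lemma jump_wave (al : R) xi c x : `|al| <= 1 ->
  jump k (fun x => (1 + al * wave xi c x)%:E) x =
  (lam * (1 + al * wave xi c x) - al * wave xi c x * levy_symbol k xi)%:E.
Proof.
move=> al1; have md : measurable_fun setT (fun y : V => dotv xi y) by exact: measurable_dotv.
have mc : measurable_fun setT (fun y : V => cos (dotv xi y)) by apply: (measurableT_comp measurable_cos).
have mw := measurable_wave xi c.
have b1 (u v : R) : `|u| <= 1 -> `|v| <= 1 -> 0 <= 1 + u * v.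
  move=> u1 v1; have : `|u * v| <= 1 by rewrite normrM mulr_ile1.
  by rewrite ler_norml; lra.
have s1 : `|al * wave xi c x| <= 1 by rewrite normrM mulr_ile1// wave_le1.
rewrite (@jump_half (fun x => 1 + al * wave xi c x)
  (fun y => 1 + (al * wave xi c x) * cos (dotv xi y))).
- set s := al * wave xi c x.
  have ik : mu.-integrable setT (EFin \o k).
    apply: integrable_absP => //; under eq_integral do rewrite ger0_norm//.
    by rewrite (jk_mass jk) ltry.
  have is1 := symbol_integrable xi.
  have iZ (c' : R) (h : V -> R) : mu.-integrable setT (EFin \o h) ->
      mu.-integrable setT (EFin \o (fun y => c' * h y)).
    move=> ih; rewrite (_ : _ \o _ = fun y => (c'%:E * (EFin \o h) y)%E)//.
    exact: integrableZl.
  have ik1 := iZ (1 + s) _ ik.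
  have is2 : mu.-integrable setT (EFin \o (fun y => s * ((1 - cos (dotv xi y)) * k y))).
    exact: iZ.
  have -> : (\int[mu]_y (k y * (1 + s * cos (dotv xi y)))%:E =
      \int[mu]_y ((1 + s) * k y - s * ((1 - cos (dotv xi y)) * k y))%:E)%E.
    by apply: eq_integral => y _; congr EFin; ring.
  rewrite -Rint_fin; last by have := integrableB measurableT ik1 is2.
  rewrite RintegralB// RintegralZl// RintegralZl// -/(levy_symbol k xi).
  by rewrite /Rintegral (jk_mass jk) /= mulrC.
- by meas.
- by move=> y; rewrite b1// wave_le1.
- by meas.
- by move=> y; rewrite b1// ler_norml cos_geN1 cos_le1.
- move=> y; have := wave_even xi c x y; set A := wave _ _ _; set B := wave _ _ (x - y).
  move=> AB; rewrite (_ : _ + _ = 2 + al * (A + B)); last by ring.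
  by rewrite AB; ring.
Qed.

Lemma jump_sq (M s : R) x : (\int[mu]_y (k y * dotv y y)%:E = M%:E)%E -> 0 <= s ->
  jump k (fun x => (dotv x x + s)%:E) x = (lam * (dotv x x + s) + M)%:E.
Proof.
move=> kM s0; have md : measurable_fun setT (fun y : V => dotv y y) by exact: measurable_dotv.
have q0 y : 0 <= dotv y y by apply: sumr_ge0 => i _; rewrite -expr2 sqr_ge0.
rewrite (@jump_half (fun x => dotv x x + s) (fun y => (dotv x x + s) + dotv y y)).
- have -> : (\int[mu]_y (k y * (dotv x x + s + dotv y y))%:E =
      \int[mu]_y ((dotv x x + s) * k y + k y * dotv y y)%:E)%E.
    by apply: eq_integral => y _; congr EFin; ring.
  have x0 : 0 <= dotv x x + s by rewrite addr_ge0.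
  rewrite ge0_intD; [|by meas|by meas|by move=> y; rewrite mulr_ge0..].
  by rewrite ge0_intZ// (jk_mass jk) kM -EFinM -EFinD mulrC.
- by meas.
- by move=> y; rewrite addr_ge0.
- by meas.
- by move=> y; rewrite !addr_ge0.
- move=> y.
  have dl u v w : dotv (u + v) w = dotv u w + dotv v w.
    by rewrite /dotv -big_split; apply: eq_bigr => i _; rewrite mxE mulrDl.
  have dn u w : dotv (- u) w = - dotv u w.
    by rewrite /dotv -sumrN; apply: eq_bigr => i _; rewrite mxE mulNr.
  by rewrite !dl !dotvDr !dn !dotvNr; ring.
Qed.

Variable N : R.
Hypothesis N0 : (0 < N)%R.
Hypothesis lamN : (lam <= N)%R.
Let pS := positive_op_jstep jk N0 lamN.
Let pJ := positive_op_jump jk.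
Let r := 1 - lam / N.
Let r0 : (0 <= r)%R.
Proof. by rewrite subr_ge0 ler_pdivrMr// mul1r. Qed.

Lemma jrun_wave n (al : R) xi c x : `|al| <= 1 ->
  iter n (jstep k lam N) (fun x => (1 + al * wave xi c x)%:E) x =
  (1 + al * (1 - levy_symbol k xi / N) ^+ n * wave xi c x)%:E.
Proof.
move=> al1; set m := levy_symbol k xi; set p := 1 - m / N.
have p1 : `|p| <= 1.
  have m0 : 0 <= m / N by rewrite divr_ge0 ?symbol_ge0 ?ltW.
  have m2 : m / N <= 2.
    by rewrite ler_pdivrMr// (le_trans (symbol_le xi))// ler_wpM2l.
  by rewrite ler_norml /p; lra.
elim: n x => [|n ih] x; first by rewrite expr0 mulr1.
have -> : iter n.+1 (jstep k lam N) (fun x => (1 + al * wave xi c x)%:E) =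
    jstep k lam N (fun x => (1 + al * p ^+ n * wave xi c x)%:E).
  by rewrite /=; congr (jstep _ _ _ _); apply/funext => y; rewrite ih.
rewrite /jstep jump_wave; last first.
  by rewrite normrM mulr_ile1// normrX exprn_ile1.
rewrite -!EFinM -EFinD; congr EFin; rewrite -/m /p exprS.
by set w := wave xi c x; set q := _ ^+ n; field; rewrite gt_eqF.
Qed.

Lemma jrun_cst1 n x : iter n (jstep k lam N) (fun=> 1%:E) x = 1%:E.
Proof.
have := @jrun_wave n 0 0 0 x; rewrite normr0 !mul0r addr0 => /(_ ler01).
rewrite (_ : (fun x => _) = fun=> 1%:E)//.
by apply/funext => y; rewrite mul0r addr0.
Qed.

Lemma jrun_sq (M : R) n x : (\int[mu]_y (k y * dotv y y)%:E = M%:E)%E ->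
  iter n (jstep k lam N) (fun x => (dotv x x)%:E) x = (dotv x x + n%:R * M / N)%:E.
Proof.
move=> kM.
have M0 : 0 <= M.
  rewrite -lee_fin -kM; apply: int_ge0 => y; rewrite mulr_ge0//.
  by apply: sumr_ge0 => i _; rewrite -expr2 sqr_ge0.
elim: n x => [|n ih] x; first by rewrite mul0r mul0r addr0.
have -> : iter n.+1 (jstep k lam N) (fun x => (dotv x x)%:E) =
    jstep k lam N (fun x => (dotv x x + n%:R * M / N)%:E).
  by rewrite /=; congr (jstep _ _ _ _); apply/funext => y; rewrite ih.
rewrite /jstep (jump_sq _ kM) ?divr_ge0 ?mulr_ge0 ?(ltW N0)//.
rewrite -!EFinM -EFinD; congr EFin; rewrite -natr1.
by field; rewrite gt_eqF.
Qed.

(** Only the paths with exactly one jump are counted: the jump takes place at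
    one of [n + 1] steps, and the walk rests during the [n] others. *)
Lemma jrun_ge_jump n (f : V -> \bar R) x : measurable_fun setT f -> (forall x, 0 <= f x)%E ->
  ((n.+1%:R / N * r ^+ n)%:E * jump k f x <= iter n.+1 (jstep k lam N) f x)%E.
Proof.
move=> mf f0.
have fr m y : ((r ^+ m)%:E * f y <= iter m (jstep k lam N) f y)%E.
  elim: m => [|m ih] /=; first by rewrite expr0 mul1e.
  have pIm := positive_op_iter m pS.
  have I0 := po_ge0 pIm f0.
  rewrite {1}/jstep exprS EFinM -muleA.
  apply: (@le_trans _ _ (r%:E * iter m (jstep k lam N) f y)%E).
    by rewrite lee_wpmul2l// lee_fin.
  rewrite -/r leeDl// mule_ge0 ?lee_fin ?invr_ge0 ?(ltW N0)//.
  exact: (po_ge0 pJ).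
have J0 := po_ge0 pJ f0.
have Jm m y : ((r ^+ m)%:E * jump k f y <= jump k (iter m (jstep k lam N) f) y)%E.
  have pIm := positive_op_iter m pS.
  have rm0 : 0 <= r ^+ m by rewrite exprn_ge0.
  rewrite -(po_scale pJ)//; apply: (po_le pJ) => //.
  - by apply: emeasurable_funM.
  - exact: (po_meas1 pIm).
  - by move=> z; rewrite mule_ge0// lee_fin.
have iN0 : 0 <= N^-1 by rewrite invr_ge0 ltW.
elim: n => [|n ih].
  rewrite expr0 mulr1 mul1r /= /jstep -/r leeDr// mule_ge0// lee_fin//.
rewrite iterS {1}/jstep -/r.
have -> : (n.+2%:R / N * r ^+ n.+1 = r * (n.+1%:R / N * r ^+ n) + N^-1 * r ^+ n.+1).
  by rewrite -[n.+2%:R]natr1 exprS; ring.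
have c1 : 0 <= r * (n.+1%:R / N * r ^+ n) by rewrite !mulr_ge0// exprn_ge0.
have c2 : 0 <= N^-1 * r ^+ n.+1 by rewrite mulr_ge0// exprn_ge0.
rewrite EFinD ge0_muleDl ?lee_fin//.
apply: leeD; rewrite EFinM -muleA lee_wpmul2l ?lee_fin//.
Qed.

End jump_on_functions.


(** * Big and small jumps *)

Section compound_limit.
Context {R : realType}.

Lemma sin_le_abs (t : R) : `|sin t| <= `|t|.
Proof.
have pos (u : R) : 0 < u -> `|sin u| <= `|u|.
  move=> u0.
  have [|c _] := @MVT R sin cos 0 u u0.
    by apply: continuous_subspaceT; exact: continuous_sin.
  rewrite sin0 !subr0 => ->; rewrite normrM ler_piMl//; exact: cos_max.
have [u0|u0|->] := ltgtP t 0; last by rewrite sin0 normr0.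
- by rewrite -normrN -sinN -[leRHS]normrN pos// oppr_gt0.
- exact: pos.
Qed.

Lemma one_sub_cos_le (t : R) : 1 - cos t <= t ^+ 2.
Proof.
have [|c ci] := @MVT_segment R cos (fun x => - sin x) 0 `|t| (normr_ge0 _).
  by apply: continuous_subspaceT; exact: continuous_cos.
have -> : cos `|t| = cos t by case: ler0P => _ //; rewrite cosN.
rewrite cos0 subr0 => ct.
have -> : 1 - cos t = sin c * `|t| by rewrite -[LHS]opprB ct mulNr opprK.
rewrite -real_normK ?num_real// expr2 ler_wpM2r//.
rewrite (le_trans (ler_norm _))// (le_trans (sin_le_abs c))//.
by move: ci; rewrite in_itv/= => /andP[c0 ct']; rewrite ger0_norm.
Qed.

(** [1 - x] lies between [e^(- x / (1 - x))] and [e^(-x)]. *)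
Lemma pow_cvg_expR (m : nat -> R) (l : R) (N : nat -> nat) :
  (forall n, 0 <= m n) -> m n @[n --> \oo] --> l -> (forall n, (n < N n)%N) ->
  (1 - m n / (N n)%:R) ^+ N n @[n --> \oo] --> expR (- l).
Proof.
move=> m0 ml nN.
have Ninf : (N n)%:R^-1 @[n --> \oo] --> (0 : R).
  apply: (@squeeze_cvgr _ _ _ _ (fun=> 0) harmonic); last exact: cvg_harmonic.
    near=> n; rewrite invr_ge0 ler0n /= lef_pV2 ?posrE ?ltr0n ?ler_nat//.
    exact: leq_ltn_trans (nN n).
  exact: cvg_cst.
have x0 : m n / (N n)%:R @[n --> \oo] --> (0 : R).
  by rewrite -(mulr0 l); apply: cvgM.
have N0 n : 0 < (N n)%:R :> R by rewrite ltr0n; exact: leq_ltn_trans (nN n).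
apply: (@squeeze_cvgr _ _ _ _
  (fun n => expR (- (m n / (1 - m n / (N n)%:R)))) (fun n => expR (- m n))).
- near=> n; have x1 : m n / (N n)%:R < 1.
    by near: n; apply: (cvgr_lt _ x0); exact: ltr01.
  move: x1; set x := m n / (N n)%:R => x1.
  have xp : 0 <= x by rewrite divr_ge0// ltW.
  have y0 : 0 < 1 - x by rewrite subr_gt0.
  have mE : m n = (N n)%:R * x by rewrite /x mulrC divfK// gt_eqF.
  clearbody x.
  have e1 : 1 - x <= expR (- x) by exact: expR_ge1Dx.
  have e2 : expR (- (x / (1 - x))) <= 1 - x.
    rewrite expRN -[leRHS]invrK lef_pV2 ?posrE ?invr_gt0 ?expR_gt0//.
    apply: le_trans (expR_ge1Dx _).
    by rewrite le_eqVlt; apply/orP; left; apply/eqP; field; rewrite gt_eqF.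
  have ee (y : R) : expR ((N n)%:R * y) = expR y ^+ N n by rewrite mulrC expRM_natr.
  have -> : - (m n / (1 - x)) = (N n)%:R * - (x / (1 - x)) by rewrite mE; ring.
  have -> : - m n = (N n)%:R * - x by rewrite mE; ring.
  rewrite !ee.
  by rewrite !lerXn2r// nnegrE ?expR_ge0// ltW.
- apply: (@cvg_comp _ _ _ (fun n => - (m n / (1 - m n / (N n)%:R))) expR); last first.
    exact: continuous_expR.
  apply: cvgN; rewrite -[X in _ --> X]mulr1 -[X in _ * X]invr1.
  apply: cvgM => //; apply: cvgV; first exact: oner_neq0.
  by rewrite -[X in _ --> X]subr0; apply: cvgB => //; exact: cvg_cst.
- apply: (@cvg_comp _ _ _ (fun n => - m n) expR); last exact: continuous_expR.
  exact: cvgN.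
Unshelve. all: by end_near. Qed.

End compound_limit.

Section kernel_splitting.
Context {R : realType} {d : nat}.
Notation V := 'rV[R]_d.
Notation mu := (@lebesgue_rV R d).
Variables (a : R -> R) (D C : R) (K : V -> R).
Hypothesis kp : kernel_profile a D C K.
Notation om := (decay_weight a).
Notation far := (far_kernel K).
Notation near0 := (near_kernel K).
Let om0 x : 0 <= om x := ltW (om_gt0 kp x).
Let mom : measurable_fun setT om := measurable_om kp.
Let mfar e : measurable_fun setT (far e) := measurable_far kp e.
Let mnear e : measurable_fun setT (near0 e) := measurable_near0 kp e.
Let near_ge0 e y : 0 <= near0 e y := near0_ge0 kp e y.
Let mK := kp_meas kp.
Let C0 := kp_C0 kp.
Let iC0 : 0 <= C^-1. Proof. by rewrite invr_ge0 ltW. Qed.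

Lemma om_le_K y : y != 0 -> C^-1 * om y <= K y.
Proof.
move=> y0; have /andP[h _] := kp_bound kp y0; apply: le_trans h.
by rewrite ler_wpM2l// (kp_ninc kp) ?normr_gt0// lerDr.
Qed.

(** Away from the origin [K] is [bigk + smallk e + restk e]. The part
    [C^-1 om] of the kernel is kept in [bigk] also on the unit ball, so that
    the big jumps have a density bounded below by [C^-1 om] everywhere; [restk]
    is negligible as [e] tends to 0. *)
Definition bigk y : R := if `|y| <= 1 then C^-1 * om y else K y.
Definition bigm : R := fine (\int[mu]_y (bigk y)%:E)%E.

Definition smallk (e : R) y : R :=
  if e < `|y| <= 1 then K y - C^-1 * om y else 0.
Definition smallm (e : R) : R := fine (\int[mu]_y (smallk e y)%:E)%E.

Definition restk (e : R) y : R :=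
  if 0 < `|y| <= e then K y - C^-1 * om y else 0.

Let mnorm : measurable_fun setT (fun y : V => `|y|) := @measurable_norm_rV R d.

Lemma om_even (y : V) : om (- y) = om y.
Proof. by rewrite /decay_weight normrN. Qed.

Lemma measurable_bigk : measurable_fun setT bigk.
Proof.
apply: measurable_fun_ifT; first by apply: measurable_fun_ler.
- by meas.
- by [].
Qed.

Lemma measurable_annulus (e r : R) :
  measurable_fun setT (fun y : V => if e < `|y| <= r then K y - C^-1 * om y else 0).
Proof.
apply: measurable_fun_ifT.
- by apply: measurable_and; [apply: measurable_fun_ltr|apply: measurable_fun_ler].
- by meas.
- by [].
Qed.

Let msmall e : measurable_fun setT (smallk e) := measurable_annulus e 1.
Let mrest e : measurable_fun setT (restk e) := measurable_annulus 0 e.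
Let mbig := measurable_bigk.

Let bigk0 y : 0 <= bigk y.
Proof.
rewrite /bigk; case: ifPn => y1; first by rewrite mulr_ge0.
by apply: (K_ge0 kp); apply: contraNneq y1 => ->; rewrite normr0.
Qed.

Lemma bigk_ge y : C^-1 * om y <= bigk y.
Proof.
rewrite /bigk; case: ifPn => // y1; apply: om_le_K.
by apply: contraNneq y1 => ->; rewrite normr0.
Qed.

Lemma bigk_jump : jump_kernel bigk bigm.
Proof.
split => //.
- by apply: filterS (kp_even kp) => y Ky; rewrite /bigk -Ky om_even normrN.
- rewrite fineK// ge0_fin_numE; last exact: int_ge0.
  apply: (@le_lt_trans _ _ (\int[mu]_y (far 1 y + C^-1 * om y)%:E)%E).
    apply: ge0_intle => //; [by meas|] => y; rewrite /bigk /far_kernel ltNge.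
    by case: ifPn => _ /=; rewrite ?add0r// lerDl mulr_ge0.
  rewrite ge0_intD; [|by meas|by meas|by move=> y; rewrite (far_ge0 kp)|by move=> y; rewrite mulr_ge0].
  rewrite lte_add_pinfty//; first exact: integral_far_fin kp _ _.
  by rewrite ge0_intZ// lte_mul_pinfty ?lee_fin// (integral_om_fin kp).
Qed.

Lemma smallk_le e y : 0 < e -> 0 <= smallk e y <= far e y /\ smallk e y <= near0 1 y.
Proof.
move=> e0; rewrite /smallk /far_kernel /near_kernel; case: ifPn => [/andP[ye y1]|_].
  have y0 : y != 0 by rewrite -normr_gt0 (lt_trans e0).
  rewrite ye y1 (lt_trans e0 ye) /= subr_ge0 om_le_K//=.
  by rewrite !gerBl mulr_ge0.
split; first by rewrite lexx; exact: (far_ge0 kp _ (ltW e0)).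
exact: near_ge0.
Qed.

Lemma smallk_jump e : 0 < e -> jump_kernel (smallk e) (smallm e).
Proof.
move=> e0; have s0 y := smallk_le y e0.
split => //.
- by move=> y; have [/andP[]] := s0 y.
- by apply: filterS (kp_even kp) => y Ky; rewrite /smallk -Ky om_even normrN.
- rewrite fineK// ge0_fin_numE; last by apply: int_ge0 => y; have [/andP[]] := s0 y.
  apply: le_lt_trans (integral_far_fin kp e0).
  by apply: ge0_intle => // [y|y]; have [/andP[]] := s0 y.
Qed.

Let md (xi : V) : measurable_fun setT (fun y : V => dotv xi y).
Proof. exact: measurable_dotv. Qed.
Let mdd : measurable_fun setT (fun y : V => dotv y y).
Proof. exact: measurable_dotv. Qed.
Let mc (xi : V) : measurable_fun setT (fun y : V => cos (dotv xi y)).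
Proof. exact: (measurableT_comp (@measurable_cos R)). Qed.

Definition smallM (e : R) : R := fine (\int[mu]_y (smallk e y * dotv y y)%:E)%E.

Lemma dotv_le_norm (y : V) : dotv y y <= d%:R * `|y| ^+ 2.
Proof.
rewrite (@le_trans _ _ (\sum_(i < d) `|y| ^+ 2))//.
  apply: ler_sum => i _; rewrite -expr2 -real_normK ?num_real//.
  by rewrite lerXn2r ?nnegrE// rV_coord_le_norm.
by rewrite sumr_const card_ord -[leLHS]mulr_natl.
Qed.

Lemma smallME e : 0 < e ->
  (\int[mu]_y (smallk e y * dotv y y)%:E = (smallM e)%:E)%E /\
  smallM e <= d%:R * near_moment K 1.
Proof.
move=> e0; have s0 y := smallk_le y e0.
have h : (\int[mu]_y (smallk e y * dotv y y)%:E <= (d%:R * near_moment K 1)%:E)%E.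
  rewrite EFinM -(near_momentE kp)// -ge0_intZ//; [|by meas|by move=> y; rewrite mulr_ge0// sqr_ge0].
  apply: ge0_intle => //; [by meas|by meas| |].
    by move=> y; rewrite mulr_ge0 ?dotv_ge0//; have [/andP[]] := s0 y.
  move=> y; rewrite mulrCA; have [/andP[h1 h2] h3] := s0 y.
  by rewrite ler_pM ?dotv_ge0 ?dotv_le_norm.
have E : (\int[mu]_y (smallk e y * dotv y y)%:E = (smallM e)%:E)%E.
  rewrite fineK// ge0_fin_numE; last first.
    by apply: int_ge0 => y; rewrite mulr_ge0 ?dotv_ge0//; have [/andP[]] := s0 y.
  by rewrite (le_lt_trans h)// ltry.
by split => //; rewrite -lee_fin -E.
Qed.

Definition dot_norm (xi : V) : R := \sum_(i < d) `|xi ord0 i|.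

Lemma dotv_le (xi y : V) : (dotv xi y) ^+ 2 <= dot_norm xi ^+ 2 * `|y| ^+ 2.
Proof.
rewrite -exprMn -real_normK ?num_real// lerXn2r ?nnegrE//.
  by rewrite mulr_ge0// sumr_ge0.
rewrite (le_trans (ler_norm_sum _ _ _))// mulr_suml ler_sum// => i _.
by rewrite normrM ler_wpM2l// rV_coord_le_norm.
Qed.

(** [1 - cos t <= t^2], and the remainder of the kernel lives on the ball of
    radius [e]. *)
Lemma symbol_split (xi : V) e : 0 < e -> e <= 1 ->
  `|levy_symbol K xi - (levy_symbol (smallk e) xi + levy_symbol bigk xi)| <=
  dot_norm xi ^+ 2 * near_moment K e.
Proof.
move=> e0 e1; have s0 y := smallk_le y e0.
have c1 y : 0 <= 1 - cos (dotv xi y) by rewrite subr_ge0 cos_le1.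
have rest0 y : 0 <= restk e y <= near0 e y.
  rewrite /restk /near_kernel; case: ifPn => [/andP[y0 ye]|_]; last by rewrite !lexx.
  by rewrite subr_ge0 om_le_K -?normr_gt0//= gerBl mulr_ge0.
have r0 y : 0 <= restk e y by have /andP[] := rest0 y.
have ss0 y : 0 <= smallk e y by have [/andP[]] := s0 y.
have rE y : (1 - cos (dotv xi y)) * K y = (1 - cos (dotv xi y)) * smallk e y +
    (1 - cos (dotv xi y)) * bigk y + (1 - cos (dotv xi y)) * restk e y.
  have [->|y0] := eqVneq y 0.
    have -> : dotv xi 0 = 0 by rewrite /dotv big1// => i _; rewrite mxE mulr0.
    by rewrite cos0 subrr !mul0r !addr0.
  rewrite -!mulrDr; congr (_ * _).
  rewrite /smallk /bigk /restk normr_gt0 y0 /=.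
  have [ye|ye] := leP `|y| e; first by rewrite (le_trans ye e1) /=; ring.
  by have [y1|y1] := leP `|y| 1; rewrite /=; ring.
have cs0 y : 0 <= (1 - cos (dotv xi y)) * smallk e y by rewrite mulr_ge0.
have cb0 y : 0 <= (1 - cos (dotv xi y)) * bigk y by rewrite mulr_ge0.
have cr0 y : 0 <= (1 - cos (dotv xi y)) * restk e y by rewrite mulr_ge0.
have mc1 := mc xi.
have rle : (\int[mu]_y ((1 - cos (dotv xi y)) * restk e y)%:E <=
    (dot_norm xi ^+ 2 * near_moment K e)%:E)%E.
  rewrite EFinM -(near_momentE kp)// -ge0_intZ//; last 3 first.
  - by rewrite sqr_ge0.
  - by meas.
  - by move=> y; rewrite mulr_ge0// sqr_ge0.
  apply: ge0_intle => //; [by meas|by meas|] => y.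
  rewrite mulrCA mulrC; have /andP[h1 h2] := rest0 y.
  rewrite ler_pM// (le_trans (one_sub_cos_le _))//; exact: dotv_le.
have KE : (\int[mu]_y ((1 - cos (dotv xi y)) * K y)%:E =
  (levy_symbol (smallk e) xi + levy_symbol bigk xi)%:E +
  \int[mu]_y ((1 - cos (dotv xi y)) * restk e y)%:E)%E.
  under eq_integral do rewrite rE.
  rewrite ge0_intD; [|by meas|by meas|by move=> y; rewrite addr_ge0|by []].
  rewrite ge0_intD; [|by meas|by meas|by []|by []].
  rewrite EFinD /levy_symbol !Rint_fin//.
    exact: symbol_integrable bigk_jump _.
  exact: symbol_integrable (smallk_jump e0) _.
rewrite {1}/levy_symbol /Rintegral KE.
have i0 := int_ge0 mu cr0.
move: rle i0; case: (\int[mu]_y _)%E => [q| |]//=; rewrite !lee_fin => hq q0.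
by rewrite addrAC subrr add0r ger0_norm.
Qed.

End kernel_splitting.


(** * Compound Poisson walks *)

Lemma one_sub_ge_expR (R : realType) (x : R) : x < 1 ->
  expR (- (x / (1 - x))) <= 1 - x.
Proof.
move=> x1; have y0 : 0 < 1 - x by rewrite subr_gt0.
rewrite expRN -[leRHS]invrK lef_pV2 ?posrE ?invr_gt0 ?expR_gt0//.
apply: le_trans (expR_ge1Dx _).
by rewrite le_eqVlt; apply/orP; left; apply/eqP; field; rewrite gt_eqF.
Qed.

Section compound_poisson.
Context {R : realType} {d : nat}.
Notation V := 'rV[R]_d.
Notation mu := (@lebesgue_rV R d).
Notation leb := (@lebesgue_measure R).
Notation VR := (V * measurableTypeR R)%type.
Variables (a : R -> R) (D C : R) (K : V -> R).
Hypothesis kp : kernel_profile a D C K.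
Notation om := (decay_weight a).
Notation bigk := (bigk a C K).
Notation bigm := (bigm a C K).
Notation smallk := (smallk a C K).
Notation smallm := (smallm a C K).

Let eps (n : nat) : R := n.+1%:R^-1.
Let eps0 n : 0 < eps n. Proof. by rewrite invr_gt0 ltr0n. Qed.
Let eps1 n : eps n <= 1. Proof. by rewrite invf_le1 ?ltr0n// ler1n. Qed.
Let bigj := bigk_jump kp.
Let smallj n := smallk_jump kp (eps0 n).

(** At least [n], and so large that a small jump has probability at most 1 and
    a big jump probability at most 1/2. *)
Definition cp_steps (n : nat) : nat :=
  (n + Num.bound (smallm (eps n)) + Num.bound (2 * bigm)).+1.
Let NN n : R := (cp_steps n)%:R.
Let NN0 n : 0 < NN n. Proof. by rewrite ltr0n. Qed.

Let small_le n : smallm (eps n) <= NN n.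
Proof.
rewrite (le_trans (ltW (archi_boundP (jk_lam_ge0 (smallj n)))))// ler_nat.
by rewrite /cp_steps -addnA addnCA -addnS leq_addr.
Qed.

Let big_le2 n : 2 * bigm <= NN n.
Proof.
have b0 : 0 <= 2 * bigm by rewrite mulr_ge0// (jk_lam_ge0 bigj).
rewrite (le_trans (ltW (archi_boundP b0)))// ler_nat.
by rewrite /cp_steps -addSn leq_addl.
Qed.

Let big_le n : bigm <= NN n.
Proof.
apply: le_trans (big_le2 n); have := jk_lam_ge0 bigj; lra.
Qed.

Definition big_run n := iter (cp_steps n) (jstep bigk bigm (NN n)).
Definition small_run n :=
  iter (cp_steps n) (jstep (smallk (eps n)) (smallm (eps n)) (NN n)).
(** The expectation of [f] after a run of small jumps from 0, followed by a
    run of big jumps. *)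
Definition cp n (f : V -> \bar R) : \bar R := small_run n (big_run n f) 0.

Lemma big_run_op n : positive_op (big_run n).
Proof. by apply: positive_op_iter; apply: positive_op_jstep. Qed.

Lemma small_run_op n : positive_op (small_run n).
Proof. by apply: positive_op_iter; apply: positive_op_jstep. Qed.

Lemma cp_op n : positive_op (fun f => small_run n (big_run n f)).
Proof. exact: positive_op_comp (small_run_op n) (big_run_op n). Qed.

Let pw n xi := (1 - levy_symbol bigk xi / NN n) ^+ cp_steps n *
  (1 - levy_symbol (smallk (eps n)) xi / NN n) ^+ cp_steps n.

Lemma cp_wave n xi c : cp n (fun x => (1 + wave xi c x)%:E) = (1 + pw n xi * cos c)%:E.
Proof.
have b1 : `|(1 - levy_symbol bigk xi / NN n) ^+ cp_steps n| <= 1.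
  rewrite normrX exprn_ile1//.
  have m0 : 0 <= levy_symbol bigk xi / NN n by rewrite divr_ge0 ?(symbol_ge0 bigj) ?ltW.
  have m2 : levy_symbol bigk xi / NN n <= 2.
    by rewrite ler_pdivrMr// (le_trans (symbol_le bigj xi))// ler_wpM2l.
  by rewrite ler_norml; lra.
rewrite /cp.
have -> : big_run n (fun x => (1 + wave xi c x)%:E) = fun x =>
    (1 + (1 - levy_symbol bigk xi / NN n) ^+ cp_steps n * wave xi c x)%:E.
  apply/funext => x; have := @jrun_wave _ _ _ _ bigj _ (NN0 n) (big_le n) (cp_steps n) 1 xi c x.
  rewrite normr1 mul1r => <- //; congr (iter _ _ _ x).
  by apply/funext => y; rewrite mul1r.
rewrite /small_run (jrun_wave (smallj n) (NN0 n) (small_le n)) // /wave.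
have -> : dotv xi 0 = 0 by rewrite /dotv big1// => i _; rewrite mxE mulr0.
by rewrite add0r.
Qed.

Lemma cp1 n : cp n (fun=> 1%:E) = 1%:E.
Proof.
rewrite /cp.
have -> : big_run n (fun=> 1%:E) = fun=> 1%:E.
  by apply/funext => x; exact: (jrun_cst1 bigj (NN0 n) (big_le n)).
exact: (jrun_cst1 (smallj n) (NN0 n) (small_le n)).
Qed.

Lemma cp_symbol_cvg xi : pw n xi @[n --> \oo] --> expR (- levy_symbol K xi).
Proof.
have nN n : (n < cp_steps n)%N by rewrite ltnS -addnA leq_addr.
have sl : levy_symbol (smallk (eps n)) xi @[n --> \oo] -->
    levy_symbol K xi - levy_symbol bigk xi.
  have h : (levy_symbol K xi - (levy_symbol (smallk (eps n)) xi + levy_symbol bigk xi))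
     @[n --> \oo] --> (0 : R).
    apply/cvgr0Pnorm_le => e e0; near=> n.
    rewrite (le_trans (symbol_split kp xi (eps0 n) (eps1 n)))//.
    rewrite (le_trans (ler_norm _))//.
    near: n; move: e e0; apply/cvgr0Pnorm_le.
    rewrite -(mulr0 (dot_norm xi ^+ 2)); apply: cvgM; first exact: cvg_cst.
    exact: near_moment_cvg0 kp.
  rewrite (_ : (fun n => _) = fun n => levy_symbol K xi - levy_symbol bigk xi -
    (levy_symbol K xi - (levy_symbol (smallk (eps n)) xi + levy_symbol bigk xi))); last first.
    by apply/funext => n; ring.
  rewrite -[X in _ --> X]subr0; apply: cvgB => //; exact: cvg_cst.
have -> : - levy_symbol K xi = - levy_symbol bigk xi + - (levy_symbol K xi - levy_symbol bigk xi).
  by ring.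
rewrite expRD; apply: cvgM; apply: pow_cvg_expR => //.
- by move=> n; exact: symbol_ge0 bigj _.
- exact: cvg_cst.
- by move=> n; exact: symbol_ge0 (smallj n) _.
Unshelve. all: by end_near. Qed.

Let q0 (y : V) : 0 <= dotv y y := dotv_ge0 y.

(** The second moment of the run of small jumps is at most
    [M = d * near_moment K 1], uniformly in [n], so that by Chebyshev's
    inequality the walk is within [rho] of the origin with probability at least
    1/2. From there a single big jump hits the unit ball around [x0] with a
    density comparable to [om x0]. *)
Lemma cp_lower : exists2 c : R, 0 < c & forall n x0 (f : V -> R) (I : R),
  measurable_fun setT f -> (forall x, 0 <= f x) -> 0 <= I ->
  (I%:E <= \int[mu]_y (f y * \1_[set y : V | `|y - x0| <= 1] y)%:E)%E ->
  ((c * om x0 * I)%:E <= cp n (EFin \o f))%E.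
Proof.
have bm0 := jk_lam_ge0 bigj; have C0 := kp_C0 kp.
pose M := d%:R * near_moment K 1.
have M0 : 0 <= M by rewrite mulr_ge0// (near_moment_ge0 kp).
(* M / rho^2 <= 1/2 and rho >= 1 *)
pose rho := 2 * M + 1.
have rho1 : 1 <= rho by rewrite /rho lerDr mulr_ge0.
have rho0 : 0 < rho := lt_le_trans ltr01 rho1.
have [B1 B10 omB] := om_shift kp (1 + rho).
pose c' := expR (- (2 * bigm)) / (C * B1).
have c'0 : 0 < c' by rewrite divr_gt0 ?expR_gt0// mulr_gt0.
exists (c' / 2); first by rewrite divr_gt0.
move=> n x0 f I mf f0 I0 fI.
have om0 := om_gt0 kp.
pose kap := c' * om x0 * I.
have kap0 : 0 <= kap by apply: mulr_ge0 => //; apply: mulr_ge0; apply: ltW.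
have mEf : measurable_fun setT (EFin \o f) by apply/measurable_EFinP.
have Ef0 x : (0 <= (EFin \o f) x)%E by rewrite lee_fin.
have mS : measurable [set y : V | `|y - x0| <= 1].
  rewrite (_ : [set _ | _] = (fun y : V => y - x0) @^-1` [set y : V | `|y| <= 1])//.
  rewrite -[X in measurable X]setTI.
  apply: (measurable_rVB (f := fun y : V => y) (g := fun=> x0)) => //.
  exact: measurable_rV_ball.
have mind : measurable_fun setT (\1_[set y : V | `|y - x0| <= 1] : V -> R) by exact: measurable_indic.
have mom := measurable_om kp; have mbk := jk_meas bigj.
have cc0 : 0 <= (C * B1)^-1 * om x0.
  by rewrite mulr_ge0 ?(ltW (om0 _))// invr_ge0 mulr_ge0// ltW.
have Bge z : `|z| <= rho -> (kap%:E <= big_run n (EFin \o f) z)%E.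
  move=> zr.
  have J : ((((C * B1)^-1 * om x0 * I)%:E) <= jump bigk (EFin \o f) z)%E.
    have -> : jump bigk (EFin \o f) z = (\int[mu]_y (bigk (y - z) * f y)%:E)%E.
      rewrite -(ge0_integral_rV_shift (f := fun y => (bigk (y - z) * f y)%:E) z).
      - by apply: eq_integral => y _; rewrite addrK [z + y]addrC.
      - by meas.
      - by move=> y; rewrite lee_fin mulr_ge0// (jk_ge0 bigj).
    apply: (@le_trans _ _ (\int[mu]_y ((C * B1)^-1 * om x0 * (f y * \1_[set y : V | `|y - x0| <= 1] y))%:E)%E).
      rewrite ge0_intZ//; last 2 first.
      - by meas.
      - by move=> y; rewrite mulr_ge0.
      by rewrite EFinM lee_wpmul2l// lee_fin.
    apply: ge0_intle; [by meas|by meas| |].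
      by move=> y; rewrite mulr_ge0// mulr_ge0.
    move=> y; rewrite indicE; have [yS|yS] := pselect (`|y - x0| <= 1); last first.
      by rewrite memNset// !mulr0 mulr_ge0// (jk_ge0 bigj).
    rewrite mem_set// mulr1 ler_wpM2r//.
    apply: le_trans (bigk_ge kp _).
    rewrite invfM -mulrA ler_wpM2l ?invr_ge0 ?(ltW C0)// mulrC ler_pdivrMr// mulrC.
    apply: omB; rewrite (_ : x0 - (y - z) = - (y - x0) + z); last by rewrite !opprB addrA addrAC.
    by rewrite (le_trans (ler_normD _ _))// normrN lerD.
  have := @jrun_ge_jump _ _ _ _ bigj _ (NN0 n) (big_le n) (cp_steps n).-1 _ z mEf Ef0.
  rewrite prednK//; apply: le_trans.
  rewrite divff ?gt_eqF// mul1r.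
  have J0 : (0 <= ((C * B1)^-1 * om x0 * I)%:E)%E.
    by rewrite lee_fin mulr_ge0.
  apply: le_trans (lee_wpmul2l _ J); last first.
    by rewrite lee_fin exprn_ge0// subr_ge0 ler_pdivrMr// mul1r.
  rewrite -EFinM lee_fin /kap /c' -!mulrA ler_wpM2r//.
    by rewrite !mulrA -lee_fin.
  set x := bigm / NN n.
  have x2 : x <= 2^-1 by rewrite ler_pdivrMr// mulrC ler_pdivlMr// mulrC.
  have x0' : 0 <= x by rewrite divr_ge0// ltW.
  have r1 : 0 <= 1 - x <= 1 by lra.
  have e2 : expR (- (2 * x)) <= 1 - x.
    apply: le_trans (one_sub_ge_expR _); last by lra.
    by rewrite ler_expR lerN2 ler_pdivrMr; [nra|lra].
  apply: (@le_trans _ _ ((1 - x) ^+ cp_steps n)).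
    rewrite (_ : - (2 * bigm) = NN n * - (2 * x)); last first.
      by rewrite /x; field; rewrite gt_eqF.
    by rewrite mulrC expRM_natr lerXn2r// nnegrE ?expR_ge0//; lra.
  rewrite /cp_steps exprS ler_piMl ?exprn_ge0//; lra.
have mq : measurable_fun setT (fun y : V => dotv y y) by exact: measurable_dotv.
have Bop := big_run_op n; have Sop := small_run_op n.
have mB := po_meas1 Bop mEf Ef0; have B0 := po_ge0 Bop Ef0.
(* Chebyshev: 1 is at most the indicator of the ball plus |z|^2 / rho^2 *)
have le1 z : (kap%:E * 1%:E <= big_run n (EFin \o f) z + (kap / rho ^+ 2)%:E * (dotv z z)%:E)%E.
  rewrite -!EFinM mulr1.
  have k0 : 0 <= kap / rho ^+ 2 * dotv z z by rewrite mulr_ge0 ?divr_ge0 ?sqr_ge0.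
  have [zr|zr] := leP `|z| rho.
    by rewrite (le_trans (Bge z zr))// leeDl// lee_fin.
  rewrite (@le_trans _ _ (kap / rho ^+ 2 * dotv z z)%:E)// ?leeDr// lee_fin.
  rewrite mulrAC ler_pdivlMr ?exprn_gt0// ler_wpM2l//.
  have h1 := norm_le_enorm z; have h2 := lt_le_trans zr h1.
  have -> : dotv z z = enorm z ^+ 2 by rewrite sqr_sqrtr.
  by rewrite lerXn2r ?nnegrE ?sqrtr_ge0 ?(ltW rho0) ?(ltW h2).
have kr0 : 0 <= kap / rho ^+ 2 by rewrite divr_ge0 ?sqr_ge0.
have mk1 : measurable_fun setT (fun _ : V => (kap%:E * 1%:E)%E) by exact: measurable_cst.
have := po_le Sop mk1 _ _ le1 0.
rewrite (po_scale Sop)// -/(cp n _).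
have [kM Mle] := smallME kp (eps0 n).
rewrite (po_add Sop)//; last 2 first.
- by apply: emeasurable_funM => //; apply/measurable_EFinP.
- by move=> z; rewrite mule_ge0// lee_fin.
rewrite (po_scale Sop)//; last by apply/measurable_EFinP.
have -> : small_run n (fun y => (dotv y y)%:E) 0 = _ := jrun_sq (smallj n) (NN0 n) _ _ kM.
have -> : small_run n (fun=> 1%:E) 0 = 1%:E := jrun_cst1 (smallj n) (NN0 n) (small_le n) _ _.
rewrite -/(cp n _).
have -> : dotv (0 : V) 0 = 0 by rewrite /dotv big1// => i _; rewrite mxE mulr0.
have -> : 0 + (cp_steps n)%:R * smallM a C K (eps n) / NN n = smallM a C K (eps n).
  by rewrite add0r mulrAC -/(NN n) divff ?gt_eqF// mul1r.
rewrite -!EFinM mulr1.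
move=> H; have {}H : (kap%:E <= cp n (EFin \o f) + (kap / rho ^+ 2 * smallM a C K (eps n))%:E)%E.
  apply: H; last by move=> z; rewrite lee_fin.
  apply: emeasurable_funD => //.
  by apply: emeasurable_funM => //; apply/measurable_EFinP.
have half : kap / rho ^+ 2 * smallM a C K (eps n) <= kap / 2.
  rewrite -mulrA ler_wpM2l// mulrC ler_pdivrMr ?exprn_gt0//.
  rewrite (le_trans Mle)// -/M; have : M <= 2^-1 * rho by rewrite /rho; lra.
  by move=> /le_trans -> //; rewrite ler_wpM2l// expr2 ler_peMl// ltW.
have -> : c' / 2 * om x0 * I = kap / 2 by rewrite /kap; ring.
have cp0 : (0 <= cp n (EFin \o f))%E by exact: (po_ge0 Sop).
move: H cp0; case: (cp n _) => [r| |]//=; rewrite ?leey// -EFinD !lee_fin; lra.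
Qed.

End compound_poisson.


(** * The lower bound for the heat kernel *)

Lemma continuous_lt_ball (R : realType) (V : normedModType R) (f : V -> R) (p : V) (q : R) :
  continuous f -> f p < q -> exists2 e, 0 < e & forall y, `|p - y| < e -> f y < q.
Proof.
move=> cf fq; have : \forall y \near p, f y < q by apply: (cvgr_lt _ (cf p)).
by move=> /nbhs_normP[e e0 he]; exists e.
Qed.

Section laplace_cosine.
Context {R : realType}.
Notation leb := (@lebesgue_measure R).

Definition expwt (t : R) : R := \1_(`[0, +oo[%classic) t * expR (- t).

Lemma expwt_ge0 t : 0 <= expwt t.
Proof. by rewrite mulr_ge0 ?expR_ge0// indicE. Qed.

Lemma measurable_expwt : measurable_fun setT expwt.
Proof.
apply: measurable_funM; first exact: measurable_indic.
apply: (measurableT_comp (f := @expR R)) => //; exact: measurable_funN.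
Qed.

(** [1 / (1 + u^2)] is an average of the cosines [cos (t u)]. *)
Lemma laplace_cos (rho u : R) : `|rho| <= 1 ->
  (\int[leb]_t (expwt t * (1 + rho * cos (t * u)))%:E = (1 + rho / (1 + u ^+ 2))%:E)%E.
Proof.
move=> r1; pose f (t : R) := expR (- t) * (1 + rho * cos (t * u)).
have u1 : 1 + u ^+ 2 != 0 by rewrite gt_eqF// ltr_pwDl// sqr_ge0.
pose F (t : R) := - expR (- t) * (1 + rho / (1 + u ^+ 2) * (cos (t * u) - u * sin (t * u))).
have -> : (\int[leb]_t (expwt t * (1 + rho * cos (t * u)))%:E =
    \int[leb]_(t in `[0%R, +oo[) (f t)%:E)%E.
  rewrite [RHS]integral_mkcond; apply: eq_integral => t _.
  rewrite patchE /expwt indicE; case: ifPn => h; first by rewrite mul1r.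
  by rewrite !mul0r.
have dF (t : R) : is_derive t (1 : R) F (f t).
  have h1 : is_derive t (1 : R) (fun t : R => - t) (- 1) by exact: is_deriveN.
  have h2 : is_derive t (1 : R) (fun t : R => expR (- t)) (expR (- t) * - 1).
    exact: (@is_derive1_comp R expR (fun t => - t) t _ _ (is_derive_expR _) h1).
  have h3 : is_derive t (1 : R) (fun t : R => t * u) u.
    have h30 := is_deriveZ u (is_derive_id t (1 : R)).
    rewrite (_ : (fun t => _) = u \*: (@id R)); last by apply/funext => s; rewrite /= /GRing.scale/= mulrC.
    by apply: (is_derive_eq h30); rewrite /GRing.scale/= mulr1.
  have h4 : is_derive t (1 : R) (fun t : R => cos (t * u)) (- sin (t * u) * u).
    exact: (@is_derive1_comp R (@cos R) (fun t => t * u) t _ _ (is_derive_cos _) h3).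
  have h5 : is_derive t (1 : R) (fun t : R => sin (t * u)) (cos (t * u) * u).
    exact: (@is_derive1_comp R (@sin R) (fun t => t * u) t _ _ (is_derive_sin _) h3).
  have h6 := is_deriveB h4 (is_deriveZ u h5).
  have h7 := is_deriveD (is_derive_cst (1 : R) t (1 : R)) (is_deriveZ (rho / (1 + u ^+ 2)) h6).
  have h8 : is_derive t (1 : R) F _ := is_deriveM (is_deriveN h2) h7.
  apply: (is_derive_eq h8).
  have -> : forall A B : R, (- (fun t : R => expR (- t))) t *: A +
     (cst 1 + (rho / (1 + u ^+ 2)) \*:
        ((fun t : R => cos (t * u)) - u \*: (fun t : R => sin (t * u)))) t *: B =
     - expR (- t) * A + (1 + rho / (1 + u ^+ 2) * (cos (t * u) - u * sin (t * u))) * B by [].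
  rewrite /GRing.scale/= /f; set E := expR _; set c := cos _; set s := sin _.
  by field.
rewrite (@ge0_continuous_FTC2y R f F 0 0).
- rewrite /F oppr0 expR0 mul0r cos0 sin0 mulr0 subr0 mulr1 sub0e.
  by rewrite mulN1r EFinN oppeK.
- move=> t _; rewrite mulr_ge0 ?expR_ge0//.
  have : `|rho * cos (t * u)| <= 1 by rewrite normrM mulr_ile1// cos_max.
  by rewrite ler_norml; lra.
- apply: continuous_subspaceT => t.
  rewrite /continuous_at /f; apply: cvgM.
    apply: (@continuous_comp _ _ _ -%R expR); [exact: opp_continuous|exact: continuous_expR].
  apply: cvgD; first exact: cvg_cst.
  apply: cvgM; first exact: cvg_cst.
  apply: (@continuous_comp _ _ _ (fun t : R => t * u) cos); last exact: continuous_cos.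
  exact: mulrr_continuous.
- apply/cvgr0Pnorm_le => e e0.
  pose B := 1 + `|rho / (1 + u ^+ 2)| * (1 + `|u|).
  have B0 : 0 < B by rewrite ltr_pwDl// mulr_ge0// addr_ge0.
  have bF (t : R) : `|F t| <= B * expR (- t).
    rewrite /F normrM normrN (ger0_norm (expR_ge0 _)) mulrC ler_wpM2r ?expR_ge0//.
    rewrite (le_trans (ler_normD _ _))// normr1 lerD2l normrM ler_wpM2l//.
    by rewrite (le_trans (ler_normB _ _))// lerD ?cos_max// normrM ler_piMr// sin_max.
  near=> t; rewrite (le_trans (bF t))// mulrC -ler_pdivlMr//.
  near: t.
  have := @cvgr_expR R => /cvgr0Pnorm_le /(_ (e / B)) h.
  apply: filterS (h _); last by rewrite divr_gt0.
  by move=> t; rewrite ger0_norm// expR_ge0.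
- by move=> t _; have [] := dF t.
- apply: cvg_at_right_filter; apply: differentiable_continuous.
  by apply/derivable1_diffP; have [] := dF 0.
- by move=> t _; rewrite derive1E; have [_ ->] := dF t.
Unshelve. all: by end_near. Qed.

End laplace_cosine.

Section weak_convergence.
Context {R : realType} {d : nat}.
Notation V := 'rV[R]_d.
Notation mu := (@lebesgue_rV R d).
Notation leb := (@lebesgue_measure R).
Notation VR := (V * measurableTypeR R)%type.
Variables (Phi : nat -> (V -> \bar R) -> V -> \bar R) (Q : V -> R).
Hypothesis PhiP : forall n, positive_op (Phi n).
Hypothesis Phi1 : forall n, Phi n (fun=> 1%:E) 0 = 1%:E.
Hypothesis mQ : measurable_fun setT Q.
Hypothesis Q0 : forall x, 0 <= Q x.
Hypothesis Q1 : (\int[mu]_x (Q x)%:E = 1)%E.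

(** Stated for [1 + f], which is nonnegative when [|f| <= 1], so that the
    operators of [positive_op] apply. *)
Definition conv (f : V -> R) : Prop :=
  Phi n (fun x => (1 + f x)%:E) 0 @[n --> \oo] --> (\int[mu]_x ((1 + f x) * Q x)%:E)%E.

Let p1 (f : V -> R) x : (forall x, `|f x| <= 1) -> 0 <= 1 + f x.
Proof. by move=> /(_ x); rewrite ler_norml => /andP[]; lra. Qed.

Let pm (f : V -> R) : measurable_fun setT f -> measurable_fun setT (fun x => 1 + f x).
Proof. by move=> mf; meas. Qed.

Let intQ_le2 (f : V -> R) : measurable_fun setT f -> (forall x, `|f x| <= 1) ->
  (\int[mu]_x ((1 + f x) * Q x)%:E <= 2%:E)%E.
Proof.
move=> mf f1; rewrite -[leRHS]mule1 -Q1 -ge0_intZ//.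
apply: ge0_intle; [by meas|by meas|by move=> x; rewrite mulr_ge0// p1|].
by move=> x; rewrite ler_wpM2r//; have := f1 x; rewrite ler_norml; lra.
Qed.

Let Phi_le2 n (f : V -> R) : measurable_fun setT f -> (forall x, `|f x| <= 1) ->
  (Phi n (fun x => (1 + f x)%:E) 0 <= 2%:E)%E.
Proof.
move=> mf f1; rewrite -[leRHS]mule1 -(Phi1 n) -(po_scale (PhiP n))//.
apply: (po_le (PhiP n)) => //.
- by apply/measurable_EFinP; exact: pm.
- by move=> x; rewrite lee_fin p1.
- by move=> x; rewrite mule1 lee_fin; have := f1 x; rewrite ler_norml; lra.
Qed.

Lemma conv_avg (f g : V -> R) : measurable_fun setT f -> measurable_fun setT g ->
  (forall x, `|f x| <= 1) -> (forall x, `|g x| <= 1) ->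
  conv f -> conv g -> conv (fun x => 2^-1 * (f x + g x)).
Proof.
move=> mf mg f1 g1 cf cg.
have hE (p : R -> R) : (fun x : V => (1 + 2^-1 * (f x + g x))%:E) = fun x =>
    (2^-1%:E * ((1 + f x)%:E + (1 + g x)%:E))%E.
  by apply/funext => x; rewrite -EFinD -EFinM; congr EFin; field.
rewrite /conv.
have -> : (fun n => Phi n (fun x => (1 + 2^-1 * (f x + g x))%:E) 0) = fun n =>
    (2^-1%:E * (Phi n (fun x => (1 + f x)%:E) 0 + Phi n (fun x => (1 + g x)%:E) 0))%E.
  apply/funext => n; rewrite (hE id) (po_scale (PhiP n))//; last 2 first.
  - by apply: emeasurable_funD; apply/measurable_EFinP; exact: pm.
  - by move=> x; rewrite adde_ge0// lee_fin p1.
  rewrite (po_add (PhiP n))//; try by [apply/measurable_EFinP; exact: pm|move=> x; rewrite lee_fin p1].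
have -> : (\int[mu]_x ((1 + 2^-1 * (f x + g x)) * Q x)%:E = 2^-1%:E *
    (\int[mu]_x ((1 + f x) * Q x)%:E + \int[mu]_x ((1 + g x) * Q x)%:E))%E.
  rewrite -ge0_intD; [|by meas|by meas|by move=> x; rewrite mulr_ge0// p1|by move=> x; rewrite mulr_ge0// p1].
  rewrite -ge0_intZ//; [|by meas|by move=> x; rewrite addr_ge0// mulr_ge0// p1].
  by apply: eq_integral => x _; congr EFin; field.
apply: cvgeZl => //; apply: cvgeD => //.
have i0 (h : V -> R) : measurable_fun setT h -> (forall x, `|h x| <= 1) ->
    (\int[mu]_x ((1 + h x) * Q x)%:E)%E \is a fin_num.
  move=> mh h1; rewrite ge0_fin_numE; last by apply: int_ge0 => x; rewrite mulr_ge0// p1.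
  by rewrite (le_lt_trans (intQ_le2 mh h1))// ltry.
by apply: fin_num_adde_defr; exact: i0.
Qed.

(** Convergence passes through an average over [t] by dominated convergence,
    the approximants being bounded by 2. *)
Lemma conv_laplace (F : V -> R -> R) (G : V -> R) :
  measurable_fun setT (fun z : VR => F z.1 z.2) -> (forall x t, `|F x t| <= 1) ->
  (forall t, conv (F ^~ t)) ->
  (forall x, \int[leb]_t (expwt t * (1 + F x t))%:E = (1 + G x)%:E)%E -> conv G.
Proof.
move=> mF F1 cF FG.
have mw := @measurable_expwt R; have w0 := @expwt_ge0 R.
have mFx x : measurable_fun setT (fun t : measurableTypeR R => F x t).
  exact: (measurableT_comp mF (pair1_measurable x)).
have mFt t : measurable_fun setT (F ^~ t).
  exact: (measurableT_comp mF (pair2_measurable (t : measurableTypeR R))).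
have F0 x t : 0 <= 1 + F x t by apply: (@p1 (F ^~ t)).
have m1 : measurable_fun setT (fun z : VR => (expwt z.2 * (1 + F z.1 z.2))%:E).
  apply/measurable_EFinP; apply: measurable_funM; last exact: measurable_funD.
  exact: (measurableT_comp mw).
have m2 n : measurable_fun setT (fun t : measurableTypeR R =>
    (Phi n (fun x => (1 + F x t)%:E) 0)%E).
  have mF' : measurable_fun setT (fun z : VR => (1 + F z.1 z.2)%:E).
    by apply/measurable_EFinP; exact: measurable_funD.
  have := po_meas (PhiP n) mF' (fun z => F0 z.1 z.2) => h.
  exact: (measurableT_comp h (pair1_measurable (0 : V))).
have hn n : (Phi n (fun x => (1 + G x)%:E) 0 =
    \int[leb]_t ((expwt t)%:E * Phi n (fun x => (1 + F x t)%:E) 0))%E.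
  have -> : (fun x => (1 + G x)%:E) = fun x => (\int[leb]_t (expwt t * (1 + F x t))%:E)%E.
    by apply/funext => x; rewrite FG.
  rewrite (po_int (PhiP n) (F := fun z => (expwt z.2 * (1 + F z.1 z.2))%:E))//; last first.
    by move=> z; rewrite lee_fin mulr_ge0.
  apply: eq_integral => t _; rewrite -(po_scale (PhiP n))//.
    by apply/measurable_EFinP; exact: measurable_funD.
  by move=> x; rewrite lee_fin.
rewrite /conv (_ : (fun n => _) = fun n =>
  (\int[leb]_t ((expwt t)%:E * Phi n (fun x => (1 + F x t)%:E) 0))%E); last first.
  by apply/funext => n; rewrite hn.
have mFQ : measurable_fun setT (fun z : VR => (expwt z.2 * ((1 + F z.1 z.2) * Q z.1))%:E).
  apply/measurable_EFinP; apply: measurable_funM; first exact: (measurableT_comp mw).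
  apply: measurable_funM; first exact: measurable_funD.
  exact: (measurableT_comp mQ).
have mFQ2 : measurable_fun setT (fun z : VR => ((1 + F z.1 z.2) * Q z.1)%:E).
  apply/measurable_EFinP.
  apply: measurable_funM; first exact: measurable_funD.
  exact: (measurableT_comp mQ).
have -> : (\int[mu]_x ((1 + G x) * Q x)%:E =
   \int[leb]_t ((expwt t)%:E * \int[mu]_x ((1 + F x t) * Q x)%:E))%E.
  transitivity (\int[mu]_x \int[leb]_t (expwt t * ((1 + F x t) * Q x))%:E)%E.
    apply: eq_integral => x _; rewrite mulrC EFinM -FG -ge0_intZ//.
    - by apply: eq_integral => t _; congr EFin; ring.
    - by apply: measurable_funM => //; exact: measurable_funD.
    - by move=> t; rewrite mulr_ge0.
  rewrite (tonelli_swap mu leb (f := fun x t => (expwt t * ((1 + F x t) * Q x))%:E))//; last first.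
    by move=> x t; rewrite lee_fin !mulr_ge0.
  apply: eq_integral => t _; rewrite ge0_intZ//.
    by apply: measurable_funM => //; exact: measurable_funD.
  by move=> x; rewrite mulr_ge0.
have w1 : (\int[leb]_t (expwt t)%:E = 1)%E.
  have := @laplace_cos R 0 0; rewrite normr0 mul0r addr0 => <- //.
  by apply: eq_integral => t _; rewrite mul0r addr0 mulr1.
have [|||||_ _] := @dominated_convergence _ _ R leb setT measurableT
  (fun n t => ((expwt t)%:E * Phi n (fun x => (1 + F x t)%:E) 0)%E)
  (fun t => ((expwt t)%:E * \int[mu]_x ((1 + F x t) * Q x)%:E)%E)
  (fun t => (2 * expwt t)%:E).
- by move=> n; apply: emeasurable_funM => //; apply/measurable_EFinP.
- apply: emeasurable_funM; first by apply/measurable_EFinP.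
  apply: (measurable_int_fst mu (f := fun x (t : measurableTypeR R) => ((1 + F x t) * Q x)%:E)) => //.
  by move=> x t; rewrite lee_fin mulr_ge0.
- by apply: aeW => t _; apply: cvgeZl => //; exact: cF.
- apply/integrableP; split; first by apply/measurable_EFinP; exact: measurable_funM.
  rewrite (_ : \int[_]_(t in _) _ = \int[leb]_t (2 * expwt t)%:E)%E; last first.
    by apply: eq_integral => t _; rewrite gee0_abs// lee_fin mulr_ge0.
  by rewrite ge0_intZ// w1 mule1 ltry.
- apply: aeW => t n _; rewrite gee0_abs; last first.
    rewrite mule_ge0 ?lee_fin//; apply: (po_ge0 (PhiP n)).
    by move=> x; rewrite lee_fin.
  have -> : (2 * expwt t)%:E = ((expwt t)%:E * 2%:E)%E by rewrite -EFinM mulrC.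
  by rewrite lee_wpmul2l ?lee_fin// Phi_le2.
by [].
Qed.

Hypothesis conv_wave : forall xi c, conv (wave xi c).

(** Closing the class under multiplication by waves makes it stable under
    multiplication by an average of cosines in one coordinate: a product of two
    cosines is a mean of two cosines. *)
Definition wave_conv (g : V -> R) : Prop :=
  [/\ measurable_fun setT g, forall x, `|g x| <= 1 &
      forall xi c, conv (fun x => g x * wave xi c x)].

Lemma wave_conv1 : wave_conv (fun=> 1).
Proof.
split => // [x|xi c]; first by rewrite normr1.
rewrite (_ : (fun x => _) = wave xi c)//.
by apply/funext => x; rewrite mul1r.
Qed.

(** Products of these factors localize at [p] as [eta] tends to 0, and they are
    averages of waves, the only functions for which convergence is known at the
    start. *)
Definition cauchy_factor (p : V) (eta : R) (i : 'I_d) (x : V) : R :=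
  (1 + ((x ord0 i - p ord0 i) / eta) ^+ 2)^-1.

Lemma dotv_delta (i : 'I_d) (s : R) (x : V) : dotv (s *: delta_mx 0 i) x = s * x ord0 i.
Proof.
rewrite /dotv (bigD1 i)//= big1; last first.
  by move=> j ji; rewrite !mxE eqxx (negbTE ji) mulr0 mul0r.
by rewrite !mxE !eqxx mulr1 addr0.
Qed.

Lemma dotvDl (u v x : V) : dotv (u + v) x = dotv u x + dotv v x.
Proof. by rewrite /dotv -big_split; apply: eq_bigr => i _; rewrite mxE mulrDl. Qed.

Lemma measurable_coord (p : V) (eta : R) (i : 'I_d) :
  measurable_fun setT (fun x : V => (x ord0 i - p ord0 i) / eta).
Proof.
apply: measurable_funM => //; apply: measurable_funB => //.
exact: (@measurable_rV_coord R d i).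
Qed.

Lemma wave_conv_cauchy (p : V) eta i g : wave_conv g ->
  wave_conv (fun x => g x * cauchy_factor p eta i x).
Proof.
case=> mg g1 gc.
pose u (x : V) := (x ord0 i - p ord0 i) / eta.
have mu' : measurable_fun setT u := measurable_coord p eta i.
have u0 x : 1 <= 1 + u x ^+ 2 by rewrite lerDl sqr_ge0.
have mcau : measurable_fun setT (cauchy_factor p eta i).
  rewrite /cauchy_factor; apply: (measurableT_comp (f := fun r : R => (1 + r ^+ 2)^-1) (g := u)) => //.
  apply: continuous_measurable_fun => r; apply: cvgV; first by rewrite gt_eqF// ltr_pwDl// sqr_ge0.
  by apply: cvgD; [exact: cvg_cst|exact: exprn_continuous].
split.
- exact: measurable_funM.
- move=> x; rewrite normrM mulr_ile1// /cauchy_factor ger0_norm -/(u x).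
    by rewrite invf_le1// (lt_le_trans _ (u0 x)).
  by rewrite invr_ge0 (le_trans _ (u0 x)).
- move=> xi c; pose F x t := g x * wave xi c x * cos (t * u x).
  have gw x xi' c' : `|g x * wave xi' c' x| <= 1 by rewrite normrM mulr_ile1// wave_le1.
  apply: (@conv_laplace F).
  + apply: measurable_funM.
      apply: measurable_funM; first exact: (measurableT_comp mg).
      by apply: (measurableT_comp (measurable_wave xi c)).
    apply: (measurableT_comp (@measurable_cos R)).
    apply: measurable_funM => //; exact: (measurableT_comp mu').
  + by move=> x t; rewrite /F normrM mulr_ile1// cos_max.
  + move=> t; pose s := t / eta.
    have -> : F ^~ t = fun x => 2^-1 *
        (g x * wave (xi + s *: delta_mx 0 i) (c - s * p ord0 i) x +
         g x * wave (xi - s *: delta_mx 0 i) (c + s * p ord0 i) x).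
      apply/funext => x; rewrite /F /wave !dotvDl -[- (s *: delta_mx _ _)]scaleNr !dotv_delta.
      have -> : t * u x = s * x ord0 i - s * p ord0 i by rewrite /u /s; ring.
      set A := s * x ord0 i; set B := s * p ord0 i; set E := dotv xi x.
      have -> : E + A + (c - B) = (E + c) + (A - B) by ring.
      have -> : E + - s * x ord0 i + (c + B) = (E + c) - (A - B) by rewrite /A; ring.
      by move: (E + c) (A - B) => W Z; rewrite cosB cosD; field.
    by apply: conv_avg => //; try by [move=> x; exact: gw
      |apply: measurable_funM => //; exact: measurable_wave].
  + move=> x; rewrite laplace_cos ?gw//; congr EFin; rewrite /cauchy_factor -/(u x); ring.
Qed.

Definition cauchy_prod (p : V) (eta : R) (x : V) : R :=
  \prod_(i < d) cauchy_factor p eta i x.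

Lemma wave_conv_cauchy_prod (p : V) eta k :
  wave_conv (fun x => cauchy_prod p eta x ^+ k).
Proof.
elim: k => [|k ih]; first exact: wave_conv1.
have -> : (fun x => cauchy_prod p eta x ^+ k.+1) = fun x => cauchy_prod p eta x ^+ k *
    \prod_(i <- index_enum 'I_d) cauchy_factor p eta i x.
  by apply/funext => x; rewrite exprSr.
elim: (index_enum _) => [|i r IH].
  by under eq_fun do rewrite big_nil mulr1.
under eq_fun do rewrite big_cons [cauchy_factor _ _ _ _ * _]mulrC mulrA.
exact: wave_conv_cauchy.
Qed.

Lemma conv_of_wave_conv g : wave_conv g -> conv g.
Proof.
case=> _ _ /(_ 0 0); rewrite (_ : (fun x => _) = g)//; apply/funext => x.
have -> : wave 0 0 x = 1; last by rewrite mulr1.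
rewrite /wave (_ : dotv 0 x = 0) ?addr0 ?cos0//.
by rewrite /dotv big1// => i _; rewrite mxE mul0r.
Qed.

End weak_convergence.

Section heat_lower.
Context {R : realType} {d : nat}.
Notation V := 'rV[R]_d.
Notation mu := (@lebesgue_rV R d).

Lemma cauchy_prod_far (p : V) eta r x : 0 < eta -> 0 < r -> r < `|x - p| ->
  0 <= cauchy_prod p eta x <= (eta / r) ^+ 2.
Proof.
move=> e0 r0 rx.
have f01 i : 0 <= cauchy_factor p eta i x <= 1.
  rewrite /cauchy_factor; set u := _ ^+ 2; have u0 : 0 <= u by rewrite sqr_ge0.
  by rewrite invr_ge0 addr_ge0//= invf_le1 ?lerDl// ltr_pwDl.
rewrite prodr_ge0/=; last by move=> i _; have /andP[] := f01 i.
have [i ri] : exists i, r < `|(x - p) ord0 i|.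
  apply/not_existsP => h; move: rx; rewrite ltNge => /negP; apply.
  by apply/(rV_norm_leP _ (ltW r0)) => i; rewrite leNgt; apply/negP; exact: h.
rewrite /cauchy_prod (bigD1 i)//=.
apply: (@le_trans _ _ (cauchy_factor p eta i x)).
  by rewrite ler_piMr ?prodr_ile1//; have /andP[] := f01 i.
rewrite /cauchy_factor; set u := _ / eta.
have ur : r / eta <= `|u|.
  rewrite /u normrM normfV (gtr0_norm e0) ler_wpM2r ?invr_ge0 ?ltW//.
  by move: ri; rewrite !mxE.
have re0 : 0 < r / eta by rewrite divr_gt0.
have -> : (eta / r) ^+ 2 = ((r / eta) ^+ 2)^-1 by rewrite -exprVn invf_div.
rewrite lef_pV2 ?posrE ?exprn_gt0//; last by rewrite ltr_pwDl// sqr_ge0.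
rewrite -[u ^+ 2]real_normK ?num_real// ler_wpDl// lerXn2r// nnegrE//.
exact: ltW.
Qed.

Lemma cauchy_prod_near (p : V) eta (x : V) : 0 < eta -> (forall i, p ord0 i <= x ord0 i <= p ord0 i + eta) ->
  2^-1 ^+ d <= cauchy_prod p eta x.
Proof.
move=> e0 xb; rewrite -[X in _ ^+ X]card_ord -prodr_const; apply: ler_prod => i _.
rewrite invr_ge0 ler0n /= /cauchy_factor lef_pV2 ?posrE//; last by rewrite ltr_pwDl// sqr_ge0.
set u := _ / eta.
have /andP[u0 u1] : 0 <= u <= 1.
  have := xb i; rewrite /u => /andP[h1 h2].
  by rewrite divr_ge0 ?subr_ge0 ?(ltW e0)//= ler_pdivrMr// mul1r lerBlDl.
have := expr_le1 (n := 2) isT u0; rewrite u1; lra.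
Qed.

Variables (a : R -> R) (D C : R) (K : V -> R).
Hypothesis kp : kernel_profile a D C K.
Hypothesis d0 : (0 < d)%N.
Notation om := (decay_weight a).
Variable Q : V -> R.
Hypothesis cQ : continuous Q.
Hypothesis Q0 : forall x, 0 <= Q x.
Hypothesis Q1 : (\int[mu]_x (Q x)%:E = 1)%E.
Hypothesis Qcos : forall xi, \int[mu]_x (cos (dotv xi x) * Q x) = expR (- levy_symbol K xi).
Hypothesis Qsin : forall xi, \int[mu]_x (sin (dotv xi x) * Q x) = 0.

Let mQ : measurable_fun setT Q.
Proof. exact: continuous_measurable_rV. Qed.

Let intQ (f : V -> R) : measurable_fun setT f -> (forall x, `|f x| <= 1) ->
  mu.-integrable setT (EFin \o (fun x => f x * Q x)).
Proof.
move=> mf f1; apply: integrable_absP; first by meas.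
apply: (@le_lt_trans _ _ (\int[mu]_x (Q x)%:E)%E); last by rewrite Q1 ltry.
apply: ge0_intle => //; [by meas|] => x.
by rewrite normrM (ger0_norm (Q0 x)) ler_piMl.
Qed.

Let int_wave xi c : (\int[mu]_x ((1 + wave xi c x) * Q x)%:E =
  (1 + expR (- levy_symbol K xi) * cos c)%:E)%E.
Proof.
have md : measurable_fun setT (fun x : V => dotv xi x) by exact: measurable_dotv.
have mc : measurable_fun setT (fun x : V => cos (dotv xi x)).
  exact: (measurableT_comp (@measurable_cos R)).
have ms : measurable_fun setT (fun x : V => sin (dotv xi x)).
  apply: (measurableT_comp (f := @sin R)) => //.
  by apply: continuous_measurable_fun; exact: continuous_sin.
have ic := intQ mc (fun x => cos_max _); have is_ := intQ ms (fun x => sin_max _).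
have i1 : mu.-integrable setT (EFin \o Q).
  apply: integrable_absP => //; under eq_integral do rewrite ger0_norm//.
  by rewrite Q1 ltry.
have icc : mu.-integrable setT (EFin \o (fun x => cos c * (cos (dotv xi x) * Q x))).
  by have := integrableZl measurableT (cos c) ic.
have iss : mu.-integrable setT (EFin \o (fun x => sin c * (sin (dotv xi x) * Q x))).
  by have := integrableZl measurableT (sin c) is_.
have icQ : mu.-integrable setT (EFin \o (fun x => Q x + cos c * (cos (dotv xi x) * Q x))).
  by have := integrableD measurableT i1 icc.
have -> : (\int[mu]_x ((1 + wave xi c x) * Q x)%:E = \int[mu]_x
    (Q x + cos c * (cos (dotv xi x) * Q x) - sin c * (sin (dotv xi x) * Q x))%:E)%E.
  by apply: eq_integral => x _; congr EFin; rewrite /wave cosD; ring.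
rewrite -Rint_fin; last by have := integrableB measurableT icQ iss.
rewrite RintegralB// RintegralD// !RintegralZl// Qcos Qsin mulr0 subr0.
by rewrite /Rintegral Q1 mulrC.
Qed.

Let conv_wave xi c :
  conv (fun n f => small_run a C K n (big_run a C K n f)) Q (wave xi c).
Proof.
rewrite /conv int_wave.
have -> : (fun n => small_run a C K n (big_run a C K n (fun x => (1 + wave xi c x)%:E)) 0) =
    EFin \o (fun n => 1 + (1 - levy_symbol (bigk a C K) xi / (cp_steps a C K n)%:R) ^+ cp_steps a C K n *
     (1 - levy_symbol (smallk a C K n.+1%:R^-1) xi / (cp_steps a C K n)%:R) ^+ cp_steps a C K n * cos c).
  by apply/funext => n; exact: (cp_wave kp n xi c).
apply: cvg_EFin; first by apply: nearW.
apply: cvgD; first exact: cvg_cst.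
by apply: cvgM; [exact: (cp_symbol_cvg kp)|exact: cvg_cst].
Qed.

Lemma cauchy_lower : exists2 c : R, 0 < c & forall p eta I, 0 < eta -> 0 <= I ->
  (I%:E <= \int[mu]_y (cauchy_prod p eta y ^+ d * \1_[set y : V | `|y - p| <= 1] y)%:E)%E ->
  ((c * om p * I)%:E <= \int[mu]_y (cauchy_prod p eta y ^+ d * Q y)%:E)%E.
Proof.
have [c c0 H] := cp_lower kp; exists c => // p eta I e0 I0 hI.
pose Phi n (f : V -> \bar R) := small_run a C K n (big_run a C K n f).
have PhiP n : positive_op (Phi n) := cp_op kp n.
have Phi1 n : Phi n (fun=> 1%:E) 0 = 1%:E := cp1 kp n.
have wc := wave_conv_cauchy_prod PhiP Phi1 mQ Q0 Q1 conv_wave p eta d.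
have cf := conv_of_wave_conv wc; case: wc => mf f1 _.
set f := fun x => cauchy_prod p eta x ^+ d in mf f1 cf.
have f0 x : 0 <= f x.
  rewrite /f exprn_ge0// prodr_ge0// => i _.
  by rewrite invr_ge0 addr_ge0// sqr_ge0.
have mEf : measurable_fun setT (EFin \o f) by apply/measurable_EFinP.
have lb n : ((1 + c * om p * I)%:E <= Phi n (fun x => (1 + f x)%:E) 0%R)%E.
  have -> : (fun x => (1 + f x)%:E) = fun x => (1%:E + (EFin \o f) x)%E.
    by apply/funext => x; rewrite EFinD.
  rewrite (po_add (PhiP n))// Phi1 EFinD leeD2l//.
  exact: (H n p f I).
have : ((1 + c * om p * I)%:E <= \int[mu]_x ((1 + f x) * Q x)%:E)%E.
  by apply: (cvge_to_ge cf); apply: nearW.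
have -> : (\int[mu]_x ((1 + f x) * Q x)%:E = 1 + \int[mu]_x (f x * Q x)%:E)%E.
  rewrite -Q1 -ge0_intD//; [|by meas|by move=> x; rewrite mulr_ge0].
  by apply: eq_integral => x _; rewrite mulrDl mul1r.
by rewrite EFinD leeD2lE.
Qed.

(** If [Q p < c om p], then by continuity [Q <= q < c om p] on a ball of radius
    [r] around [p]. The integral of [cauchy_prod p eta ^+ d] against [Q] is at
    most [q J] plus [(eta / r)^(2 d)], where [J] is the integral over that ball;
    by [cauchy_lower] it is at least [c om p J]. But [J] is at least a multiple
    of [eta^d], which is much larger than [eta^(2 d)]. The power [d] of the
    product is chosen for this comparison. *)
Lemma heat_lower : exists2 c : R, 0 < c & forall x, c * om x <= Q x.
Proof.
have [c c0 H] := cauchy_lower; exists c => // p; rewrite leNgt; apply/negP => QL.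
set L := c * om p in QL.
have om0 := om_gt0 kp p.
have L0 : 0 < L by rewrite mulr_gt0.
pose q := (Q p + L) / 2.
have qL : q < L by rewrite /q; lra.
have Qq : Q p < q by rewrite /q; lra.
have q0 : 0 <= q by rewrite (le_trans (Q0 p))// ltW.
have [r [r0 r1 Qr]] : exists r : R, [/\ 0 < r, r <= 1 & forall y, `|y - p| <= r -> Q y <= q].
  have [e e0 he] := continuous_lt_ball cQ Qq; exists (Num.min 1 (e / 2)).
  split; [by rewrite lt_min ltr01 divr_gt0|by rewrite ge_min lexx|] => y yr.
  apply/ltW/he; rewrite distrC (le_lt_trans yr)// gt_min.
  by apply/orP; right; rewrite ltr_pdivrMr// ltr_pMr// ltr1n.
(* chosen so that the final comparison reads cst <= eta, against ec *)
pose cst : R := (L - q) * (2^-1 ^+ d) ^+ d * r ^+ 2 ^+ d.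
have cst0 : 0 < cst by rewrite !mulr_gt0 ?exprn_gt0 ?subr_gt0 ?invr_gt0.
pose eta := Num.min r (Num.min 1 (cst / 2)).
have e0 : 0 < eta by rewrite !lt_min r0 ltr01 divr_gt0.
have er : eta <= r by rewrite ge_min lexx.
have e1 : eta <= 1 by rewrite !ge_min lexx orbT.
have ec : eta < cst.
  apply: (@le_lt_trans _ _ (cst / 2)); first by rewrite !ge_min lexx !orbT.
  by rewrite ltr_pdivrMr// ltr_pMr// ltr1n.
pose f x := cauchy_prod p eta x ^+ d.
have [mf f1 _] := wave_conv_cauchy_prod (cp_op kp) (cp1 kp) mQ Q0 Q1 conv_wave p eta d.
rewrite -/f in mf f1.
have f0 x : 0 <= f x.
  rewrite /f exprn_ge0// prodr_ge0// => i _.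
  by rewrite invr_ge0 addr_ge0// sqr_ge0.
have mB s : measurable [set y : V | `|y - p| <= s].
  rewrite (_ : [set _ | _] = (fun y : V => y - p) @^-1` [set y : V | `|y| <= s])//.
  rewrite -[X in measurable X]setTI.
  apply: (measurable_rVB (f := fun y : V => y) (g := fun=> p)) => //.
  exact: measurable_rV_ball.
have mi s : measurable_fun setT (\1_[set y : V | `|y - p| <= s] : V -> R) by exact: measurable_indic.
pose J := (\int[mu]_y (f y * \1_[set y : V | `|y - p| <= r] y)%:E)%E.
have J0 : (0 <= J)%E by apply: int_ge0 => y; rewrite mulr_ge0.
have f1' y : f y <= 1 by exact: le_trans (ler_norm _) (f1 y).
have Jge : (((2^-1 ^+ d) ^+ d * eta ^+ d)%:E <= J)%E.
  pose A : 'I_d -> set R := fun i => `[p ord0 i, p ord0 i + eta]%classic.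
  pose B : set V := [set y | forall i, A i (y ord0 i)].
  have mBx : measurable B by apply: measurable_rV_box => i; exact: measurable_itv.
  have mB' : mu B = (eta ^+ d)%:E.
    rewrite (lebesgue_rV_box (A := A)); last by move=> i; exact: measurable_itv.
    rewrite (eq_bigr (fun=> eta%:E)); last first.
      move=> i _; rewrite lebesgue_measure_itv/= lte_fin ltrDl e0.
      by rewrite -EFinD addrAC subrr add0r.
    by rewrite prodEFin prodr_const card_ord.
  have k0 : 0 <= (2^-1 ^+ d : R) ^+ d by rewrite !exprn_ge0// invr_ge0.
  apply: (@le_trans _ _ (\int[mu]_y ((2^-1 ^+ d) ^+ d * \1_B y)%:E)%E).
    by rewrite ge0_intZ// integral_indic// setIT EFinM -mB'.
  apply: ge0_intle; [| |by move=> y; rewrite mulr_ge0// indicE|].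
  - by apply: measurable_funM => //; exact: measurable_indic.
  - exact: measurable_funM.
  move=> y; rewrite !indicE; have [yB|yB] := pselect (B y); last first.
    by rewrite [y \in B]memNset// mulr0 mulr_ge0.
  have yb i : p ord0 i <= y ord0 i <= p ord0 i + eta.
    by have := yB i; rewrite /A /= in_itv.
  rewrite [y \in B]mem_set// mem_set/= ?mulr1.
    by rewrite /f lerXn2r ?nnegrE ?exprn_ge0 ?invr_ge0// ?cauchy_prod_near// (le_trans _ (cauchy_prod_near e0 yb))// exprn_ge0// invr_ge0.
  apply/(rV_norm_leP _ (ltW r0)) => i; rewrite !mxE.
  by have /andP[h1 h2] := yb i; rewrite ger0_norm; lra.
have up : (\int[mu]_y (f y * Q y)%:E <= q%:E * J + ((eta / r) ^+ 2 ^+ d)%:E)%E.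
  have er0 : 0 <= (eta / r) ^+ 2 ^+ d by rewrite !exprn_ge0// divr_ge0// ltW.
  rewrite -[((eta / r) ^+ 2 ^+ d)%:E]mule1 -Q1 -!ge0_intZ//; last 2 first.
  - exact: measurable_funM.
  - by move=> y; rewrite mulr_ge0.
  have mfi := measurable_funM mf (mi r).
  have fi0 y : 0 <= f y * \1_[set y : V | `|y - p| <= r] y by rewrite mulr_ge0.
  rewrite -ge0_intD; [|by apply: measurable_funM|by apply: measurable_funM
    |by move=> y; rewrite mulr_ge0|by move=> y; rewrite mulr_ge0].
  apply: ge0_intle.
  - exact: measurable_funM.
  - by apply: measurable_funD; apply: measurable_funM => //; exact: measurable_funM.
  - by move=> y; rewrite mulr_ge0.
  move=> y; rewrite indicE; have [yr|yr] := leP `|y - p| r.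
    rewrite mem_set// mulr1 ler_wpDr ?mulr_ge0// mulrC ler_wpM2r//.
    exact: Qr.
  rewrite memNset/=; last by apply/negP; rewrite -ltNge.
  rewrite !mulr0 add0r ler_wpM2r// /f.
  by have /andP[h1 h2] := cauchy_prod_far e0 r0 yr; rewrite lerXn2r// nnegrE// exprn_ge0// divr_ge0// ltW.
have Jfin : J \is a fin_num.
  rewrite ge0_fin_numE//.
  apply: (@le_lt_trans _ _ (\int[mu]_y (\1_[set y : V | (`|y| <= r + `|p|)%R] y)%:E)%E); last first.
    rewrite integral_indic ?setIT//; last exact: measurable_rV_ball.
    exact: lebesgue_rV_ball_fin.
  apply: ge0_intle.
  - exact: measurable_funM.
  - by apply: measurable_indic; exact: measurable_rV_ball.
  - by move=> y; rewrite mulr_ge0.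
  move=> y; rewrite !indicE; have [yr|yr] := leP `|y - p| r.
    rewrite mem_set// mulr1 mem_set//=.
    by rewrite -[y in leLHS](subrK p) (le_trans (ler_normD _ _))// lerD2r.
  by rewrite memNset/= ?mulr0//; apply/negP; rewrite -ltNge.
have JE : J = (fine J)%:E by rewrite fineK.
set j := fine J in JE; rewrite JE in Jge up J0.
rewrite !lee_fin in Jge J0.
have h := H p eta j e0 J0.
have {}h : ((c * om p * j)%:E <= \int[mu]_y (f y * Q y)%:E)%E.
  apply: h; rewrite -JE; apply: ge0_intle.
  - exact: measurable_funM.
  - exact: measurable_funM.
  - by move=> y; rewrite mulr_ge0.
  move=> y; rewrite ler_wpM2l// !indicE; have [yr|yr] := leP `|y - p| r.
    by rewrite !mem_set//= (le_trans yr).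
  have -> : (y \in [set y0 : V | `|y0 - p| <= r]) = false.
    by apply/memNset/negP; rewrite -ltNge.
  by rewrite ler0n.
have := le_trans h up; rewrite -/L -EFinM -EFinD lee_fin => {}h.
have h1 : (L - q) * ((2^-1 ^+ d) ^+ d * eta ^+ d) <= (eta / r) ^+ 2 ^+ d.
  apply: (@le_trans _ _ ((L - q) * j)); last by rewrite mulrBl lerBlDl.
  by rewrite ler_wpM2l// subr_ge0 ltW.
have : cst <= eta.
  have ed0 : 0 < eta ^+ d by rewrite exprn_gt0.
  rewrite (@le_trans _ _ (eta ^+ d))//; last first.
    by rewrite -[leRHS]expr1 ler_wiXn2l// ltW.
  rewrite -(ler_pM2r ed0) /cst.
  rewrite (_ : _ * eta ^+ d = (L - q) * ((2^-1 ^+ d) ^+ d * eta ^+ d) * (r ^+ 2 ^+ d)); last by ring.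
  have rd0 : 0 < r ^+ 2 ^+ d by rewrite !exprn_gt0.
  apply: (le_trans (ler_wpM2r (ltW rd0) h1)).
  have -> : (eta / r) ^+ 2 = eta ^+ 2 / r ^+ 2 by rewrite expr_div_n.
  have -> : eta ^+ d * eta ^+ d = (eta ^+ 2) ^+ d by rewrite -exprMn expr2.
  by rewrite -exprMn divfK// expf_neq0// gt_eqF.
by rewrite leNgt ec.
Qed.

End heat_lower.


(** * A function is determined by its mollifications *)

Section orthant_generation.
Context {R : realType} {n : nat}.
Notation V := 'rV[R]_n.

Definition orthant (b : 'rV[R]_n) : set V := [set x | forall i, x ord0 i < b ord0 i].

Definition orthants : set (set V) := [set A | exists b, A = orthant b].

Lemma orthants_setI : setI_closed orthants.
Proof.
move=> _ _ [b ->] [b' ->]; exists (\row_i Num.min (b ord0 i) (b' ord0 i)).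
apply/seteqP; split => x /=.
  by move=> [h h'] i; rewrite mxE lt_min h h'.
by move=> h; split => i; have := h i; rewrite mxE lt_min => /andP[].
Qed.

Lemma orthant_measurable b : measurable (orthant b).
Proof.
apply: (@measurable_rV_box R n (fun i => [set y | y < b ord0 i])) => i.
rewrite (_ : [set _ | _] = `]-oo, b ord0 i[%classic) //.
Qed.

(** A half-space [x_i < b] is the increasing union of the orthants whose other
    bounds are [k]. *)
Lemma measurable_orthants : measurable = <<s orthants >> :> set (set V).
Proof.
apply/seteqP; split; last first.
  apply: smallest_sub; first exact: sigma_algebra_measurable.
  by move=> _ [b ->]; exact: orthant_measurable.
have sG : sigma_algebra setT <<s orthants >> by exact: smallest_sigma_algebra.
have [s0 sC sU] := sG.
apply: smallest_sub => //.
move=> B; rewrite -bigcup_seq => -[i _ [C mC <-]]; rewrite setTI.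
pose H := [set C : set R | <<s orthants >> (@rV_coord R n i @^-1` C)].
have sH : sigma_algebra setT H.
  split.
  - by rewrite /H /= preimage_set0.
  - by move=> A HA; rewrite /H /= setTD preimage_setC -setTD; exact: sC.
  - by move=> F HF; rewrite /H /= preimage_bigcup; exact: sU.
have : (@RGenInftyO.G R).-sigma.-measurable C.
  by rewrite -RGenInftyO.measurableE; exact: mC.
move: C {mC}; apply: smallest_sub => // _ [b ->]; rewrite /H /=.
rewrite (_ : _ @^-1` _ = \bigcup_k orthant (\row_j (if j == i then b else k%:R))).
  by apply: sU => k; apply: sub_sigma_algebra; exists (\row_j (if j == i then b else k%:R)).
apply/seteqP; split => x /=.
  rewrite /rV_coord in_itv/= => xb; exists (Num.bound `|x|) => // j; rewrite mxE.
  case: eqP => [->//|_].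
  rewrite (le_lt_trans (ler_norm _))// (le_lt_trans (rV_coord_le_norm _ _))//.
  exact: archi_boundP.
by move=> [k _ /(_ i)]; rewrite mxE eqxx /= in_itv.
Qed.

End orthant_generation.

Section mollifier_injective.
Context {R : realType} {d : nat}.
Notation V := 'rV[R]_d.
Notation mu := (@lebesgue_rV R d).
Variable w : V -> R.
Hypothesis mw : measurable_fun setT w.
Hypothesis wloc : forall r : R, (\int[mu]_y (`|w y| * \1_[set y : V | (`|y| <= r)%R] y)%:E < +oo)%E.

Let ball (r : R) : set V := [set y | `|y| <= r].
Let mball r : measurable (ball r) := measurable_rV_ball r.

Lemma local_integrable (f : V -> R) r : measurable_fun setT f ->
  (forall y, `|f y| <= \1_(ball r) y) -> mu.-integrable setT (EFin \o (fun y => w y * f y)).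
Proof.
move=> mf fr; apply: integrable_absP; first by meas.
apply: le_lt_trans (wloc r); apply: ge0_intle => //; [by meas| |].
  by apply: measurable_funM; [meas|apply: measurable_indic; exact: mball].
by move=> y; rewrite normrM ler_wpM2l.
Qed.

Definition cube (r : R) : set V := [set y : V | forall i, - r <= y ord0 i < r].

Lemma cube_measurable r : measurable (cube r).
Proof.
apply: (@measurable_rV_box R d (fun i => `[-r, r[%classic)) => i; exact: measurable_itv.
Qed.

Lemma cube_sub r : cube r `<=` ball `|r|.
Proof.
move=> y Qy; apply/rV_norm_leP => // i; have /andP[h1 h2] := Qy i.
rewrite ler_norml (le_trans _ h1) ?lerN2 ?ler_norm//=.
by rewrite (le_trans (ltW h2))// ler_norm.
Qed.

Lemma cube_integrable r : mu.-integrable (cube r) (EFin \o w).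
Proof.
have mc := cube_measurable r.
have /(integrableS measurableT mc (@subsetT _ _)) h : mu.-integrable setT (EFin \o (fun y => w y * \1_(cube r) y)).
  apply: (@local_integrable _ `|r|); first exact: measurable_indic.
  move=> y; rewrite !indicE ger0_norm//.
  have [h|h] := pselect (cube r y); last by rewrite memNset.
  by rewrite mem_set// mem_set//; apply: cube_sub.
apply: eq_integrable h => // y yc; rewrite /= indicE yc mulr1.
by [].
Qed.

(** Orthants form a generating class stable under intersection; the cube makes
    [w] integrable, as the passage to complements and unions requires. *)
Lemma orthogonal_to_orthants r :
  (forall b : V, \int[mu]_(y in cube r `&` orthant b) (w y)%:E = 0)%E ->
  forall A : set V, measurable A -> (\int[mu]_(y in cube r `&` A) (w y)%:E = 0)%E.
Proof.
move=> hb; have mQ := cube_measurable r; have iQ := cube_integrable r.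
have intQ : (\int[mu]_(y in cube r) (w y)%:E = 0)%E.
  rewrite -(hb (const_mx r)); congr (integral _ _ _).
  by apply/esym/setIidl => z Qz i; have /andP[_] := Qz i; rewrite mxE.
pose P (A : set V) := (\int[mu]_(y in cube r `&` A) (w y)%:E = 0)%E.
move=> A mA; have : <<s @orthants R d >> A by rewrite -measurable_orthants.
move: A {mA}; apply: (@dynkin_induction _ _ _ P measurable_orthants (@orthants_setI R d)).
- by rewrite /P setIT.
- by move=> _ [b ->]; exact: hb.
- move=> A mA; rewrite /P => PA; move: intQ.
  rewrite -[X in (\int[mu]_(y in X) _)%E](setUIDK (cube r) A).
  rewrite integral_setU//=; last 4 first.
  + exact: measurableI.
  + exact: measurableD.
  + by apply/measurable_EFinP; exact: measurable_funTS.
  + by apply/disj_setPS => y [[_ Ay] [_]].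
  by rewrite PA add0e setDE.
- move=> F mF tF PF; rewrite /P setI_bigcupr integral_bigcup.
  + by apply: eseries0 => i _ _; exact: PF.
  + exact: trivIset_setIl.
  + by move=> k; exact: measurableI.
  + rewrite -setI_bigcupr; apply: integrableS iQ => //.
    by apply: measurableI => //; exact: bigcupT_measurable.
Qed.

Lemma zero_of_orthants :
  (forall r (b : V), \int[mu]_(y in cube r `&` orthant b) (w y)%:E = 0)%E ->
  {ae mu, forall y, w y = 0}.
Proof.
move=> hb.
have h (k : nat) : ae_eq mu (cube k%:R) (EFin \o w) (cst 0%E).
  apply: integral_ae_eq => //; [exact: cube_measurable|exact: cube_integrable|].
  move=> E EQ mE; rewrite integral0.
  by rewrite -(orthogonal_to_orthants (hb k%:R) mE) (setIidr EQ).
have := ae_foralln h; apply: filterS => y hy.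
have [k yk] : exists k : nat, cube k%:R y.
  exists (Num.bound `|y|) => i; have := archi_boundP (normr_ge0 y).
  have := rV_coord_le_norm y i; rewrite ler_norml => /andP[h1 h2] h3.
  by rewrite (le_lt_trans h2 h3) andbT (le_trans _ h1)// lerN2 ltW.
by have [] := hy k yk.
Qed.

Let del (n : nat) : R := n.+1%:R^-1.
Let del0 n : 0 < del n. Proof. by rewrite invr_gt0 ltr0n. Qed.
Let del1 n : del n <= 1. Proof. by rewrite invf_le1 ?ltr0n// ler1n. Qed.

(** The mollifications are integrated over a box [B] that is open to the right.
    This gives [int w G_n = 0], where [G_n] is the convolution of the indicator
    of [B] with the reflected bump. Divided by the mass [c n] of the bump, it
    converges to the indicator everywhere, because the bump is supported in
    [[0, del n]^d]; so the integral of [w] over [B] vanishes. *)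
Lemma mollify_injective :
  (forall n, {ae mu, forall x, mollify w (cbump (del n)) x = 0}) ->
  {ae mu, forall y, w y = 0}.
Proof.
move=> hw; apply: zero_of_orthants => r b.
pose B := cube r `&` orthant b.
have mB : measurable B by apply: measurableI; [exact: cube_measurable|exact: orthant_measurable].
have mcb n : measurable_fun setT (cbump (del n) : V -> R) by have [M /bump_meas] := cbump_bump (d := d) (del0 n).
have cb0 n (x : V) : 0 <= cbump (del n) x by exact: cbump_ge0.
pose iB (x : V) : R := \1_B x.
have mI : measurable_fun setT iB by exact: measurable_indic.
have I01 (x : V) : 0 <= iB x <= 1 by rewrite /iB indicE; case: (_ \in _); rewrite ?lexx ?ler01.
have I0 (x : V) : 0 <= iB x by have /andP[] := I01 x.
have cfin n : (\int[mu]_x (cbump (del n) x)%:E < +oo)%E.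
  have [M bM] := cbump_bump (d := d) (del0 n).
  have M0 : 0 <= M by rewrite (le_trans _ (bump_bound bM 0)).
  apply: (@le_lt_trans _ _ (\int[mu]_x (M * \1_(ball 1) x)%:E)%E).
    apply: ge0_intle => //.
      by apply: measurable_funM => //; exact: measurable_indic.
    move=> x; rewrite indicE; have [x1|x1] := leP `|x| 1.
      by rewrite mem_set// mulr1 (le_trans (ler_norm _))// (bump_bound bM).
    by rewrite (bump_supp bM) ?mulr_ge0// (le_lt_trans (del1 n)).
  rewrite ge0_intZ//.
  by rewrite integral_indic// setIT lte_mul_pinfty ?lee_fin// lebesgue_rV_ball_fin.
pose c n : R := fine (\int[mu]_x (cbump (del n) x)%:E)%E.
have cE n : (\int[mu]_x (cbump (del n) x)%:E = (c n)%:E)%E.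
  by rewrite fineK// ge0_fin_numE ?cfin// int_ge0.
have c0 n : 0 < c n by rewrite -lte_fin -cE integral_cbump_gt0.
pose G n (y : V) : R := \int[mu]_x (iB x * cbump (del n) (x - y)).
have GE n y : (\int[mu]_x (iB x * cbump (del n) (x - y))%:E = \int[mu]_z (iB (z + y) * cbump (del n) z)%:E)%E.
  rewrite -(ge0_integral_rV_shift (f := fun x => (iB x * cbump (del n) (x - y))%:E) y).
  - by apply: eq_integral => z _; rewrite addrK.
  - by meas.
  - by move=> x; rewrite lee_fin mulr_ge0.
have Gle n y : (\int[mu]_x (iB x * cbump (del n) (x - y))%:E <= (c n)%:E)%E.
  rewrite GE -cE; apply: ge0_intle => //; [by meas|by move=> x; rewrite mulr_ge0|].
  by move=> x; rewrite ler_piMl//; have /andP[] := I01 (x + y).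
have Gint n y : mu.-integrable setT (EFin \o (fun x => iB x * cbump (del n) (x - y))).
  apply: integrable_absP; first by meas.
  under eq_integral do rewrite ger0_norm ?mulr_ge0//.
  by rewrite (le_lt_trans (Gle n y))// ltry.
have Gfin n y : (G n y)%:E = (\int[mu]_x (iB x * cbump (del n) (x - y))%:E)%E.
  by rewrite /G Rint_fin.
have G01 n y : 0 <= G n y <= c n.
  by rewrite -!lee_fin Gfin Gle andbT; apply: int_ge0 => x; rewrite mulr_ge0.
have mG n : measurable_fun setT (G n).
  by rewrite /G; apply: measurable_Rint_snd; meas.
have Bball x : B x -> `|x| <= `|r| by move=> [/cube_sub].
have Gout n y : `|r| + 1 < `|y| -> G n y = 0.
  move=> hy; rewrite /G (@eq_Rintegral _ _ _ _ _ (cst 0)) ?Rintegral_cst ?mul0r// => x _.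
  rewrite /iB indicE; have [xB|xB] := pselect (B x); last by rewrite memNset// mul0r.
  rewrite (@cbump_out _ _ (del n)) ?mulr0// (le_lt_trans (del1 n))//.
  have := ler_normB x (x - y); rewrite subKr => h.
  have := Bball x xB; lra.
have zero n : \int[mu]_y (w y * G n y) = 0.
  have -> : \int[mu]_y (w y * G n y) = \int[mu]_y \int[mu]_x (w y * (iB x * cbump (del n) (x - y))).
    by apply: eq_Rintegral => y _; rewrite RintegralZl.
  have mf : measurable_fun setT (fun z : V * V => w z.1 * (iB z.2 * cbump (del n) (z.2 - z.1))).
    by meas.
  have bound (x y : V) : `|w y * (iB x * cbump (del n) (x - y))| = `|w y| * (iB x * cbump (del n) (x - y)).
    by rewrite normrM [X in _ * X]ger0_norm// mulr_ge0.
  have [M bM] := cbump_bump (d := d) (del0 n).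
  have M0 : 0 <= M by rewrite (le_trans _ (bump_bound bM 0)).
  have cbl (x : V) : cbump (del n) x <= M * \1_(ball 1) x.
    rewrite indicE; have [x1|x1] := leP `|x| 1.
      by rewrite mem_set// mulr1 (le_trans (ler_norm _))// (bump_bound bM).
    by rewrite (bump_supp bM) ?mulr_ge0// (le_lt_trans (del1 n)).
  rewrite (Rint_swap mf).
  - have mm : measurable_fun setT (mollify w (cbump (del n))).
      by rewrite /mollify; apply: measurable_Rint_snd; meas.
    have -> : \int[mu]_x (\int[mu]_y (w y * (iB x * cbump (del n) (x - y)))) =
        \int[mu]_x (iB x * mollify w (cbump (del n)) x).
      apply: eq_Rintegral => x _; have [xB|xB] := pselect (B x); last first.
        rewrite {2}/iB indicE memNset// mul0r (@eq_Rintegral _ _ _ _ _ (cst 0)) ?Rintegral_cst ?mul0r// => y _.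
        by rewrite /iB indicE memNset// mul0r mulr0.
      rewrite {2}/iB indicE mem_set// mul1r; apply: eq_Rintegral => y _.
      by rewrite /iB indicE mem_set// mul1r.
    rewrite /Rintegral (ae_eq_integral (cst 0%E)) ?integral0//.
      by apply/measurable_EFinP; exact: measurable_funM.
    by apply: filterS (hw n) => x -> _; rewrite mulr0.
  - move=> y; under eq_integral do rewrite bound.
    by rewrite ge0_intZ//; [rewrite -Gfin -EFinM ltry|by meas|by move=> x; rewrite mulr_ge0].
  - move=> x; under eq_integral do rewrite bound.
    apply: (@le_lt_trans _ _ (\int[mu]_y (M * (`|w y| * \1_(ball (`|x| + 1)) y))%:E)%E).
      apply: ge0_intle; [by meas| |by move=> y; rewrite mulr_ge0// mulr_ge0|].
        by apply: measurable_funM => //; apply: measurable_funM; [meas|exact: measurable_indic].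
      move=> y; rewrite [leRHS]mulrCA ler_wpM2l//.
      have /andP[_ i1] := I01 x.
      apply: (@le_trans _ _ (cbump (del n) (x - y))); first by rewrite ler_piMl.
      apply: (le_trans (cbl _)); rewrite ler_wpM2l// !indicE.
      have [xy|xy] := leP `|x - y| 1; last by rewrite memNset//=; apply/negP; rewrite -ltNge.
      rewrite mem_set// mem_set//=; have := ler_normB x (x - y); rewrite subKr => h.
      by rewrite /ball /= (le_trans h)// lerD2l.
    rewrite ge0_intZ//.
    + by apply: lte_mul_pinfty; rewrite ?lee_fin//; exact: wloc.
    + by apply: measurable_funM; [meas|exact: measurable_indic].
  - apply: (@le_lt_trans _ _ (\int[mu]_y (c n * (`|w y| * \1_(ball (`|r| + 1)) y))%:E)%E).
      rewrite (eq_integral (fun y => (`|w y| * G n y)%:E)); last first.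
        move=> y _; under eq_integral do rewrite bound.
        by rewrite ge0_intZ//; [rewrite -Gfin -EFinM|by meas|by move=> x; rewrite mulr_ge0].
      have mGn := mG n.
      apply: ge0_intle; [by meas| |by move=> y; rewrite mulr_ge0//; have /andP[] := G01 n y|].
        by apply: measurable_funM => //; apply: measurable_funM; [meas|exact: measurable_indic].
      move=> y; rewrite mulrCA ler_wpM2l// indicE.
      have [yr|yr] := leP `|y| (`|r| + 1); first by rewrite mem_set// mulr1; have /andP[] := G01 n y.
      by rewrite Gout// mulr_ge0// ltW.
    rewrite ge0_intZ ?(ltW (c0 n))//.
    + by apply: lte_mul_pinfty; rewrite ?lee_fin ?(ltW (c0 n))//; exact: wloc.
    + by apply: measurable_funM; [meas|exact: measurable_indic].
have small (e : R) : 0 < e -> \forall n \near \oo, del n < e.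
  by move=> e0; apply: (cvgr_lt _ (@cvg_harmonic R)).
(* for large n the bump around y does not cross the boundary of B *)
have same y : \forall n \near \oo, forall z, cbump (del n) z != 0 -> iB (z + y) = iB y.
  have [yB|yB] := pselect (B y).
    have : \forall n \near \oo, forall i : 'I_d, del n < Num.min r (b ord0 i) - y ord0 i.
      apply: filter_forall => i; apply: small; rewrite subr_gt0 lt_min.
      by case: yB => /(_ i)/andP[_ ->] /(_ i) ->.
    apply: filterS => n hn z zn; rewrite /iB !indicE [y \in _]mem_set// mem_set//.
    have zi i := cbump_supp (del0 n) zn i.
    split => i; rewrite mxE; have := hn i; have /andP[z0 z1] := zi i;
      case: yB => /(_ i)/andP[h1 h2] /(_ i) h3; rewrite ltrBrDr lt_min => /andP[h4 h5].
      by apply/andP; split; lra.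
    by lra.
  have [[i yi]|[i yi]] : (exists i, y ord0 i < - r) \/ (exists i, r <= y ord0 i \/ b ord0 i <= y ord0 i).
  - apply: contrapT => /not_orP[/forallNP h1 /forallNP h2]; apply: yB; split => i.
      rewrite leNgt; apply/andP; split; first by apply/negP; exact: h1.
      by rewrite ltNge; apply/negP => h; apply: (h2 i); left.
    by rewrite ltNge; apply/negP => h; apply: (h2 i); right.
  - apply: filterS (small (- r - y ord0 i) _); last by rewrite subr_gt0.
    move=> n hn z zn; rewrite /iB !indicE [y \in _]memNset// memNset// => -[/(_ i)].
    by rewrite mxE => /andP[h _] _; have /andP[z0 z1] := cbump_supp (del0 n) zn i; lra.
  - apply: nearW => n z zn; rewrite /iB !indicE [y \in _]memNset// memNset// => -[/(_ i) + /(_ i)].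
    rewrite mxE => /andP[_ h1] h2; have /andP[z0 z1] := cbump_supp (del0 n) zn i.
    by case: yi; lra.
have lim y : G n y / c n @[n --> \oo] --> iB y.
  apply: cvg_near_cst; apply: filterS (same y) => n hn.
  have -> : G n y = c n * iB y; last by rewrite mulrC mulKf// gt_eqF.
  apply: EFin_inj; rewrite Gfin GE EFinM -cE muleC -ge0_intZ//.
  apply: eq_integral => z _; congr EFin.
  by have [->|/hn ->//] := eqVneq (cbump (del n) z) 0; rewrite !mulr0.
have mGn n := mG n.
have [|||||_ _] := @dominated_convergence _ _ R mu setT measurableT
  (fun n y => (w y * (G n y / c n))%:E) (fun y => (w y * iB y)%:E)
  (fun y => (`|w y| * \1_(ball (`|r| + 1)) y)%:E).
- move=> n; apply/measurable_EFinP; apply: measurable_funM => //.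
  by apply: measurable_funM.
- by apply/measurable_EFinP; exact: measurable_funM.
- apply: aeW => y _; apply: cvg_EFin; first exact: nearW.
  by apply: cvgM; [exact: cvg_cst|exact: lim].
- apply: (@integrable_absP _ _ _ mu (fun y => `|w y| * \1_(ball (`|r| + 1)) y)).
    by apply: measurable_funM; [meas|exact: measurable_indic].
  under eq_integral do rewrite ger0_norm ?mulr_ge0//.
  exact: wloc.
- apply: aeW => y n _; rewrite lee_fin normrM ler_wpM2l// indicE.
  have /andP[g0 g1] := G01 n y.
  rewrite ger0_norm ?divr_ge0 ?(ltW (c0 n))//.
  have [yr|yr] := leP `|y| (`|r| + 1); last by rewrite Gout// mul0r.
  by rewrite mem_set// ler_pdivrMr// mul1r.
have -> : [sequence (\int[mu]_y (w y * (G n y / c n))%:E)%E]_n = cst 0%E.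
  apply/funext => n /=.
  have ifn : mu.-integrable setT (EFin \o (fun y => w y * G n y)).
    apply: integrable_absP; first by meas.
    apply: (@le_lt_trans _ _ (\int[mu]_y (c n * (`|w y| * \1_(ball (`|r| + 1)) y))%:E)%E).
      apply: ge0_intle; [by meas| |by []|].
        by apply: measurable_funM => //; apply: measurable_funM; [meas|exact: measurable_indic].
      move=> y; have /andP[g0 g1] := G01 n y.
      rewrite normrM (ger0_norm g0) mulrCA ler_wpM2l// indicE.
      have [yr|yr] := leP `|y| (`|r| + 1); first by rewrite mem_set// mulr1.
      by rewrite Gout// mulr_ge0// ltW.
    rewrite ge0_intZ ?(ltW (c0 n))//.
    + by apply: lte_mul_pinfty; rewrite ?lee_fin ?(ltW (c0 n))//; exact: wloc.
    + by apply: measurable_funM; [meas|exact: measurable_indic].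
  under eq_integral do rewrite mulrA mulrC EFinM.
  rewrite integralZl//.
  by rewrite -(Rint_fin ifn) zero mule0.
move=> /(cvg_unique (@ereal_hausdorff R) (cvg_cst 0%E)) => h0.
rewrite integral_mkcond [RHS]h0; apply: eq_integral => y _.
rewrite patchE /iB indicE; case: ifPn => yB; first by rewrite mulr1.
by rewrite mulr0.
Qed.

End mollifier_injective.


(** * Uniqueness in terms of mollifications *)

Section homogeneous_uniqueness.
Context {R : realType} {d : nat}.
Notation V := 'rV[R]_d.
Notation mu := (@lebesgue_rV R d).
Notation leb := (@lebesgue_measure R).
Notation VR := (V * measurableTypeR R)%type.
Variables (a : R -> R) (D C : R) (K : V -> R).
Hypothesis kp : kernel_profile a D C K.
Notation om := (decay_weight a).
Notation far_mass := (far_mass K).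
Notation near_moment := (near_moment K).
Let om0 x : 0 <= om x := ltW (om_gt0 kp x).
Let mom : measurable_fun setT om := measurable_om kp.
Variables (T W : R) (w : V -> R -> R).
Hypothesis T0 : 0 < T.
Hypothesis mw : measurable_fun setT (fun z : VR => w z.1 z.2).
Hypothesis wW : forall t, (\int[mu]_y (`|w y t| * om y)%:E <= W%:E)%E.
Hypothesis wout : forall y t, ~~ (0 < t < T) -> w y t = 0.

Let mwt t : measurable_fun setT (w ^~ t).
Proof. exact: (measurableT_comp mw (pair2_measurable (t : measurableTypeR R))). Qed.

Let W0 : 0 <= W.
Proof. by rewrite -lee_fin (le_trans _ (wW 0))// int_ge0// => y; rewrite mulr_ge0. Qed.

Let wfin t : (\int[mu]_y (`|w y t| * om y)%:E < +oo)%E.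
Proof. by rewrite (le_lt_trans (wW t))// ltry. Qed.

(** Without the rate of the jumps longer than [e], what is left of the operator
    is the near part, small with [e], and minus the convolution with the far
    kernel, which is positive and can be estimated by absolute values. *)
Definition killed_op (psi : V -> R) (e : R) (z : V) : R :=
  nonlocal_op K psi z - far_mass e * psi z.

Section one_bump.
Variables (psi : V -> R) (r M : R).
Hypothesis bpsi : bump r M psi.
Let mpsi := bump_meas bpsi.
Let M0 : 0 <= M. Proof. by rewrite (le_trans _ (bump_bound bpsi 0)). Qed.

Lemma killed_opE e z : 0 < e -> e <= 1 ->
  killed_op psi e z = near_op K psi e z - far_convolution K psi e z.
Proof. by move=> e0 e1; rewrite /killed_op (nonlocal_split kp bpsi _ e0 e1); ring. Qed.

Lemma measurable_killed_op e : 0 < e -> e <= 1 -> measurable_fun setT (killed_op psi e).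
Proof.
move=> e0 e1; have mn := measurable_near_op kp bpsi e; have mf := measurable_far_conv kp bpsi e.
rewrite (_ : killed_op psi e = fun z => near_op K psi e z - far_convolution K psi e z); first by meas.
by apply/funext => z; rewrite killed_opE.
Qed.

Lemma killed_op_le_om e : 0 < e -> e <= 1 ->
  exists2 B, 0 <= B & forall z, `|killed_op psi e z| <= B * om z.
Proof.
move=> e0 e1; have [B1 B10 omB] := om_shift kp (r + 1).
have [B2 B20 fB] := far_conv_le_om kp bpsi e0.
have o0 := om_gt0 kp (0 : V).
have n0 := near_moment_ge0 kp e.
exists (M * near_moment e / om (0 : V) * B1 + B2).
  by rewrite addr_ge0 ?(ltW B20)// mulr_ge0 ?(ltW B10)// divr_ge0 ?mulr_ge0.
move=> z; rewrite killed_opE// (le_trans (ler_normB _ _))// mulrDl lerD//.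
  have [zr|zr] := leP `|z| (r + 1); last first.
    by rewrite (near_op_supp K bpsi)// normr0 !mulr_ge0 ?invr_ge0 ?(ltW B10)// ltW.
  apply: (le_trans (near_op_bound kp bpsi z e1)).
  rewrite -!mulrA ler_wpM2l// ler_peMr// mulrC ler_pdivlMr// mul1r.
  by apply: omB; rewrite sub0r normrN.
rewrite -lee_fin; apply: le_trans (fB z).
have mf := measurable_far kp e.
apply: (le_trans (abs_Rint_le mu _)); first by meas.
apply: ge0_intle; [by meas|by meas|by []|] => y.
by rewrite normrM ger0_norm// (far_ge0 kp)// ltW.
Qed.

Lemma mollify_bounded (g : V -> R) B x : measurable_fun setT g -> 0 <= B ->
  (forall z, `|g z| <= B * om z) ->
  exists2 A, 0 <= A & forall t, `|mollify (w ^~ t) g x| <= A.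
Proof.
move=> mg B0 gB; have [c gc] := om_le_shift kp x gB B0.
have c0 : 0 <= c.
  by have := le_trans (normr_ge0 _) (gc 0); rewrite pmulr_lge0// (om_gt0 kp).
exists (c * W); first by rewrite mulr_ge0.
move=> t; rewrite -lee_fin; have mt := mwt t.
apply: (le_trans (abs_Rint_le mu _)); first by meas.
apply: (@le_trans _ _ (\int[mu]_y (c * (`|w y t| * om y))%:E)%E).
  apply: ge0_intle; [by meas|by meas|by []|] => y.
  by rewrite normrM mulrCA ler_wpM2l.
rewrite ge0_intZ//; [|by meas|by move=> y; rewrite mulr_ge0].
by rewrite EFinM lee_wpmul2l// lee_fin.
Qed.

Lemma measurable_mollify_joint (g : V -> R) : measurable_fun setT g ->
  measurable_fun setT (fun z : VR => mollify (w ^~ z.2) g z.1).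
Proof.
move=> mg; apply: (measurable_Rint_snd mu
  (f := fun (z : VR) (y : V) => w y z.2 * g (z.1 - y))).
apply: measurable_funM.
  apply: (measurableT_comp mw (g := fun p : VR * V => (p.2, p.1.2))).
  by apply: measurable_fun_pair => //; exact: measurableT_comp.
apply: (measurableT_comp mg); apply: measurable_rVB => //.
exact: measurableT_comp.
Qed.

Lemma mollify_out (g : V -> R) x t : ~~ (0 < t < T) -> mollify (w ^~ t) g x = 0.
Proof.
move=> ht; rewrite /mollify (@eq_Rintegral _ _ _ _ _ (cst 0)) ?Rintegral_cst ?mul0r//.
by move=> y _; rewrite wout// mul0r.
Qed.

Variables (s sg : R -> R) (S : R).
Hypothesis step : smooth_step s sg S.
Hypothesis weak : forall e x al b et, 0 < e -> e <= 1 ->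
  0 < al -> al < b -> 0 < et -> b + et < T ->
  \int[leb]_t ((sg ((t - al) / et) / et - sg ((t - b) / et) / et) *
    (expR (far_mass e * t) * mollify (w ^~ t) psi x)) =
  \int[leb]_t ((s ((t - al) / et) - s ((t - b) / et)) *
    (expR (far_mass e * t) * mollify (w ^~ t) (killed_op psi e) x)).
Hypothesis trace : forall x e, 0 < e -> exists2 tau : R, 0 < tau &
  {ae leb, forall t, 0 < t < tau -> `|mollify (w ^~ t) psi x| <= e}.
Variables (rho : V -> R) (r0 Mr : R).
Hypothesis brho : bump r0 Mr rho.
Hypothesis rho0 : forall x, 0 <= rho x.
Hypothesis rho_pos : (0 < \int[mu]_x (rho x)%:E)%E.
Notation Om := (Om a rho).

Lemma far_mass_ge0 e : 0 < e -> 0 <= far_mass e.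
Proof. by move=> e0; apply/fine_ge0/int_ge0 => y; rewrite (far_ge0 kp)// ltW. Qed.

Lemma pointwise_time_estimate e kap x : 0 < e -> e <= 1 -> 0 < kap ->
  (\int[leb]_t (expR (- kap * t) * `|mollify (w ^~ t) psi x|)%:E <=
   (kap + far_mass e)^-1%:E *
   \int[leb]_t (expR (- kap * t) * `|mollify (w ^~ t) (killed_op psi e) x|)%:E)%E.
Proof.
move=> e0 e1 k0.
have [B B0 pB] := bump_le_om kp bpsi.
have mk := measurable_killed_op e0 e1.
have [B' B'0 kB] := killed_op_le_om e0 e1.
have [A A0 hA] := mollify_bounded x mpsi (ltW B0) pB.
have [A' A'0 hA'] := mollify_bounded x mk B'0 kB.
apply: (time_estimate step (T := T) (lam := far_mass e) (M := A + A')
  (h := fun t => mollify (w ^~ t) psi x)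
  (be := fun t => mollify (w ^~ t) (killed_op psi e) x)).
- exact: T0.
- exact: far_mass_ge0.
- exact: (measurableT_comp (measurable_mollify_joint mpsi) (pair1_measurable x)).
- exact: (measurableT_comp (measurable_mollify_joint mk) (pair1_measurable x)).
- by move=> t; rewrite (le_trans (hA t))// lerDl.
- by move=> t; rewrite (le_trans (hA' t))// lerDr.
- by move=> t; exact: mollify_out.
- by move=> t; exact: mollify_out.
- by move=> al b et al0 alb et0 bT; exact: weak.
- exact: trace.
- exact: k0.
Qed.

(** Let [J] be the integral of [Om e^(-kap t) |h|], with [h] the mollification.
    The time and space estimates give
    [(kap + far_mass e) J <= c near_moment e W T + (far_mass e + C1) J].
    Since [kap = C1 + 1], the unbounded [far_mass e] cancels and [J] is at most
    [c near_moment e W T], for every [e]. *)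
Lemma mollify_ae0 : {ae leb, forall t, {ae mu, forall x, mollify (w ^~ t) psi x = 0}}.
Proof.
have [c [C1 [c0 C10 SE]]] := space_estimate kp bpsi brho rho0 rho_pos.
have [BO BO0 OB] := Om_le kp brho rho0.
have [bO bO0 Ob] := Om_ge kp brho rho0 rho_pos.
have mOm := measurable_Om kp brho.
have Om0 := Om_ge0 kp rho0.
(* any exponent larger than C1 leaves a positive multiple of J *)
pose kap := C1 + 1.
have kap0 : 0 < kap by rewrite addr_gt0.
pose h x t := mollify (w ^~ t) psi x.
have mh : measurable_fun setT (fun z : VR => h z.1 z.2) := measurable_mollify_joint mpsi.
pose J t : \bar R := (\int[mu]_x (Om x * `|h x t|)%:E)%E.
have mhx x : measurable_fun setT (fun t : measurableTypeR R => h x t).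
  exact: (measurableT_comp mh (pair1_measurable x)).
have mht t : measurable_fun setT (h ^~ t).
  exact: (measurableT_comp mh (pair2_measurable (t : measurableTypeR R))).
have mexp : measurable_fun setT (fun t : R => expR (- kap * t)).
  by apply: measurableT_comp => //; meas.
pose ind (t : R) : R := \1_(`]0, T[%classic) t.
have mind : measurable_fun setT ind by exact: measurable_indic.
have ind0 t : 0 <= ind t by rewrite /ind indicE.
have mwt' := mwt.
(* finiteness of the integral is needed to subtract it from both sides *)
have Jfin : exists2 Q : R, 0 <= Q & forall t, (J t <= (Q * ind t)%:E)%E.
  have [B B0 LB] := local_convolution kp r.
  exists (BO * (M * B) * W); first by rewrite !mulr_ge0// ltW.
  move=> t; rewrite /ind indicE; have [tT|tT] := boolP (0 < t < T); last first.
    rewrite /J integral0_eq; last by move=> x _; rewrite /h mollify_out// normr0 mulr0.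
    by rewrite lee_fin !mulr_ge0// ltW.
  rewrite mem_set/= ?in_itv// mulr1.
  pose v y := w y t; have mv : measurable_fun setT v := mwt' t.
  have hle x : ((`|h x t|)%:E <= \int[mu]_y (`|v y| * `|psi (x - y)|)%:E)%E.
    apply: (le_trans (abs_Rint_le mu _)); first by rewrite -/(v _); meas.
    by apply: ge0_le_integral => //; [rewrite -/(v _); meas|meas|move=> y _; rewrite normrM].
  apply: (@le_trans _ _ (\int[mu]_x \int[mu]_y (Om x * (`|v y| * `|psi (x - y)|))%:E)%E).
    apply: ge0_le_integral => //.
    - by move=> x _; rewrite lee_fin mulr_ge0.
    - by have := mht t => mh'; meas.
    - apply: measurable_int_snd; first by meas.
      by move=> x y; rewrite lee_fin !mulr_ge0.
    - move=> x _; rewrite ge0_intZ//; last by meas.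
      by rewrite EFinM lee_wpmul2l// lee_fin.
  rewrite tonelli_swap; [|by meas|by move=> x y; rewrite lee_fin !mulr_ge0].
  have wWt : (\int[mu]_y (`|v y| * om y)%:E <= W%:E)%E := wW t.
  apply: (@le_trans _ _ (\int[mu]_y ((BO * (M * B)) * (`|v y| * om y))%:E)%E); last first.
    rewrite ge0_intZ; [|by rewrite !mulr_ge0// ltW|by meas|by move=> y; rewrite mulr_ge0].
    by rewrite [(_ * W)%:E]EFinM lee_wpmul2l// lee_fin !mulr_ge0// ltW.
  apply: ge0_le_integral => //.
  - by move=> y _; apply: int_ge0 => x; rewrite !mulr_ge0.
  - apply: measurable_int_fst; first by meas.
    by move=> x y; rewrite lee_fin !mulr_ge0.
  - by meas.
  - move=> y _; have [_ h2] := LB psi M y mpsi (bump_bound bpsi) (bump_supp bpsi).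
    apply: (@le_trans _ _ (\int[mu]_x ((BO * `|v y|) * (om x * `|psi (x - y)|))%:E)%E).
      apply: ge0_intle; [by meas|by meas|by move=> x; rewrite !mulr_ge0|] => x.
      have := OB x; have := normr_ge0 (psi (x - y)); have := normr_ge0 (w y t).
      move: (`|v y|) (`|psi (x - y)|) => p q p0 q0 OBx.
      rewrite (_ : BO * p * (om x * q) = BO * om x * (p * q)); last by ring.
      by rewrite ler_wpM2r// mulr_ge0.
    rewrite ge0_intZ; [|by rewrite mulr_ge0// ltW|by meas|by move=> x; rewrite mulr_ge0].
    apply: (@le_trans _ _ ((BO * `|v y|)%:E * (M * B * om y)%:E)%E).
      by rewrite lee_wpmul2l// lee_fin mulr_ge0// ltW.
    by rewrite -EFinM lee_fin le_eqVlt; apply/orP; left; apply/eqP; ring.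
have [Q Q0 JQ] := Jfin.
have mh' : measurable_fun setT (fun z : measurableTypeR R * V => h z.2 z.1).
  by apply: (measurableT_comp mh (g := fun z : measurableTypeR R * V => (z.2, z.1))); apply: measurable_fun_pair.
have mJ : measurable_fun setT (J : measurableTypeR R -> \bar R).
  rewrite /J; apply: (measurable_int_snd mu (f := fun (t : measurableTypeR R) x => (Om x * `|h x t|)%:E)).
    by meas.
  by move=> t x; rewrite lee_fin mulr_ge0.
have J0 t : (0 <= J t)%E by apply: int_ge0 => x; rewrite mulr_ge0.
have JE : J = fun t => (\int[mu]_x (Om x * `|h x t|)%:E)%E by [].
clearbody J.
have e0' t : 0 <= expR (- kap * t) by exact: expR_ge0.
have eind t : expR (- kap * t) * ind t <= ind t.
  rewrite /ind indicE; have [tT|tT] := pselect (`]0, T[%classic t); last by rewrite memNset// mulr0.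
  rewrite mem_set// mulr1 expR_le1//; move: tT; rewrite /= in_itv/= => /andP[t0 _].
  by rewrite mulNr oppr_le0 mulr_ge0// ltW.
have intind : (\int[leb]_t (ind t)%:E = T%:E)%E.
  by rewrite /ind integral_indic_itv// subr0.
pose JJ := (\int[leb]_t ((expR (- kap * t))%:E * J t))%E.
have ejind (A : R) : 0 <= A -> (\int[leb]_t ((expR (- kap * t))%:E * (A * ind t)%:E) <= (A * T)%:E)%E.
  move=> A0; rewrite EFinM -intind -ge0_intZ//.
  apply: ge0_le_integral => //.
  - by move=> t _; rewrite -EFinM lee_fin !mulr_ge0.
  - by apply: emeasurable_funM; apply/measurable_EFinP => //; exact: measurable_funM.
  - by apply/measurable_EFinP; exact: measurable_funM.
  - by move=> t _; rewrite -EFinM lee_fin mulrCA ler_wpM2l.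
have JJfin : JJ \is a fin_num.
  rewrite ge0_fin_numE; last by apply: integral_ge0 => t _; rewrite mule_ge0// lee_fin.
  apply: (@le_lt_trans _ _ (Q * T)%:E); last by rewrite ltry.
  apply: le_trans (ejind Q Q0); apply: ge0_le_integral => //.
  - by move=> t _; rewrite mule_ge0// lee_fin.
  - by apply: emeasurable_funM => //; apply/measurable_EFinP.
  - by apply: emeasurable_funM; apply/measurable_EFinP => //; exact: measurable_funM.
  - by move=> t _; rewrite lee_wpmul2l// lee_fin.
(* the inequality of the two estimates, solved for the integral *)
have JJ_le e : 0 < e -> e <= 1 -> (JJ <= (c * near_moment e * W * T)%:E)%E.
  move=> e0 e1; have fm0 := far_mass_ge0 e0.
  pose be x t := mollify (w ^~ t) (killed_op psi e) x.
  have mk := measurable_killed_op e0 e1.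
  have mbe : measurable_fun setT (fun z : VR => be z.1 z.2) := measurable_mollify_joint mk.
  have mbex x : measurable_fun setT (fun t : measurableTypeR R => be x t).
    exact: (measurableT_comp mbe (pair1_measurable x)).
  have mbet t : measurable_fun setT (be ^~ t).
    exact: (measurableT_comp mbe (pair2_measurable (t : measurableTypeR R))).
  have swap (k : V -> R -> R) : measurable_fun setT (fun z : VR => k z.1 z.2) ->
     (\int[leb]_t ((expR (- kap * t))%:E * \int[mu]_x (Om x * `|k x t|)%:E) =
      \int[mu]_x ((Om x)%:E * \int[leb]_t (expR (- kap * t) * `|k x t|)%:E))%E.
    move=> mk'.
    have mkx x : measurable_fun setT (fun t : measurableTypeR R => k x t).
      exact: (measurableT_comp mk' (pair1_measurable x)).
    have mkt t : measurable_fun setT (k ^~ t).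
      exact: (measurableT_comp mk' (pair2_measurable (t : measurableTypeR R))).
    transitivity (\int[leb]_t \int[mu]_x (Om x * (expR (- kap * t) * `|k x t|))%:E)%E.
      apply: eq_integral => t _.
      have mkt' := measurableT_comp (@normr_measurable R setT) (mkt t).
      rewrite -ge0_intZ; [|by []|exact: measurable_funM|by move=> x; rewrite mulr_ge0].
      by apply: eq_integral => x _; congr EFin; ring.
    rewrite -(tonelli_swap mu leb (f := fun x (t : measurableTypeR R) => (Om x * (expR (- kap * t) * `|k x t|))%:E)).
    - apply: eq_integral => x _.
      have mkx' := measurableT_comp (@normr_measurable R setT) (mkx x).
      by rewrite ge0_intZ; [|by []|exact: measurable_funM|by move=> t; rewrite mulr_ge0].
    - apply/measurable_EFinP; apply: measurable_funM; first exact: (measurableT_comp mOm).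
      apply: measurable_funM; first exact: (measurableT_comp mexp).
      exact: (measurableT_comp (@normr_measurable R setT) mk').
    - by move=> x t; rewrite lee_fin !mulr_ge0.
  pose q := kap + far_mass e; have q0 : 0 < q by rewrite ltr_wpDr.
  have iq0 : 0 <= q^-1 by rewrite invr_ge0 ltW.
  pose J2 t : \bar R := (\int[mu]_x (Om x * `|be x t|)%:E)%E.
  have J20 t : (0 <= J2 t)%E by apply: int_ge0 => x; rewrite mulr_ge0.
  have mbe' : measurable_fun setT (fun z : measurableTypeR R * V => be z.2 z.1).
    by apply: (measurableT_comp mbe (g := fun z : measurableTypeR R * V => (z.2, z.1))); apply: measurable_fun_pair.
  have mJ2 : measurable_fun setT (J2 : measurableTypeR R -> \bar R).
    rewrite /J2; apply: (measurable_int_snd mu (f := fun (t : measurableTypeR R) x => (Om x * `|be x t|)%:E)).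
      by meas.
    by move=> t x; rewrite lee_fin mulr_ge0.
  have J2E : J2 = fun t => (\int[mu]_x (Om x * `|be x t|)%:E)%E by [].
  clearbody J2.
  have step1 : (JJ <= q^-1%:E * \int[leb]_t ((expR (- kap * t))%:E * J2 t))%E.
    rewrite /JJ JE J2E (swap h mh) (swap be mbe).
    have mint (k : V -> R -> R) : measurable_fun setT (fun z : VR => k z.1 z.2) ->
        measurable_fun setT (fun x => \int[leb]_t (expR (- kap * t) * `|k x t|)%:E)%E.
      move=> mk'; apply: (measurable_int_snd leb (f := fun x (t : measurableTypeR R) => (expR (- kap * t) * `|k x t|)%:E)).
        apply/measurable_EFinP; apply: measurable_funM; first exact: (measurableT_comp mexp).
        exact: (measurableT_comp (@normr_measurable R setT) mk').
      by move=> x t; rewrite lee_fin mulr_ge0.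
    have i0 (k : V -> R -> R) x : (0 <= \int[leb]_t (expR (- kap * t) * `|k x t|)%:E)%E.
      by apply: int_ge0 => t; rewrite mulr_ge0.
    rewrite -ge0_integralZl//; last 2 first.
    + by apply: emeasurable_funM; [apply/measurable_EFinP|exact: mint].
    + by move=> x _; rewrite mule_ge0 ?lee_fin.
    apply: ge0_le_integral => //.
    + by move=> x _; rewrite mule_ge0 ?lee_fin.
    + by apply: emeasurable_funM; [apply/measurable_EFinP|exact: mint].
    + apply: emeasurable_funM => //; apply: emeasurable_funM; [by apply/measurable_EFinP|exact: mint].
    + move=> x _; rewrite muleCA lee_wpmul2l ?lee_fin//.
      exact: pointwise_time_estimate.
  have J2le t : (J2 t <= (c * near_moment e * W * ind t)%:E + (far_mass e + C1)%:E * J t)%E.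
    have := SE (w ^~ t) (W * ind t) e (mwt t) _ e0 e1.
    rewrite JE J2E -[c * near_moment e * W * ind t]mulrA; apply.
    rewrite /ind indicE; have [tT|tT] := boolP (0 < t < T).
      by rewrite mem_set/= ?in_itv// mulr1.
    rewrite integral0_eq ?lee_fin ?mulr_ge0// => y _.
    by rewrite wout// normr0 mul0r.
  have A0 : 0 <= c * near_moment e * W.
    by rewrite !mulr_ge0// (near_moment_ge0 kp).
  have Ai0 t : 0 <= c * near_moment e * W * ind t by rewrite mulr_ge0.
  have fc0 : 0 <= far_mass e + C1 by rewrite addr_ge0// ltW.
  have step2 : (\int[leb]_t ((expR (- kap * t))%:E * J2 t) <=
     (c * near_moment e * W * T)%:E + (far_mass e + C1)%:E * JJ)%E.
    apply: (@le_trans _ _ (\int[leb]_t ((expR (- kap * t))%:E * (c * near_moment e * W * ind t)%:E +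
       (far_mass e + C1)%:E * ((expR (- kap * t))%:E * J t))))%E.
      apply: ge0_le_integral => //.
      - by move=> t _; rewrite mule_ge0 ?lee_fin.
      - by apply: emeasurable_funM => //; apply/measurable_EFinP.
      - apply: emeasurable_funD.
          by apply: emeasurable_funM; apply/measurable_EFinP => //; exact: measurable_funM.
        by apply: emeasurable_funM => //; apply: emeasurable_funM => //; apply/measurable_EFinP.
      - move=> t _; apply: (le_trans (lee_wpmul2l _ (J2le t))); first by rewrite lee_fin.
        rewrite ge0_muleDr ?lee_fin ?Ai0//; last by rewrite mule_ge0 ?lee_fin.
        by rewrite [X in (_ + X <= _)%E]muleCA.
    rewrite ge0_integralD//; last 4 first.
    - by move=> t _; rewrite mule_ge0 ?lee_fin ?Ai0.
    - by apply: emeasurable_funM; apply/measurable_EFinP => //; exact: measurable_funM.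
    - by move=> t _; rewrite !mule_ge0 ?lee_fin.
    - by apply: emeasurable_funM => //; apply: emeasurable_funM => //; apply/measurable_EFinP.
    rewrite leeD ?ejind// ge0_integralZl//.
    - by apply: emeasurable_funM => //; apply/measurable_EFinP.
    - by move=> t _; rewrite mule_ge0 ?lee_fin.
  have := le_trans step1 (lee_wpmul2l _ step2); rewrite lee_fin => /(_ iq0).
  have [j ->] : exists j, JJ = j%:E by exists (fine JJ); rewrite fineK.
  rewrite -[((far_mass e + C1)%:E * j%:E)%E]EFinM -[(_ + _)%E]EFinD -EFinM !lee_fin.
  rewrite mulrC ler_pdivlMr// /q /kap => hj.
  by move: hj; lra.
have JJ0 : JJ = 0%E.
  have jj0 : 0 <= fine JJ by apply/fine_ge0/integral_ge0 => t _; rewrite mule_ge0 ?lee_fin.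
  rewrite -(fineK JJfin); congr EFin; apply/eqP; rewrite eq_le jj0 andbT leNgt; apply/negP => jpos.
  pose A := c * W * T; have A0 : 0 <= A by rewrite !mulr_ge0// ltW.
  have := near_moment_cvg0 kp => /cvgr0Pnorm_lt /(_ (fine JJ / (A + 1))).
  have A1 : 0 < A + 1 by rewrite ltr_wpDl.
  rewrite divr_gt0// => /(_ isT) [n _ /(_ n (leqnn n)) /=].
  have n0 : 0 < (n.+1%:R^-1 : R) by rewrite invr_gt0.
  have n1 : (n.+1%:R^-1 : R) <= 1 by rewrite invf_le1 ?ler1n.
  have := JJ_le _ n0 n1; rewrite -(fineK JJfin) lee_fin => h1.
  rewrite ger0_norm ?(near_moment_ge0 kp)// ltr_pdivlMr// => h2.
  have h3 : fine JJ <= A * near_moment n.+1%:R^-1 by rewrite (le_trans h1)// /A le_eqVlt; apply/orP; left; apply/eqP; ring.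
  have := near_moment_ge0 kp n.+1%:R^-1; move: h2 h3; move: (near_moment _) (fine JJ) A0 => p j A0 /=.
  by nra.
have mEJ : measurable_fun setT (fun t : measurableTypeR R => (expR (- kap * t))%:E * J t)%E.
  by apply: emeasurable_funM => //; apply/measurable_EFinP.
have habs : (\int[leb]_t `|(expR (- kap * t))%:E * J t| = 0)%E.
  rewrite -JJ0; apply: eq_integral => t _.
  by rewrite gee0_abs// mule_ge0 ?lee_fin.
have [+ _] := ae_eq_integral_abs leb measurableT mEJ.
move=> /(_ habs); apply: aeS => t /(_ Logic.I) /= /eqP.
rewrite mule_eq0 eqe gt_eqF ?expR_gt0//= => /eqP Jt0.
have mOh : measurable_fun setT (fun x => (Om x * `|h x t|)%:E).
  apply/measurable_EFinP; apply: measurable_funM => //.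
  exact: (measurableT_comp (@normr_measurable R setT) (mht t)).
have [+ _] := ae_eq_integral_abs mu measurableT mOh.
have -> : (\int[mu]_x `|(Om x * `|h x t|)%:E| = 0)%E.
  by rewrite -Jt0 JE; apply: eq_integral => x _; rewrite gee0_abs// lee_fin mulr_ge0.
move=> /(_ erefl); apply: filterS => x /(_ Logic.I) /= [] /eqP.
rewrite mulf_eq0 gt_eqF/=; last by rewrite (lt_le_trans _ (Ob x))// mulr_gt0// (om_gt0 kp).
by rewrite normr_eq0 => /eqP.
Qed.

End one_bump.

Hypothesis weak : forall del e x al b et, 0 < del -> 0 < e -> e <= 1 ->
  0 < al -> al < b -> 0 < et -> b + et < T ->
  \int[leb]_t ((dustep ((t - al) / et) / et - dustep ((t - b) / et) / et) *
    (expR (far_mass e * t) * mollify (w ^~ t) (cbump del) x)) =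
  \int[leb]_t ((ustep ((t - al) / et) - ustep ((t - b) / et)) *
    (expR (far_mass e * t) * mollify (w ^~ t) (killed_op (cbump del) e) x)).
Hypothesis trace : forall del x e, 0 < del -> 0 < e -> exists2 tau : R, 0 < tau &
  {ae leb, forall t, 0 < t < tau -> `|mollify (w ^~ t) (cbump del) x| <= e}.

Lemma homogeneous_uniqueness : {ae leb, forall t, {ae mu, forall y, w y t = 0}}.
Proof.
have [S step] := @ustep_smooth_step R.
have [Mr brho] := @cbump_bump R d 1 ltr01.
have H n : {ae leb, forall t, {ae mu, forall x, mollify (w ^~ t) (cbump n.+1%:R^-1) x = 0}}.
  have n0 : 0 < (n.+1%:R^-1 : R) by rewrite invr_gt0.
  have [M bpsi] := @cbump_bump R d _ n0.
  apply: (mollify_ae0 bpsi step _ _ brho).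
  - by move=> e x al b et; exact: weak.
  - by move=> x e; exact: trace.
  - by move=> x; exact: cbump_ge0.
  - exact: integral_cbump_gt0.
have := ae_foralln H; apply: aeS => t Ht.
apply: (mollify_injective (mwt t) _ Ht).
move=> r; have [B B0 omB] := om_shift kp r.
have o0 := om_gt0 kp (0 : V).
have mt := mwt t.
have mball : measurable [set y : V | `|y| <= r] by exact: measurable_rV_ball.
apply: (@le_lt_trans _ _ (\int[mu]_y ((B / om (0 : V)) * (`|w y t| * om y))%:E)%E).
  apply: ge0_intle; [| |by move=> y; rewrite mulr_ge0|].
  - by apply: measurable_funM; [meas|exact: measurable_indic].
  - by meas.
  - move=> y; rewrite mulrCA ler_wpM2l// indicE.
    have [yr|yr] := leP `|y| r; last first.
      rewrite memNset; last by apply/negP; rewrite -ltNge.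
      by rewrite !mulr_ge0 ?invr_ge0// ltW.
    rewrite mem_set// mulrAC ler_pdivlMr// mul1r.
    by apply: omB; rewrite sub0r normrN.
rewrite ge0_intZ; [|by rewrite divr_ge0// ltW|by meas|by move=> y; rewrite mulr_ge0].
by rewrite lte_mul_pinfty ?lee_fin ?divr_ge0 ?(ltW B0).
Qed.

End homogeneous_uniqueness.


(** * Test functions in the equation *)

Section space_time.
Context {R : realType} {d : nat}.
Notation V := 'rV[R]_d.
Notation mu := (@lebesgue_rV R d).
Notation leb := (@lebesgue_measure R).
Notation VR := (V * measurableTypeR R)%type.

Lemma cylinder_measurable (T : R) : measurable (cylinder T : set VR).
Proof. by apply: measurableX => //; exact: measurable_itv. Qed.

Lemma ae_time_slices (Q : R -> Prop) : {ae leb, forall t, Q t} ->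
  {ae (@lebesgue_xt R d), forall z : VR, Q z.2}.
Proof.
move=> [N [mN N0 QN]]; exists ([set: V] `*` N); split.
- exact: measurableX.
- have -> : lebesgue_xt ([set: V] `*` N) = (mu [set: V] * leb N)%E.
    exact: product_measure1E.
  by rewrite N0 mule0.
- by move=> [x t] /= h; split => //=; apply: QN.
Qed.

Lemma ae_xt_zero (w : V -> R -> R) : measurable_fun setT (fun z : VR => w z.1 z.2) ->
  {ae leb, forall t, {ae mu, forall y, w y t = 0}} ->
  {ae (@lebesgue_xt R d), forall z : VR, w z.1 z.2 = 0}.
Proof.
move=> mw h.
have mE : measurable_fun setT (fun z : VR => (`|w z.1 z.2|)%:E).
  by apply/measurable_EFinP; exact: (measurableT_comp (@normr_measurable R setT) mw).
have [+ _] := ae_eq_integral_abs (@lebesgue_xt R d) measurableT mE.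
have -> : (\int[@lebesgue_xt R d]_z `|(`|w z.1 z.2|)%:E| = 0)%E.
  under eq_integral do rewrite abse_EFin normr_id.
  rewrite /lebesgue_xt (tonelli_prod mu leb (f := fun y (t : measurableTypeR R) => (`|w y t|)%:E))//.
  rewrite (tonelli_swap mu leb (f := fun y (t : measurableTypeR R) => (`|w y t|)%:E))//.
  have mi : measurable_fun setT (fun t : measurableTypeR R => \int[mu]_y (`|w y t|)%:E)%E.
    by apply: (measurable_int_fst mu (f := fun y (t : measurableTypeR R) => (`|w y t|)%:E)).
  rewrite (ae_eq_integral (cst 0%E)) ?integral0//.
  apply: aeS h => t ht _ /=.
  have mt : measurable_fun setT (fun y => (`|w y t|)%:E).
    exact: (measurableT_comp mE (pair2_measurable (t : measurableTypeR R))).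
  rewrite (ae_eq_integral (cst 0%E)) ?integral0//.
  by apply: filterS ht => y -> _; rewrite normr0.
move=> /(_ erefl); case=> N [mN N0 hN]; exists N; split => // z hz; apply: hN => /= hz'.
by apply: hz; have [] := hz' Logic.I => /eqP; rewrite normr_eq0 => /eqP.
Qed.

End space_time.

Section time_coefficients.
Context {R : realType}.
Notation leb := (@lebesgue_measure R).
Variables (T al b et lam : R).
Hypothesis al0 : 0 < al.
Hypothesis alb : al < b.
Hypothesis et0 : 0 < et.
Hypothesis bT : b + et < T.
Hypothesis lam0 : 0 <= lam.

(** [coef2] is the time factor of the test function and [coef1] is
    [e^(lam t)] times the derivative of the cutoff, so that the time derivative
    is [lam coef2 + coef1]. *)
Definition coef1 (t : R) : R :=
  (dustep ((t - al) / et) / et - dustep ((t - b) / et) / et) * expR (lam * t).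
Definition coef2 (t : R) : R :=
  (ustep ((t - al) / et) - ustep ((t - b) / et)) * expR (lam * t).

Lemma coefs_bounded : exists2 A : R, 0 <= A &
  forall t, `|coef1 t| <= A * \1_(`]0, T[%classic) t /\
            `|coef2 t| <= A * \1_(`]0, T[%classic) t.
Proof.
have [S st] := @ustep_smooth_step R.
have S0 : 0 <= S by rewrite (le_trans (step_dge0 st 0))// (step_dbound st).
exists ((S / et + S / et + 2) * expR (lam * T)).
  by rewrite mulr_ge0 ?expR_ge0// !addr_ge0// divr_ge0// ltW.
have dz u : ~~ (0 < u < T) -> dustep ((u - al) / et) = 0 /\ dustep ((u - b) / et) = 0.
  move=> h; split; apply: (step_dout st); apply: contra h => /andP[];
    rewrite pmulr_lgt0 ?invr_gt0// ltr_pdivrMr// mul1r => h1 h2; apply/andP; split;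
    by move: h1 h2 al0 alb et0 bT; lra.
have sz u : ~~ (0 < u < T) -> ustep ((u - al) / et) - ustep ((u - b) / et) = 0.
  rewrite negb_and -!leNgt => /orP[h|h].
    by rewrite !(step_0 st) ?subrr// pmulr_lle0 ?invr_gt0//; move: h al0 alb; lra.
  by rewrite !(step_1 st) ?subrr// ler_pdivlMr//; move: h al0 alb et0 bT; lra.
move=> t; rewrite indicE /coef1 /coef2; have [tT|tT] := boolP (0 < t < T); last first.
  have [-> ->] := dz t tT; rewrite sz// mul0r subrr !mul0r normr0.
  by split; rewrite mulr_ge0// mulr_ge0 ?expR_ge0// !addr_ge0// divr_ge0// ltW.
rewrite mem_set/= ?in_itv// mulr1.
have /andP[t0 tT'] := tT.
have eT : expR (lam * t) <= expR (lam * T) by rewrite ler_expR ler_wpM2l// ltW.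
have d1 u : `|dustep u / et| <= S / et.
  rewrite ger0_norm; last by rewrite divr_ge0 ?(ltW et0)//; exact: step_dge0 st u.
  by rewrite ler_pM2r ?invr_gt0//; exact: step_dbound st u.
have Se : 0 <= S / et by rewrite divr_ge0// ltW.
split; rewrite normrM [X in _ * X]ger0_norm ?expR_ge0// ler_pM ?expR_ge0//.
  by rewrite (le_trans (ler_normB _ _))// ler_wpDr// lerD.
have /andP[u0 u1] := step_01 st ((t - al) / et).
have /andP[v0 v1] := step_01 st ((t - b) / et).
by rewrite ler_norml; lra.
Qed.

Let affine_meas (f : R -> R) c : measurable_fun setT f ->
  measurable_fun setT (fun t : R => f ((t - c) / et)).
Proof.
move=> mf; apply: (measurableT_comp mf).
by apply: measurable_funM => //; exact: measurable_funB.
Qed.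

Let mexp : measurable_fun setT (fun t : R => expR (lam * t)).
Proof. by apply: measurableT_comp => //; exact: measurable_funM. Qed.

Lemma measurable_coef1 : measurable_fun setT coef1.
Proof.
have [S st] := @ustep_smooth_step R; apply: measurable_funM => //.
by apply: measurable_funB; apply: measurable_funM => //; apply: affine_meas; exact: step_dmeas st.
Qed.

Lemma measurable_coef2 : measurable_fun setT coef2.
Proof.
have [S st] := @ustep_smooth_step R; apply: measurable_funM => //.
by apply: measurable_funB; apply: affine_meas; exact: step_meas st.
Qed.

Lemma derive_time_factor t :
  is_derive t (1 : R) (fun t => expR (lam * t) * (ustep ((t - al) / et) - ustep ((t - b) / et)))
    (lam * coef2 t + coef1 t).
Proof.
have dlin c : is_derive t (1 : R) (fun t : R => (t - c) / et) et^-1.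
  have -> : (fun t : R => (t - c) / et) = (fun t => et^-1 *: (t + (- c))).
    by apply/funext => y; rewrite mulrC.
  have h0 : is_derive t (1 : R) (fun t : R => et^-1 *: (t + (- c))) _ :=
    is_deriveZ et^-1 (is_deriveD (is_derive_id t (1 : R)) (is_derive_cst (- c) t (1 : R))).
  by apply: (is_derive_eq h0); rewrite addr0 /GRing.scale/= mulr1.
have ds c : is_derive t (1 : R) (fun t : R => ustep ((t - c) / et)) (dustep ((t - c) / et) / et).
  exact: (@is_derive1_comp R ustep (fun t => (t - c) / et) t _ _ (is_derive_ustep _) (dlin c)).
have de : is_derive t (1 : R) (fun t : R => expR (lam * t)) (expR (lam * t) * lam).
  have h := is_deriveZ lam (is_derive_id t (1 : R)).
  have h2 : is_derive t (1 : R) (fun t : R => lam * t) lam.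
    by apply: (is_derive_eq (h : is_derive t (1 : R) (fun t : R => lam * t) _)); rewrite /GRing.scale/= mulr1.
  exact: (@is_derive1_comp R expR (fun t => lam * t) t _ _ (is_derive_expR _) h2).
have h : is_derive t (1 : R) (fun t => expR (lam * t) *
    (ustep ((t - al) / et) - ustep ((t - b) / et))) _ := is_deriveM de (is_deriveB (ds al) (ds b)).
apply: (is_derive_eq h); rewrite /GRing.scale/= /coef1 /coef2.
have -> : ((fun t : R => ustep ((t - al) / et)) - (fun t : R => ustep ((t - b) / et))) t =
  ustep ((t - al) / et) - ustep ((t - b) / et) by [].
by ring.
Qed.

End time_coefficients.

Section test_function_equation.
Context {R : realType} {d : nat}.
Notation V := 'rV[R]_d.
Notation mu := (@lebesgue_rV R d).
Variables (a : R -> R) (D C : R) (K : V -> R).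
Hypothesis kp : kernel_profile a D C K.

Lemma time_derive_test_fun (del lam et al b : R) (x : V) (z : V * R) :
  time_derive (test_fun del lam et al b x) z =
  cbump del (x - z.1) * (lam * coef2 al b et lam z.2 + coef1 al b et lam z.2).
Proof.
rewrite /time_derive derive1E /test_fun /=.
have h := is_deriveZ (cbump del (x - z.1)) (derive_time_factor al b et lam z.2).
have [_] := (h : is_derive z.2 (1 : R) (fun t => cbump del (x - z.1) * (expR (lam * t) *
   (ustep ((t - al) / et) - ustep ((t - b) / et)))) _).
by move=> ->.
Qed.

Lemma nonlocal_test_fun (del lam et al b : R) (x : V) (z : V * R) : 0 < del ->
  nonlocal_op_x K (test_fun del lam et al b x) z =
  coef2 al b et lam z.2 * nonlocal_op K (cbump del) (x - z.1).
Proof.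
move=> del0; rewrite /nonlocal_op_x /nonlocal_op /test_fun /=.
have [M bM] := @cbump_bump R d _ del0.
have hi := nonlocal_integrable kp bM (x - z.1).
rewrite -RintegralZl//.
apply: eq_Rintegral => y _; rewrite /coef2.
rewrite (_ : x - (z.1 + y) = x - z.1 - y); last by rewrite opprD addrA.
rewrite (_ : x - (z.1 - y) = x - z.1 + y); last by rewrite opprB addrA addrAC.
by ring.
Qed.

End test_function_equation.


(** * Time slices of a solution *)

Section solution_slices.
Context {R : realType} {d : nat}.
Notation V := 'rV[R]_d.
Notation mu := (@lebesgue_rV R d).
Notation leb := (@lebesgue_measure R).
Notation VR := (V * measurableTypeR R)%type.
Variables (a : R -> R) (D C : R) (K : V -> R).
Hypothesis kp : kernel_profile a D C K.
Notation om := (decay_weight a).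
Let om0 x : 0 <= om x := ltW (om_gt0 kp x).
Let mom : measurable_fun setT om := measurable_om kp.
Variables (T : R) (u : VR -> R).
Notation cyl := (cylinder T : set VR).
Hypothesis mu_ : measurable_fun cyl u.

(** A representative of the solution [u] with bounds at every time: the null
    set of times at which the weighted norm is large is discarded, and the
    function is extended by 0 outside [(0, T)]. *)
Definition solution_slices (W : R) (w : V -> R -> R) : Prop :=
  [/\ measurable_fun setT (fun z : VR => w z.1 z.2),
      forall t, (\int[mu]_y (`|w y t| * om y)%:E <= W%:E)%E,
      forall y t, ~~ (0 < t < T) -> w y t = 0 &
      {ae leb, forall t, 0 < t < T -> forall y, w y t = u (y, t)}].

Lemma cyl_out (z : VR) : ~~ (0 < z.2 < T) -> (u \_ cyl) z = 0.
Proof.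
move=> zT; rewrite patchE; case: ifPn => //; rewrite inE => -[_ /=].
by rewrite in_itv/= (negbTE zT).
Qed.

Lemma cyl_in (z : VR) : 0 < z.2 < T -> (u \_ cyl) z = u z.
Proof. by move=> zT; rewrite patchE mem_set//; split => //=; rewrite in_itv. Qed.

Lemma ae_bound_of_ess_sup (f : R -> \bar R) :
  (ess_sup (mrestr leb (measurable_itv `]0%R, T[)) f < +oo)%E ->
  exists2 M : R, 0 <= M & {ae leb, forall t, 0 < t < T -> (f t <= M%:E)%E}.
Proof.
set m := mrestr _ _ => h.
have [M M0 hM] : exists2 M : R, 0 <= M & (ess_sup m f <= M%:E)%E.
  case: (ess_sup m f) h => [r _|//|_]; last by exists 0 => //; rewrite leNye.
  by exists (Num.max 0 r); rewrite ?lee_fin le_max lexx ?orbT.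
exists M => //; have /ess_supP [N [mN N0 hN]] := hM.
exists (N `&` `]0, T[%classic); split => //.
  exact: measurableI.
move=> t /= h'; have tT : 0 < t < T by apply: contrapT => ht; apply: h'.
split; last by rewrite in_itv.
by apply: hN => /= ht; apply: h'.
Qed.

Lemma slices_of_bound (Q : V -> R) (c : R) : 0 < c -> measurable_fun setT Q ->
  (forall x, c * om x <= Q x) ->
  (ess_sup (mrestr leb (measurable_itv `]0%R, T[))
     (fun t => \int[mu]_x (`|u (x, t)| * Q x)%:E) < +oo)%E ->
  exists W w, solution_slices W w.
Proof.
move=> c0 mQ Qom /ae_bound_of_ess_sup [M M0 hM].
pose ut := u \_ cyl.
have mut : measurable_fun setT ut.
  by apply/(measurable_restrictT u (cylinder_measurable T)).
pose N (t : measurableTypeR R) : \bar R := (\int[mu]_y (`|ut (y, t)| * om y)%:E)%E.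
have mjoint : measurable_fun setT (fun z : VR => (`|ut z| * om z.1)%:E).
  apply/measurable_EFinP; apply: measurable_funM.
    exact: (measurableT_comp (@normr_measurable R setT) mut).
  exact: measurableT_comp.
have mN : measurable_fun setT N.
  apply: (measurable_int_fst mu (f := fun y (t : measurableTypeR R) => (`|ut (y, t)| * om y)%:E)).
    by apply: (eq_measurable_fun _ _ mjoint) => -[y t].
  by move=> y t; rewrite lee_fin mulr_ge0.
pose W := M / c.
(* the good times, measurable because the norm is a partial integral *)
pose S : set (measurableTypeR R) := N @^-1` [set x | (x <= W%:E)%E].
have mS : measurable S.
  rewrite -[S]setTI; apply: mN => //.
  rewrite (_ : [set x | _] = `]-oo, W%:E]%classic); first exact: emeasurable_itv.
  by apply/seteqP; split => x; rewrite /= in_itv.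
exists W, (fun y t => ut (y, t) * \1_S t); split.
- apply: measurable_funM.
    by apply: (eq_measurable_fun _ _ mut) => -[y t].
  apply: (measurableT_comp (f := \1_S : measurableTypeR R -> R)) => //.
- move=> t; under eq_integral do rewrite indicE.
  case: (boolP (t \in S)) => tS.
    apply: le_trans (_ : (N t <= W%:E)%E); last by have := set_mem tS.
    by under eq_integral do rewrite mulr1.
  rewrite (eq_integral (cst 0%E)) => [|y _]; last by rewrite mulr0 normr0 mul0r.
  by rewrite integral0 lee_fin divr_ge0// ltW.
- by move=> y t tT; rewrite /ut cyl_out// mul0r.
apply: aeS hM => t ht tT y; rewrite /ut cyl_in// indicE mem_set ?mulr1//.
have mt : measurable_fun setT (fun y : V => ut (y, t)).
  exact: (measurableT_comp mut (pair2_measurable (t : measurableTypeR R))).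
have mt' : measurable_fun setT (fun y : V => u (y, t)).
  by apply: (eq_measurable_fun _ _ mt) => z _; rewrite /ut cyl_in.
rewrite /S /= /N (_ : W%:E = (c^-1%:E * M%:E)%E); last by rewrite -EFinM mulrC.
apply: (@le_trans _ _ (\int[mu]_x (c^-1 * (`|u (x, t)| * Q x))%:E)%E).
  apply: ge0_intle; [by meas|by meas|by move=> z; rewrite mulr_ge0|] => z.
  by rewrite /ut cyl_in// mulrCA ler_wpM2l// ler_pdivlMl.
have Q0 z : 0 <= Q z by rewrite (le_trans _ (Qom z))// mulr_ge0// ltW.
rewrite ge0_intZ; [|by rewrite invr_ge0 ltW|by meas|by move=> z; rewrite mulr_ge0].
by apply: lee_wpmul2l; [rewrite lee_fin invr_ge0 ltW|exact: ht].
Qed.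

End solution_slices.

Section solution_equation.
Context {R : realType} {d : nat}.
Notation V := 'rV[R]_d.
Notation mu := (@lebesgue_rV R d).
Notation leb := (@lebesgue_measure R).
Notation VR := (V * measurableTypeR R)%type.
Variables (a : R -> R) (D C : R) (K : V -> R).
Hypothesis kp : kernel_profile a D C K.
Notation om := (decay_weight a).
Let om0 x : 0 <= om x := ltW (om_gt0 kp x).
Let mom : measurable_fun setT om := measurable_om kp.
Variables (T W : R) (u : VR -> R) (w : V -> R -> R).
Hypothesis T0 : 0 < T.
Hypothesis sl : solution_slices a T u W w.

Let mw : measurable_fun setT (fun z : VR => w z.1 z.2). Proof. by have [] := sl. Qed.
Let wW t : (\int[mu]_y (`|w y t| * om y)%:E <= W%:E)%E. Proof. by have [] := sl. Qed.
Let wout y t : ~~ (0 < t < T) -> w y t = 0. Proof. by have [_ _ + _] := sl; apply. Qed.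
Let wu : {ae leb, forall t, 0 < t < T -> forall y, w y t = u (y, t)}. Proof. by have [] := sl. Qed.

Let mwt t : measurable_fun setT (w ^~ t).
Proof. exact: (measurableT_comp mw (pair2_measurable (t : measurableTypeR R))). Qed.

Let wfin t : (\int[mu]_y (`|w y t| * om y)%:E < +oo)%E.
Proof. by rewrite (le_lt_trans (wW t))// ltry. Qed.

Let W0 : 0 <= W.
Proof. by rewrite -lee_fin (le_trans _ (wW 0))// int_ge0// => y; rewrite mulr_ge0. Qed.

Let ind (t : R) : R := \1_(`]0, T[%classic) t.
Let mind : measurable_fun setT ind. Proof. exact: measurable_indic. Qed.
Let ind0 t : 0 <= ind t. Proof. by rewrite /ind indicE. Qed.
Let ind_lty : (\int[leb]_t (ind t)%:E < +oo)%E.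
Proof.
have -> : (\int[leb]_t (ind t)%:E = leb `]0%R, T[%classic)%E by rewrite integral_indic// setIT.
by rewrite lebesgue_measure_itv/= lte_fin; case: ifP => // _; rewrite -EFinB ltry.
Qed.

Let bounded_ind_integrable (f : R -> R) B : measurable_fun setT f -> 0 <= B ->
  (forall t, `|f t| <= B * ind t) -> leb.-integrable setT (EFin \o f).
Proof.
move=> mf B0 fB; apply: integrable_absP => //.
apply: (@le_lt_trans _ _ (\int[leb]_t (B * ind t)%:E)%E).
  apply: ge0_intle; [exact: (measurableT_comp (@normr_measurable R setT) mf)| |by []|exact: fB].
  exact: measurable_funM.
rewrite ge0_intZ; [|exact: B0|exact: mind|exact: ind0].
by rewrite lte_mul_pinfty.
Qed.


Lemma coef_mollify_integrable (c : R -> R) (g : V -> R) (A B : R) x :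
  measurable_fun setT c -> measurable_fun setT g ->
  0 <= A -> (forall t, `|c t| <= A * ind t) -> 0 <= B -> (forall z, `|g z| <= B * om z) ->
  leb.-integrable setT (EFin \o (fun t => c t * mollify (w ^~ t) g x)).
Proof.
move=> mc mg A0 cA B0 gB; have [A' A'0 gA] := mollify_bounded kp mw wW x mg B0 gB.
apply: (bounded_ind_integrable (B := A * A')); last 2 first.
- exact: mulr_ge0.
- by move=> t; rewrite normrM mulrAC ler_pM.
apply: measurable_funM => //.
exact: (measurableT_comp (measurable_mollify_joint mw mg) (pair1_measurable x)).
Qed.

(** Fubini's theorem; the integrand is dominated by
    [|w y t| om y] times the indicator of [(0, T)]. *)
Lemma separated_integral (c1 c2 : R -> R) (g1 g2 : V -> R) (A B1 B2 : R) x :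
  measurable_fun setT c1 -> measurable_fun setT c2 ->
  measurable_fun setT g1 -> measurable_fun setT g2 ->
  0 <= A -> (forall t, `|c1 t| <= A * ind t) -> (forall t, `|c2 t| <= A * ind t) ->
  0 <= B1 -> (forall z, `|g1 z| <= B1 * om z) -> 0 <= B2 -> (forall z, `|g2 z| <= B2 * om z) ->
  \int[@lebesgue_xt R d]_z (w z.1 z.2 * (c1 z.2 * g1 (x - z.1) - c2 z.2 * g2 (x - z.1))) = 0 ->
  \int[leb]_t (c1 t * mollify (w ^~ t) g1 x) = \int[leb]_t (c2 t * mollify (w ^~ t) g2 x).
Proof.
move=> mc1 mc2 mg1 mg2 A0 h1 h2 B10 gB1 B20 gB2.
pose F y t := w y t * (c1 t * g1 (x - y) - c2 t * g2 (x - y)).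
have [b1 gb1] := om_le_shift kp x gB1 B10.
have [b2 gb2] := om_le_shift kp x gB2 B20.
have nn b (g : V -> R) : (forall y, `|g y| <= b * om y) -> 0 <= b.
  by move=> /(_ 0) h; have := le_trans (normr_ge0 _) h; rewrite pmulr_lge0// (om_gt0 kp).
have b10 := nn _ _ gb1; have b20 := nn _ _ gb2.
have mgx (g : V -> R) : measurable_fun setT g -> measurable_fun setT (fun z : VR => g (x - z.1)).
  move=> mg; apply: (measurableT_comp mg); apply: measurable_rVB => //.
have mcx (c : R -> R) : measurable_fun setT c -> measurable_fun setT (fun z : VR => c z.2).
  by move=> mc; apply: (measurableT_comp mc).
have mF : measurable_fun setT (fun z : VR => F z.1 z.2).
  apply: measurable_funM => //; apply: measurable_funB; apply: measurable_funM.
  - exact: mcx. - exact: mgx. - exact: mcx. - exact: mgx.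
have mFa : measurable_fun setT (fun z : VR => (`|F z.1 z.2|)%:E).
  by apply/measurable_EFinP; exact: (measurableT_comp (@normr_measurable R setT) mF).
have mFt t : measurable_fun setT (F ^~ t).
  exact: (measurableT_comp mF (pair2_measurable (t : measurableTypeR R))).
pose B := A * (b1 + b2).
have B0 : 0 <= B by rewrite mulr_ge0 ?addr_ge0.
have FB y t : `|F y t| <= B * ind t * (`|w y t| * om y).
  rewrite normrM mulrCA ler_wpM2l// (le_trans (ler_normB _ _))//.
  rewrite /B mulrDr !mulrDl !normrM lerD//.
    by apply: le_trans (ler_pM _ _ (h1 t) (gb1 y)) _ => //; rewrite mulrACA mulrA.
  by apply: le_trans (ler_pM _ _ (h2 t) (gb2 y)) _ => //; rewrite mulrACA mulrA.
have Fy t : (\int[mu]_y (`|F y t|)%:E <= (B * W * ind t)%:E)%E.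
  apply: (@le_trans _ _ (\int[mu]_y (B * ind t * (`|w y t| * om y))%:E)%E).
    have mt := mwt t; have mft := mFt t.
    by apply: ge0_intle; [by meas|by meas|by []|move=> y].
  have mt := mwt t.
  rewrite ge0_intZ; [|by rewrite mulr_ge0|by meas|by move=> y; rewrite mulr_ge0].
  rewrite (_ : B * W * ind t = B * ind t * W); last by rewrite mulrAC.
  by rewrite [leRHS]EFinM; apply: lee_wpmul2l => //; rewrite lee_fin; exact: mulr_ge0.
have Fint : (@lebesgue_xt R d).-integrable setT (EFin \o (fun z : VR => F z.1 z.2)).
  apply: integrable_absP => //.
  rewrite /lebesgue_xt (tonelli_prod mu leb (f := fun y (t : measurableTypeR R) => (`|F y t|)%:E))//.
  rewrite (tonelli_swap mu leb (f := fun y (t : measurableTypeR R) => (`|F y t|)%:E))//.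
  apply: (@le_lt_trans _ _ (\int[leb]_t (B * W * ind t)%:E)%E).
    apply: ge0_le_integral => //.
    - by move=> t _; rewrite int_ge0.
    - exact: (measurable_int_fst mu (f := fun y (t : measurableTypeR R) => (`|F y t|)%:E)).
    - by apply/measurable_EFinP; apply: measurable_funM.
  rewrite ge0_intZ; [|by rewrite mulr_ge0|exact: mind|exact: ind0].
  by rewrite lte_mul_pinfty// lee_fin mulr_ge0.
have i1 t := mollify_int kp (mwt t) (wfin t) x mg1 gB1 B10.
have i2 t := mollify_int kp (mwt t) (wfin t) x mg2 gB2 B20.
have Fslice t : \int[mu]_y F y t = c1 t * mollify (w ^~ t) g1 x - c2 t * mollify (w ^~ t) g2 x.
  rewrite /mollify -!RintegralZl// -RintegralB//.
  - by apply: eq_Rintegral => y _; rewrite /F; ring.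
  - by have := integrableZl measurableT (c1 t) (i1 t).
  - by have := integrableZl measurableT (c2 t) (i2 t).
have FiT t : mu.-integrable setT (EFin \o (F ^~ t)).
  apply: integrable_absP => //; exact: (le_lt_trans (Fy t) (ltry _)).
have -> : \int[@lebesgue_xt R d]_z F z.1 z.2 = \int[leb]_t (\int[mu]_y F y t) :> R.
  rewrite /Rintegral; congr fine.
  rewrite -(integral12_prod_meas1 Fint) (Fubini Fint).
  by apply: eq_integral => t _; rewrite -(Rint_fin (FiT t)).
under eq_Rintegral do rewrite Fslice.
have j1 := coef_mollify_integrable x mc1 mg1 A0 h1 B10 gB1.
have j2 := coef_mollify_integrable x mc2 mg2 A0 h2 B20 gB2.
rewrite (RintegralB measurableT j1 j2).
by move/eqP; rewrite subr_eq0 => /eqP.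
Qed.

(** The weak formulation for [test_fun]. The term [lam coef2 psi] of the time
    derivative and the nonlocal operator combine into [killed_op]. *)
Lemma slices_weak del e x al b et : very_weak_solution K T u ->
  0 < del -> 0 < e -> e <= 1 -> 0 < al -> al < b -> 0 < et -> b + et < T ->
  let H t := coef1 al b et (far_mass K e) t * mollify (w ^~ t) (cbump del) x in
  let B t := coef2 al b et (far_mass K e) t * mollify (w ^~ t) (killed_op K (cbump del) e) x in
  [/\ leb.-integrable setT (EFin \o H), leb.-integrable setT (EFin \o B) &
    \int[leb]_t H t = \int[leb]_t B t].
Proof.
move=> [[mu_ _] ue] del0 e0 e1 al0 alb et0 bT H B; rewrite {}/H {}/B.
set lam := far_mass K e.
have [_ eq] := ue _ (@test_funP R d T del lam et al b x del0 et0 al0 alb bT).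
have [M bM] := @cbump_bump R d _ del0.
have [B1 B10 gB1] := bump_le_om kp bM.
have [B2 B20 gB2] := killed_op_le_om kp bM e0 e1.
have lam0 : 0 <= lam by exact: (far_mass_ge0 kp).
have [A A0 hA] := @coefs_bounded R T al b et lam al0 alb et0 bT lam0.
have mg1 := bump_meas bM.
have mg2 := measurable_killed_op kp bM e0 e1.
have mc1 := @measurable_coef1 R al b et lam.
have mc2 := @measurable_coef2 R al b et lam.
have h1 t := (hA t).1; have h2 t := (hA t).2.
split; first exact: (coef_mollify_integrable x mc1 mg1 A0 h1 (ltW B10) gB1).
  exact: (coef_mollify_integrable x mc2 mg2 A0 h2 B20 gB2).
apply: (separated_integral mc1 mc2 mg1 mg2 A0 h1 h2 (ltW B10) gB1 B20 gB2).
rewrite -[RHS]eq [RHS]Rintegral_mkcond /Rintegral; congr fine.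
pose k (z : VR) : R := coef1 al b et lam z.2 * cbump del (x - z.1) -
  coef2 al b et lam z.2 * killed_op K (cbump del) e (x - z.1).
have mgx (g : V -> R) : measurable_fun setT g -> measurable_fun setT (fun z : VR => g (x - z.1)).
  by move=> mg; apply: (measurableT_comp mg); apply: measurable_rVB.
have mcx (c : R -> R) : measurable_fun setT c -> measurable_fun setT (fun z : VR => c z.2).
  by move=> mc; apply: (measurableT_comp mc).
have mk : measurable_fun setT k.
  by apply: measurable_funB; apply: measurable_funM; [exact: mcx|exact: mgx|exact: mcx|exact: mgx].
have kE z : time_derive (test_fun del lam et al b x) z -
    nonlocal_op_x K (test_fun del lam et al b x) z = k z.
  by rewrite time_derive_test_fun (nonlocal_test_fun kp)// /k /killed_op -/lam; ring.
have mut : measurable_fun setT (u \_ (cylinder T)).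
  by apply/(measurable_restrictT u (cylinder_measurable T)).
transitivity (\int[@lebesgue_xt R d]_z ((u \_ (cylinder T)) z * k z)%:E)%E; last first.
  by apply: eq_integral => z _; rewrite !patchE; case: ifP => _; rewrite ?mul0r// kE.
apply: ae_eq_integral => //.
- by apply/measurable_EFinP; apply: measurable_funM.
- by apply/measurable_EFinP; apply: measurable_funM.
apply: (aeS _ (@ae_time_slices R d _ wu)) => -[y t] /= h _; congr EFin.
have [tT|tT] := boolP (0 < t < T); first by rewrite h// cyl_in.
by rewrite wout// cyl_out// !mul0r.
Qed.

Lemma slices_trace (mu0 : radon_measure R d) del e x : has_initial_trace u mu0 ->
  0 < del -> 0 < e -> exists2 tau : R, 0 < tau &
  {ae leb, forall t, 0 < t < tau ->
    `|mollify (w ^~ t) (cbump del) x - mu0 (fun y => cbump del (x - y))| <= e}.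
Proof.
move=> tr del0 e0; have [N nN cv] := tr _ (Cc_cbump x del0).
have /cvgrPdist_le /(_ e e0) [r r0 h] := cv.
exists (Num.min r T); first by rewrite lt_min T0 andbT.
have nN' : {ae leb, forall t, ~ N t}.
  have [N' [mN' N'0 NN]] := nN; exists N'; split => // t /= ht; apply: NN.
  exact: contrapT.
apply: (aeS2 _ nN' wu) => t nt wt; rewrite lt_min => /andP[t0 /andP[tr' tT]].
rewrite distrC; have := h t _ t0 nt; rewrite /ball_/= sub0r normrN ger0_norm ?(ltW t0)//.
move=> /(_ tr'); congr (`|_ - _| <= _).
by apply: eq_Rintegral => y _; rewrite wt ?t0// mulrC.
Qed.

End solution_equation.


(** * Uniqueness *)

Theorem corollary3p6 (R : realType) (d : nat) (T : R)
    (K : 'rV[R]_d -> R) (P : R -> 'rV[R]_d -> R)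
    (mu0 : radon_measure R d) (u v : 'rV[R]_d * R -> R) :
  (0 < d)%N -> 0 < T ->
  mixed_growth_kernel K -> is_heat_kernel K P ->
  very_weak_solution K T u -> Linfty_L1P1 P T u -> has_initial_trace u mu0 ->
  very_weak_solution K T v -> Linfty_L1P1 P T v -> has_initial_trace v mu0 ->
  u = v %[ae lebesgue_xt in cylinder T].
Proof.
move=> d0 T0 Kmg hP su Lu tru sv Lv trv.
have [a [D [C kp]]] := mixed_growth_profile d0 Kmg.
have [cP P0 P1 Pcos Psin] := hP 1 ltr01.
have Pcos' xi : \int[lebesgue_rV d]_x (cos (dotv xi x) * P 1 x) = expR (- levy_symbol K xi).
  by rewrite Pcos mul1r.
have [c c0 Pom] := heat_lower kp d0 cP P0 P1 Pcos' Psin.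
have mP := continuous_measurable_rV cP.
have [W1 [w1 s1]] := slices_of_bound kp su.1.1 c0 mP Pom Lu.
have [W2 [w2 s2]] := slices_of_bound kp sv.1.1 c0 mP Pom Lv.
have [mw1 wW1 wout1 wu1] := s1; have [mw2 wW2 wout2 wu2] := s2.
have mom := measurable_om kp.
have om0 x : 0 <= decay_weight a x := ltW (om_gt0 kp x).
pose w y t := w1 y t - w2 y t.
have mw : measurable_fun setT (fun z : 'rV[R]_d * measurableTypeR R => w z.1 z.2).
  exact: measurable_funB.
have slice (f : 'rV[R]_d -> R -> R) t : measurable_fun setT (fun z : 'rV[R]_d * measurableTypeR R => f z.1 z.2) ->
    measurable_fun setT (f ^~ t).
  by move=> mf; exact: (measurableT_comp mf (pair2_measurable (t : measurableTypeR R))).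
have wW t : (\int[lebesgue_rV d]_y (`|w y t| * decay_weight a y)%:E <= (W1 + W2)%:E)%E.
  have m1 := slice _ t mw1; have m2 := slice _ t mw2.
  apply: (@le_trans _ _ (\int[lebesgue_rV d]_y (`|w1 y t| * decay_weight a y + `|w2 y t| * decay_weight a y)%:E)%E).
    rewrite /w; apply: ge0_intle; [by meas|by meas|by move=> y; rewrite mulr_ge0|] => y.
    by rewrite -mulrDl ler_wpM2r// ler_normB.
  rewrite ge0_intD; [|by meas|by meas|by move=> y; rewrite mulr_ge0|by move=> y; rewrite mulr_ge0].
  by rewrite EFinD leeD.
have wout y t : ~~ (0 < t < T) -> w y t = 0.
  by move=> tT; rewrite /w wout1// wout2// subrr.
have fin1 t := le_lt_trans (wW1 t) (ltry W1).
have fin2 t := le_lt_trans (wW2 t) (ltry W2).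
have mollB (g : 'rV[R]_d -> R) B x t : measurable_fun setT g -> 0 <= B ->
    (forall z, `|g z| <= B * decay_weight a z) ->
    mollify (w ^~ t) g x = mollify (w1 ^~ t) g x - mollify (w2 ^~ t) g x.
  move=> mg B0 gB; have i1 := mollify_int kp (slice _ t mw1) (fin1 t) x mg gB B0.
  have i2 := mollify_int kp (slice _ t mw2) (fin2 t) x mg gB B0.
  rewrite /mollify -(RintegralB measurableT i1 i2).
  by apply: eq_Rintegral => y _; rewrite /w mulrBl.
have w0 : {ae lebesgue_measure, forall t, {ae lebesgue_rV d, forall y, w y t = 0}}.
  apply: (homogeneous_uniqueness kp T0 mw wW wout).
    move=> del e x al b et del0 e0 e1 al0 alb et0 bT.
    have [M bM] := @cbump_bump R d _ del0.
    have [B1 B10 gB1] := bump_le_om kp bM.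
    have [B2 B20 gB2] := killed_op_le_om kp bM e0 e1.
    have mg2 := measurable_killed_op kp bM e0 e1.
    have [i1 j1 e1'] := slices_weak kp s1 x su del0 e0 e1 al0 alb et0 bT.
    have [i2 j2 e2'] := slices_weak kp s2 x sv del0 e0 e1 al0 alb et0 bT.
    have H t : (dustep ((t - al) / et) / et - dustep ((t - b) / et) / et) *
        (expR (far_mass K e * t) * mollify (w ^~ t) (cbump del) x) =
      coef1 al b et (far_mass K e) t * mollify (w1 ^~ t) (cbump del) x -
      coef1 al b et (far_mass K e) t * mollify (w2 ^~ t) (cbump del) x.
      by rewrite (mollB _ _ _ _ (bump_meas bM) (ltW B10) gB1) mulrA -mulrBr.
    have B t : (ustep ((t - al) / et) - ustep ((t - b) / et)) *
        (expR (far_mass K e * t) * mollify (w ^~ t) (killed_op K (cbump del) e) x) =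
      coef2 al b et (far_mass K e) t * mollify (w1 ^~ t) (killed_op K (cbump del) e) x -
      coef2 al b et (far_mass K e) t * mollify (w2 ^~ t) (killed_op K (cbump del) e) x.
      by rewrite (mollB _ _ _ _ mg2 B20 gB2) mulrA -mulrBr.
    under eq_Rintegral do rewrite H; under [RHS]eq_Rintegral do rewrite B.
    by rewrite (RintegralB measurableT i1 i2) (RintegralB measurableT j1 j2) e1' e2'.
  move=> del x e del0 e0; have e20 : 0 < e / 2 by rewrite divr_gt0.
  have [M bM] := @cbump_bump R d _ del0.
  have [B1 B10 gB1] := bump_le_om kp bM.
  have [t1 t10 h1] := slices_trace T0 s1 x tru del0 e20.
  have [t2 t20 h2] := slices_trace T0 s2 x trv del0 e20.
  exists (Num.min t1 t2); first by rewrite lt_min t10.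
  apply: (aeS2 _ h1 h2) => t {}h1 {}h2; rewrite lt_min => /andP[t0 /andP[tt1 tt2]].
  rewrite (mollB _ _ _ _ (bump_meas bM) (ltW B10) gB1).
  set m := mu0 _ in h1 h2.
  rewrite (_ : _ - _ = (mollify (w1 ^~ t) (cbump del) x - m) - (mollify (w2 ^~ t) (cbump del) x - m)).
    by rewrite (le_trans (ler_normB _ _))// [leRHS]splitr lerD ?h1 ?h2 ?t0.
  by ring.
have h0 := ae_xt_zero mw w0.
have h12 := aeS2 (fun t p q => conj p q) wu1 wu2.
apply: (aeS2 _ h0 (@ae_time_slices R d _ h12)) => -[y t] /= {}h0 [h1 h2] [_ /=].
rewrite in_itv/= => tT; apply/eqP; rewrite -subr_eq0 -h1// -h2//.
by apply/eqP.
Qed.
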